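(* Fix real numbers $\vartheta\in(0,1)$ and $\Theta\in\mathbb{R}$. Then there exist $x_0$ and $C>0$ such that for all real $x\ge x_0$, \[ \left|S_{\vartheta,\Theta}(x)-(\log x)^{\Theta}S_\vartheta(x)\right|\le C\,(\log x)^{\Theta}S_\vartheta(x)\sqrt{\frac{\log\log x}{\log x}}. \]
   Context: For a natural number $m$, let $k(m)$ denote the largest square-free divisor of $m$. For $\vartheta>0$ and real $x\ge1$, let $S_\vartheta(x)$ be the number of natural numbers $m\le x$ with $k(m)\le m^{\vartheta}$. For $\vartheta\in(0,1)$ and $\Theta\in\mathbb{R}$, let $S_{\vartheta,\Theta}(x)$ be the number of integers $n$ with $2\le n\le x$ and $k(n)\le n^{\vartheta}(\log n)^{\Theta}$. *)

(* Defs.v *)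
From Stdlib Require Import Reals ZArith.
From mathcomp Require Import all_boot.

Definition rad (m : nat) : nat := \prod_(p <- primes m) p.

Definition Rleb (a b : R) : bool := if Rle_dec a b then true else false.

Definition nfloor (x : R) : nat := Z.to_nat (Int_part x).

Definition S_th (th x : R) : nat :=
  count (fun m => Rleb (INR (rad m)) (Rpower (INR m) th)) (iota 1 (nfloor x)).

Definition S_thTh (th Th x : R) : nat :=
  count (fun n => Rleb (INR (rad n)) (Rmult (Rpower (INR n) th) (Rpower (ln (INR n)) Th)))
        (iota 2 (nfloor x - 1)).

(* Main.v *)
(** Every [n] is uniquely [l * rad l * q] with [q] square-free and coprime to
    [l], and then [rad n = rad l * q].  For fixed [l] the conditions [n <= x] and
    [rad n <= kap * n ^ th] bound [q] by [kap x^th w(l / L) / rad l], where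
    [w u = min (u ^ (th / (1 - th)), 1 / u)] and [L = x^(1 - th) / kap].  Sieving
    the [q] gives that the count is, up to a constant independent of [kap],
    [kap x^th V(L)] with [V(L) = sum_l w(l / L) / psi l] ([hsum]) and
    [psi l = prod_(p | l) (p + 1)].  So everything reduces to
    [V(L') = V(L) (1 + O(sqrt (log log x / log x)))] when [L' / L] is bounded by
    powers of [log x].

    Let [H_d(e^v)] ([psum]) be the sum of [1 / psi l] over [l <= e^v] coprime to [d], and
    [delta = 1 / sqrt (v log v)].  Expanding [log l] over the prime powers of [l],
    primes larger than [v] give [v H >= c (iterated integral of H) / log v], an
    inequality [J'' >= c delta^2 J] which integrates to [J' >= c delta J].
    Inserting this in the same expansion restricted to [(N / b, N]] gives
    [H_(d b) <= C delta H_d] for small primes [b], hence slow growth of [H_d], and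
    [H_(d p) <= C delta p log p H_d] for all [p].

    The exact relation [V_d(p L) - V_d(L) = V_(d p)(p L) - p / (p + 1) V_(d p)(L)],
    a Lipschitz bound from [p] to [p - 1] and induction (with the gain
    [V_(d p) <= V_d / 2]) give [V(n L) - V(L) = O(delta log n V)] for
    [n <= c / (delta log (1 / delta))].  Rational numbers with such numerators and
    denominators approximate any dilation factor well enough.

    The scale is indexed by [k], with [2 ^ k] comparable to [log x], so that
    [delta k = 1 / sqrt (k 2^k)]. *)

(* Only ratios are controlled: no asymptotic formula is derived for the count or for [psum], and the
   constant of the sieve cancels because it depends on [x] alone. The weight [hat] by itself is
   Lipschitz on the logarithmic scale only with a constant of order 1, which saves nothing. The
   saving [delta k] has to come from arithmetic, and an exact relation exists only for dilation by a
   prime. A dilation by a power of [log x] has logarithm of order [k], so it costs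
   [k * delta k = sqrt (k / 2 ^ k)], which is the error of the theorem.

   A second obstacle is that [V_d(L)] has the size of the mass of one block [(L / 2, L]]. That is
   the size of [psum (d * 2)], which is at most of order [delta k * psum d]. Bounding [V_d] by
   [psum d] would therefore lose exactly what is to be gained. This is why one of the primes 2, 3, 5
   is kept free throughout and why upper bounds are stated with [psum (d * b)]. Errors arising at
   different scales are measured against the sum at one fixed top scale [Ls], so that they can be
   added. *)
Require Import Defs.
From HB Require Import structures.
From Stdlib Require Import Reals Lra Lia Psatz.
From mathcomp Require Import all_boot zify.
Open Scope R_scope.
Set Implicit Arguments. Unset Strict Implicit. Unset Printing Implicit Defensive.
(* [zify] loads [ring_scope], which takes over the key [%R]. *)
Delimit Scope R_scope with Re.

(** * Finite sums and products of reals *)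

HB.instance Definition _ := Monoid.isComLaw.Build R 0 Rplus
  (fun x y z => esym (Rplus_assoc x y z)) Rplus_comm Rplus_0_l.
HB.instance Definition _ := Monoid.isComLaw.Build R 1 Rmult
  (fun x y z => esym (Rmult_assoc x y z)) Rmult_comm Rmult_1_l.
HB.instance Definition _ := Monoid.isMulLaw.Build R 0 Rmult Rmult_0_l Rmult_0_r.
HB.instance Definition _ := Monoid.isAddLaw.Build R Rmult Rplus
  (fun x y z => Rmult_plus_distr_r x y z) (fun x y z => Rmult_plus_distr_l x y z).

Notation "\sum_ ( i <- r | P ) F" :=
  (\big[Rplus/R0]_(i <- r | P%B) F%Re) : R_scope.
Notation "\sum_ ( i <- r ) F" :=
  (\big[Rplus/R0]_(i <- r) F%Re) : R_scope.
Notation "\sum_ ( m <= i < n | P ) F" :=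
  (\big[Rplus/R0]_(m%N <= i < n%N | P%B) F%Re) : R_scope.
Notation "\sum_ ( m <= i < n ) F" :=
  (\big[Rplus/R0]_(m%N <= i < n%N) F%Re) : R_scope.
Notation "\prod_ ( i <- r | P ) F" :=
  (\big[Rmult/R1]_(i <- r | P%B) F%Re) : R_scope.
Notation "\prod_ ( i <- r ) F" :=
  (\big[Rmult/R1]_(i <- r) F%Re) : R_scope.
Notation "\prod_ ( m <= i < n | P ) F" :=
  (\big[Rmult/R1]_(m%N <= i < n%N | P%B) F%Re) : R_scope.

Lemma rsum_ge0 (I : Type) (r : seq I) (P : pred I) (F : I -> R) :
  (forall i, P i -> 0 <= F i) -> 0 <= \sum_(i <- r | P i) F i.
Proof.
move=> h; apply: (big_ind (fun x => 0 <= x)) => //; first lra.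
by move=> x y; lra.
Qed.

Lemma rsum_le (I : Type) (r : seq I) (P : pred I) (F G : I -> R) :
  (forall i, P i -> F i <= G i) -> \sum_(i <- r | P i) F i <= \sum_(i <- r | P i) G i.
Proof.
move=> h; apply: (big_ind2 (fun x y => x <= y)) => //; first lra.
by move=> x y z t; lra.
Qed.

Lemma rsum_le_seq (I : eqType) (r : seq I) (P : pred I) (F G : I -> R) :
  (forall i, i \in r -> P i -> F i <= G i) ->
  \sum_(i <- r | P i) F i <= \sum_(i <- r | P i) G i.
Proof.
move=> h; rewrite big_seq_cond [X in _ <= X]big_seq_cond.
by apply: rsum_le => i /andP[]; exact: h.
Qed.

Lemma rsum_le_nat (m n : nat) (P : pred nat) (F G : nat -> R) :
  (forall i, (m <= i < n)%N -> P i -> F i <= G i) ->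
  \sum_(m <= i < n | P i) F i <= \sum_(m <= i < n | P i) G i.
Proof. by move=> h; apply: rsum_le_seq => i; rewrite mem_index_iota; exact: h. Qed.

Lemma rsum_le_pred (I : eqType) (r : seq I) (P Q : pred I) (F : I -> R) :
  (forall i, i \in r -> P i -> Q i) -> (forall i, i \in r -> Q i -> 0 <= F i) ->
  \sum_(i <- r | P i) F i <= \sum_(i <- r | Q i) F i.
Proof.
move=> hPQ hF; rewrite [X in _ <= X](bigID P) /= -[X in X <= _]Rplus_0_r.
apply: Rplus_le_compat.
  apply: Req_le; rewrite big_seq_cond [RHS]big_seq_cond; apply: eq_bigl => i.
  case ir: (i \in r) => //=; case Pi: (P i) => //=; first by rewrite hPQ.
  by rewrite andbF.
rewrite big_seq_cond; apply: rsum_ge0 => i /and3P[]; by move=> *; exact: hF.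
Qed.

Lemma rsum_mulr (I : Type) (r : seq I) (P : pred I) (F : I -> R) (c : R) :
  \sum_(i <- r | P i) (c * F i) = c * \sum_(i <- r | P i) F i.
Proof. by rewrite big_distrr. Qed.

Lemma rsum_mull (I : Type) (r : seq I) (P : pred I) (F : I -> R) (c : R) :
  \sum_(i <- r | P i) (F i * c) = (\sum_(i <- r | P i) F i) * c.
Proof. by rewrite big_distrl. Qed.

Lemma rsum_opp (I : Type) (r : seq I) (P : pred I) (F : I -> R) :
  \sum_(i <- r | P i) (- F i) = - \sum_(i <- r | P i) F i.
Proof.
rewrite (eq_bigr (fun i => (-1) * F i)); last by move=> i _; lra.
by rewrite rsum_mulr; lra.
Qed.

Lemma rsum_sub (I : Type) (r : seq I) (P : pred I) (F G : I -> R) :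
  \sum_(i <- r | P i) (F i - G i) = \sum_(i <- r | P i) F i - \sum_(i <- r | P i) G i.
Proof. by rewrite /Rminus big_split rsum_opp. Qed.

Lemma rsum_const_le (I : Type) (r : seq I) (P : pred I) (c : R) :
  0 <= c -> \sum_(i <- r | P i) c <= INR (size r) * c.
Proof.
move=> c0; elim: r => [|a r IH]; first by rewrite big_nil /=; lra.
rewrite big_cons [size _]/= S_INR; case: (P a); lra.
Qed.

Lemma rsum_abs (I : Type) (r : seq I) (P : pred I) (F : I -> R) :
  Rabs (\sum_(i <- r | P i) F i) <= \sum_(i <- r | P i) Rabs (F i).
Proof.
apply: (big_ind2 (fun x y => Rabs x <= y)); [by rewrite Rabs_R0; lra | | by move=> *; lra].
move=> x y z t hx hz; have := Rabs_triang x z; lra.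
Qed.

Lemma INR_sum_bool (I : Type) (r : seq I) (P : pred I) :
  INR (count P r) = \sum_(i <- r | P i) 1.
Proof.
elim: r => [|a r IH]; first by rewrite big_nil.
by rewrite big_cons /= plus_INR IH; case: (P a) => /=; lra.
Qed.

Lemma rprod_pos (I : Type) (r : seq I) (P : pred I) (F : I -> R) :
  (forall i, P i -> 0 < F i) -> 0 < \prod_(i <- r | P i) F i.
Proof.
move=> h; apply: (big_ind (fun x => 0 < x)) => //; first lra.
by move=> x y; apply: Rmult_lt_0_compat.
Qed.

Lemma ln_rprod (I : Type) (r : seq I) (P : pred I) (F : I -> R) :
  (forall i, P i -> 0 < F i) ->
  ln (\prod_(i <- r | P i) F i) = \sum_(i <- r | P i) ln (F i).
Proof.
move=> h; elim: r => [|a r IH]; first by rewrite !big_nil ln_1.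
rewrite !big_cons; case Pa: (P a) => //.
by rewrite ln_mult ?IH //; [exact: h | exact: rprod_pos].
Qed.

Lemma INR_prod (I : Type) (r : seq I) (P : pred I) (F : I -> nat) :
  INR (\prod_(i <- r | P i) F i)%N = \prod_(i <- r | P i) INR (F i).
Proof.
apply: (big_ind2 (fun (n : nat) x => INR n = x)) => //.
by move=> m x n y <- <-; rewrite -mult_INR.
Qed.

(** * Casts to the reals, logarithms, and sums over multiples or subranges *)

Lemma INR_le m n : (m <= n)%N -> INR m <= INR n.
Proof. by move=> /leP; exact: le_INR. Qed.

Lemma INR_lt m n : (m < n)%N -> INR m < INR n.
Proof. by move=> /ltP; exact: lt_INR. Qed.

Lemma INR_pos n : (0 < n)%N -> 0 < INR n.
Proof. by move=> /INR_lt. Qed.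

Lemma INR_ge1 n : (0 < n)%N -> 1 <= INR n.
Proof. by move=> /INR_le. Qed.

Lemma INR_exp m n : INR (m ^ n)%N = INR m ^ n.
Proof. by elim: n => [|n IH] //; rewrite expnS mult_INR IH. Qed.

Lemma INR_prime_ge2 p : prime p -> 2 <= INR p.
Proof. by move=> /prime_gt1 /INR_le. Qed.

Lemma ln_le x y : 0 < x -> x <= y -> ln x <= ln y.
Proof. by move=> x0 [xy|->]; [left; exact: ln_increasing | lra]. Qed.

Lemma ln_ge0 x : 1 <= x -> 0 <= ln x.
Proof. by move=> h; rewrite -ln_1; apply: ln_le; lra. Qed.

Lemma ln_INR_ge0 n : 0 <= ln (INR n).
Proof.
case: n => [|n]; last by apply: ln_ge0; exact: INR_ge1.
rewrite /ln; case: (Rlt_dec 0 (INR 0)) => [h|_]; last lra.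
by exfalso; move: h; rewrite /=; lra.
Qed.

Lemma divn_INR m d : (0 < d)%N -> INR (m %/ d) <= INR m / INR d.
Proof.
move=> d0; have dp := INR_pos d0.
apply: (Rmult_le_reg_r (INR d)) => //.
rewrite -mult_INR /Rdiv Rmult_assoc Rinv_l ?Rmult_1_r; last lra.
exact/INR_le/leq_divM.
Qed.

Lemma sum_multiples (f : nat -> R) (P : pred nat) (p M : nat) : (0 < p)%N ->
  \sum_(1 <= l < M.+1 | (p %| l)%N && P l) f l =
  \sum_(1 <= m < (M %/ p).+1 | P (p * m)%N) f (p * m)%N.
Proof.
move=> p0; elim: M => [|M IH]; first by rewrite div0n !big_geq.
rewrite big_mkcond big_nat_recr //= -big_mkcond IH divnS //.
case: (boolP (p %| M.+1)%N) => h /=; last by rewrite add0n Rplus_0_r.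
rewrite add1n [in RHS]big_mkcond [in RHS]big_nat_recr //= -big_mkcond.
suff -> : (p * (M %/ p).+1 = M.+1)%N by [].
have := divnS M p0; rewrite h /= add1n => <-.
by rewrite mulnC divnK.
Qed.

Lemma rsum_cat_nat n m p (P : pred nat) (F : nat -> R) : (m <= n)%N -> (n <= p)%N ->
  \sum_(m <= i < p | P i) F i = \sum_(m <= i < n | P i) F i + \sum_(n <= i < p | P i) F i.
Proof. by move=> mn np; rewrite (big_cat_nat mn np). Qed.

Lemma rsum_recr m n (P : pred nat) (F : nat -> R) : (m <= n)%N ->
  \sum_(m <= i < n.+1 | P i) F i = \sum_(m <= i < n | P i) F i + (if P n then F n else 0).
Proof. by move=> mn; rewrite big_mkcond big_nat_recr //= -big_mkcond. Qed.

(** * Chebyshev and Mertens type bounds *)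

Lemma ln2_gt : / 2 < ln 2.
Proof. exact: ln_lt_2. Qed.

Lemma ln2_lt1 : ln 2 < 1.
Proof.
rewrite -(ln_exp 1); apply: ln_increasing; first lra.
have := exp_ineq1 1 ltac:(lra); lra.
Qed.

Lemma ln_prime_gt0 p : prime p -> 0 < ln (INR p).
Proof.
move=> pp; have := INR_prime_ge2 pp => h.
have := @ln_le 2 (INR p) ltac:(lra) h; have := ln2_gt; lra.
Qed.

Lemma ln_pow2 m : ln (INR (2 ^ m)%N) = INR m * ln 2.
Proof. by rewrite INR_exp ln_pow //= ; lra. Qed.

Lemma rsum_sub_range (m n m' n' : nat) (P : pred nat) (F : nat -> R) :
  (m' <= m)%N -> (n <= n')%N -> (forall i, P i -> 0 <= F i) ->
  \sum_(m <= i < n | P i) F i <= \sum_(m' <= i < n' | P i) F i.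
Proof.
move=> mm nn F0; rewrite (big_nat_widen _ _ _ _ _ nn) (big_nat_widenl _ _ _ _ _ mm).
by apply: rsum_le_pred => i _; [case/andP=> /andP[] | exact: F0].
Qed.

(** The primes run up to any [N >= n], with zero terms beyond [n], so that one range of primes
    serves all the integers of a sum. *)
Lemma ln_logn n N : (0 < n <= N)%N ->
  ln (INR n) = \sum_(1 <= p < N.+1 | prime p) INR (logn p n) * ln (INR p).
Proof.
move=> /andP[n0 nN]; rewrite -{1}(partnT n0) /partn INR_prod.
(* The index 0 of [partn] contributes [0 ^ 0 = 1]. *)
rewrite big_nat_recl //=.
rewrite Rmult_1_l -(big_add1 R1 Rmult 0 n.+1 xpredT (fun i => INR (i ^ logn i n)%N)).
rewrite big_nat_cond ln_rprod; last first.
  by move=> i /andP[/andP[i0 _] _]; apply: INR_pos; rewrite expn_gt0 i0.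
rewrite -big_nat_cond.
have nN' : (n.+1 <= N.+1)%N by [].
rewrite (big_nat_widen _ _ _ _ _ nN') /=.
rewrite [LHS]big_mkcond [RHS]big_mkcond; apply: eq_big_nat => i /andP[i0 iN].
case: (boolP (prime i)) => [pi|npi].
  case: (ltnP i n.+1) => [h|h]; last first.
    rewrite [logn _ _](_ : _ = 0%N) ?Rmult_0_l //.
    by rewrite lognE pi n0 /=; case: ifP => // /(dvdn_leq n0); lia.
  rewrite INR_exp ln_pow //; exact: INR_pos.
rewrite [logn _ _](_ : _ = 0%N); last by rewrite lognE (negbTE npi).
by rewrite expn0 ln_1; case: ifP.
Qed.

Lemma bin_le_exp2 n m : ('C(n, m) <= 2 ^ n)%N.
Proof.
elim: n m => [|n IH] [|m]; rewrite ?bin0 ?bin0n ?expn_gt0 //.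
by rewrite binS expnS mul2n -addnn; apply: leq_add.
Qed.

Lemma prime_dvd_central_bin n p : prime p -> (n < p <= 2 * n)%N -> (p %| 'C(2 * n, n))%N.
Proof.
move=> pp /andP[np p2n].
have h : ('C(2 * n, n) * (n`! * (2 * n - n)`!) = (2 * n)`!)%N by apply: bin_fact; lia.
have d : (p %| (2 * n)`!)%N by apply: dvdn_fact; rewrite prime_gt0.
have nd m : (m < p)%N -> ~~ (p %| m`!)%N.
  elim: m => [|m IH] mp; first by rewrite fact0 dvdn1 -(negbK (p == 1%N)) neq_ltn prime_gt1 ?orbT.
  rewrite factS Euclid_dvdM // negb_or IH ?andbT; last by lia.
  by apply/negP => /(dvdn_leq (ltn0Sn m)); lia.
move: d; rewrite -h !Euclid_dvdM // (negbTE (nd n np)).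
have -> : (2 * n - n = n)%N by lia.
by rewrite (negbTE (nd n np)) !orbF.
Qed.

(** Every prime of [(n, 2n]] divides the central binomial coefficient, which is at most [4 ^ n]. *)
Lemma chebyshev_block n :
  \sum_(n.+1 <= p < (2 * n).+1 | prime p) ln (INR p) <= INR n * (2 * ln 2).
Proof.
(* [N] bounds both [C], as [ln_logn] requires, and the block of primes. *)
set C := 'C(2 * n, n); set N := maxn C (2 * n).
have C0 : (0 < C)%N by rewrite bin_gt0; lia.
have hC : (0 < C <= N)%N by rewrite C0 leq_maxl.
have e : ln (INR C) <= INR n * (2 * ln 2).
  have : INR C <= INR (2 ^ (2 * n))%N by apply/INR_le/bin_le_exp2.
  move/(ln_le (INR_pos C0)); rewrite ln_pow2 mult_INR /=; lra.
apply: Rle_trans e; rewrite (ln_logn hC).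
have h : (1 <= n.+1)%N by []. have h' : ((2 * n).+1 <= N.+1)%N by rewrite ltnS leq_maxr.
rewrite (big_nat_widen _ _ _ _ _ h') (big_nat_widenl _ _ _ _ _ h).
apply: (Rle_trans _ (\sum_(1 <= p < N.+1 | (prime p && (p < (2 * n).+1)%N) && (n < p)%N)
    INR (logn p C) * ln (INR p))).
  apply: rsum_le => p /andP[/andP[pp p2] pn].
  have : 1 <= INR (logn p C).
    apply: INR_ge1; rewrite logn_gt0 mem_primes pp C0 /=.
    by apply: prime_dvd_central_bin => //; rewrite pn.
  have := ln_prime_gt0 pp; nra.
apply: rsum_le_pred => i _; first by move=> /andP[/andP[]].
move=> _; apply: Rmult_le_pos; [exact: pos_INR | exact: ln_INR_ge0].
Qed.

Lemma INR_sum (I : Type) (r : seq I) (P : pred I) (F : I -> nat) :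
  INR (\sum_(i <- r | P i) F i)%N = \sum_(i <- r | P i) INR (F i).
Proof.
apply: (big_ind2 (fun (n : nat) x => INR n = x)) => //.
by move=> m x n y <- <-; rewrite -plus_INR.
Qed.

(** Legendre's formula without the floors is a geometric series; the induction keeps its exact
    partial sum. *)
Lemma logn_fact_le p n : prime p -> INR (logn p n`!) <= INR n / (INR p - 1).
Proof.
move=> pp; rewrite logn_fact // INR_sum.
have p2 := INR_prime_ge2 pp.
have h m : \sum_(1 <= k < m.+1) INR (n %/ p ^ k) <= INR n * (1 - (/ INR p) ^ m) / (INR p - 1).
  elim: m => [|m IH].
    by rewrite big_geq //= ; apply: Req_le; field; lra.
  rewrite big_nat_recr //=.
  have hd : INR (n %/ p ^ m.+1) <= INR n * (/ INR p) ^ m.+1.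
    have h0 : (0 < p ^ m.+1)%N by rewrite expn_gt0 prime_gt0.
    have := divn_INR n h0; rewrite INR_exp /Rdiv pow_inv //; lra.
  apply: (Rle_trans _ _ _ (Rplus_le_compat _ _ _ _ IH hd)).
  apply: Req_le; rewrite /=; field; lra.
apply: (Rle_trans _ _ _ (h n)).
have hn := pos_INR n.
have q0 : 0 <= (/ INR p) ^ n by apply: pow_le; left; apply: Rinv_0_lt_compat; lra.
apply: Rmult_le_compat_r; first by left; apply: Rinv_0_lt_compat; lra.
nra.
Qed.

Lemma ln_fact_ge n : INR n * ln (INR n) - INR n <= ln (INR n`!).
Proof.
elim: n => [|n IH]; first by rewrite /= ln_1; lra.
rewrite factS mult_INR ln_mult.
- case: n IH => [|n] IH; first by rewrite /= ln_1; lra.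
  set a := INR n.+1 in IH *; have a1 : 1 <= a by exact: INR_ge1.
  have -> : INR n.+2 = a + 1 by rewrite S_INR.
  have e : ln (a + 1) <= ln a + / a.
    have -> : a + 1 = a * (1 + / a) by field; lra.
    rewrite ln_mult; [|lra| have := Rinv_0_lt_compat a; lra].
    have := exp_ineq1_le (/ a) => h; have ia : 0 < / a by apply: Rinv_0_lt_compat; lra.
    have := @ln_le (1 + / a) _ ltac:(lra) h; rewrite ln_exp; lra.
  have ea : a * (/ a) = 1 by field; lra.
  have : a * ln (a + 1) <= a * ln a + 1 by nra.
  lra.
- exact/INR_pos.
- exact/INR_pos/fact_gt0.
Qed.

(** Legendre's bound on each exponent of [n!] is set against [ln n! >= n ln n - n]. *)
Lemma mertens_lower n : (0 < n)%N ->
  ln (INR n) - 1 <= \sum_(1 <= p < n.+1 | prime p) (ln (INR p) / (INR p - 1)).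
Proof.
move=> n0; have np := INR_pos n0.
set N := n`!.
have hN : (n <= n`!)%N.
  case: n n0 {np N} => // n _; rewrite factS leq_pmulr // fact_gt0 //.
have e := ln_fact_ge n.
have hN' : (0 < n`! <= n`!)%N by rewrite fact_gt0 leqnn.
rewrite (ln_logn hN') in e.
have hh : \sum_(1 <= p < n`!.+1 | prime p) INR (logn p n`!) * ln (INR p) <=
   INR n * \sum_(1 <= p < n.+1 | prime p) (ln (INR p) / (INR p - 1)).
  have hNn : (n.+1 <= n`!.+1)%N by [].
  rewrite -rsum_mulr (big_nat_widen _ _ _ _ _ hNn) big_mkcondr.
  apply: rsum_le => p pp; case: ifP => [pn|pn].
    have h := logn_fact_le n pp; have l0 := ln_prime_gt0 pp.
    apply: (Rle_trans _ _ _ (Rmult_le_compat_r _ _ _ (Rlt_le _ _ l0) h)).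
    apply: Req_le; field; have := INR_prime_ge2 pp; lra.
  rewrite logn_fact // big1_seq ?Rmult_0_l ?Rplus_0_r //=; first lra.
  move=> i; rewrite mem_index_iota => /andP[i0 _].
  apply: divn_small; move/negbT: pn; rewrite -leqNgt => pn.
  apply: (leq_trans pn); rewrite -{1}(expn1 p) leq_exp2l //; exact: prime_gt1.
apply: (Rmult_le_reg_l (INR n)) => //; lra.
Qed.

Lemma exp2_dbl m : (2 ^ m.+1 = 2 * 2 ^ m)%N.
Proof. by rewrite expnS. Qed.

Lemma sum_primes_upper m :
  \sum_(1 <= p < (2 ^ m).+1 | prime p) (ln (INR p) / INR p) <= 2 * INR m * ln 2.
Proof.
elim: m => [|m IH].
  by rewrite expn0 big_mkcond big_nat1 /=; lra.
rewrite (@rsum_cat_nat (2 ^ m).+1) //; last by rewrite ltnS leq_exp2l.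
have b : \sum_((2 ^ m).+1 <= p < (2 ^ m.+1).+1 | prime p) (ln (INR p) / INR p) <= 2 * ln 2.
  have h := chebyshev_block (2 ^ m); rewrite exp2_dbl.
  have q0 : 0 < INR (2 ^ m)%N by apply: INR_pos; rewrite expn_gt0.
  apply: (Rle_trans _ (\sum_((2 ^ m).+1 <= p < (2 * 2 ^ m).+1 | prime p) (ln (INR p) * / INR (2 ^ m)%N))).
    apply: rsum_le_nat => p /andP[pm _] pp.
    apply: Rmult_le_compat_l; first exact: ln_INR_ge0.
    by apply: Rinv_le_contravar => //; apply/INR_le/ltnW.
  rewrite rsum_mull.
  apply: (Rle_trans _ _ _ (Rmult_le_compat_r _ _ _ _ h)).
    by left; apply: Rinv_0_lt_compat.
  by apply: Req_le; field; lra.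
rewrite S_INR; lra.
Qed.

Lemma sum_primes_lower m :
  (INR m * ln 2 - 1) / 2 <= \sum_(1 <= p < (2 ^ m).+1 | prime p) (ln (INR p) / INR p).
Proof.
have n0 : (0 < 2 ^ m)%N by rewrite expn_gt0.
have := mertens_lower n0; rewrite ln_pow2 => h.
suff : \sum_(1 <= p < (2 ^ m).+1 | prime p) (ln (INR p) / (INR p - 1)) <=
  2 * \sum_(1 <= p < (2 ^ m).+1 | prime p) (ln (INR p) / INR p) by lra.
rewrite -rsum_mulr; apply: rsum_le => p pp.
have p2 := INR_prime_ge2 pp; have l0 := ln_prime_gt0 pp.
have e : / (INR p - 1) <= 2 * / INR p.
  have -> : 2 * / INR p = / (INR p / 2) by field; lra.
  by apply: Rinv_le_contravar; lra.
rewrite /Rdiv; nra.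
Qed.

Lemma sum_primes_range_upper k :
  \sum_((2 ^ k).+1 <= p < (2 ^ (8 * k)).+1 | prime p) (ln (INR p) / INR p) <= 16 * INR k.
Proof.
apply: (Rle_trans _ (\sum_(1 <= p < (2 ^ (8 * k)).+1 | prime p) (ln (INR p) / INR p))).
  apply: rsum_sub_range => // p pp; have := INR_prime_ge2 pp; have := ln_prime_gt0 pp.
  by move=> l0 p2; apply: Rmult_le_pos; [lra | left; apply: Rinv_0_lt_compat; lra].
apply: (Rle_trans _ _ _ (sum_primes_upper _)).
rewrite mult_INR [INR 8]/=; have := ln2_lt1; have := pos_INR k; nra.
Qed.

(** The exponent 8 makes the window long enough for the crude bounds: up to [2 ^ (8 k)] the sum of
    [ln p / p] is at least [4 k ln 2 - 1 / 2], and the part up to [2 ^ k] takes at most [2 k ln 2]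
    of it. On the window [ln p <= 8 k ln 2], which converts [ln p / p] into [1 / (p ln p)]. *)
Lemma sum_inv_plnp_lower k : (0 < k)%N ->
  / (64 * INR k) <=
  \sum_((2 ^ k).+1 <= p < (2 ^ (8 * k)).+1 | prime p) / (INR p * ln (INR p)).
Proof.
move=> k0; have k1 := INR_ge1 k0.
have hs : INR k * ln 2 <= \sum_((2 ^ k).+1 <= p < (2 ^ (8 * k)).+1 | prime p) (ln (INR p) / INR p).
  have := sum_primes_lower (8 * k); have := sum_primes_upper k.
  have e : (2 ^ k <= 2 ^ (8 * k))%N by rewrite leq_exp2l //; lia.
  rewrite (@rsum_cat_nat (2 ^ k).+1 1 (2 ^ (8 * k)).+1) //.
  rewrite mult_INR [INR 8]/=; have := ln2_gt; nra.
have g := ln2_gt.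
set c := / (8 * INR k * ln 2) ^ 2.
have kl : 0 < INR k * ln 2 by nra.
have c0 : 0 < c by apply: Rinv_0_lt_compat; apply: pow_lt; lra.
apply: (Rle_trans _ (c * (INR k * ln 2))).
  have -> : c * (INR k * ln 2) = / (64 * INR k * ln 2) by rewrite /c; field; lra.
  apply: Rinv_le_contravar; have := ln2_lt1; nra.
apply: (Rle_trans _ _ _ (Rmult_le_compat_l _ _ _ (Rlt_le _ _ c0) hs)).
rewrite -rsum_mulr; apply: rsum_le_nat => p /andP[_ pm] pp.
have p2 := INR_prime_ge2 pp; have l0 := ln_prime_gt0 pp.
have lm : ln (INR p) <= 8 * INR k * ln 2.
  have h : INR p <= INR (2 ^ (8 * k))%N by apply: INR_le.
  have := ln_le (INR_pos (prime_gt0 pp)) h; rewrite ln_pow2 mult_INR /=; lra.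
have -> : / (INR p * ln (INR p)) = / (ln (INR p)) ^ 2 * (ln (INR p) / INR p) by field; lra.
apply: Rmult_le_compat_r; first by apply: Rmult_le_pos; [lra | left; apply: Rinv_0_lt_compat; lra].
by apply: Rinv_le_contravar; nra.
Qed.

Lemma sum_inv_plnp_upper k m : (0 < k)%N ->
  \sum_((2 ^ k).+1 <= p < (2 ^ m).+1 | prime p) / (INR p * ln (INR p)) <= 8 / INR k.
Proof.
move=> k0; have k1 := INR_ge1 k0.
case: (leqP m k) => [mk|km].
  rewrite big_geq; last by rewrite ltnS leq_exp2l.
  by apply: Rmult_le_pos; [lra | left; apply: Rinv_0_lt_compat; lra].
(* The dyadic block at [2 ^ m] contributes at most [4 / m ^ 2 <= 8 / m - 8 / (m + 1)], so the bound
   telescopes in this form. *)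
suff : \sum_((2 ^ k).+1 <= p < (2 ^ m).+1 | prime p) / (INR p * ln (INR p)) <= 8 / INR k - 8 / INR m.
  have : 0 < 8 / INR m by apply: Rmult_lt_0_compat; [lra | apply: Rinv_0_lt_compat; apply: INR_pos; lia].
  lra.
have : (k <= m)%N by lia.
elim: m {km} => [|m IH]; first by lia.
rewrite leq_eqVlt => /orP[/eqP <-|]; first by rewrite big_geq //; lra.
rewrite ltnS => km; have {IH} := IH km => IH.
have m0 : (0 < m)%N by lia. have m1 := INR_ge1 m0.
rewrite (@rsum_cat_nat (2 ^ m).+1) //; [|by rewrite ltnS leq_exp2l|by rewrite ltnS leq_exp2l].
have g := ln2_gt.
have b : \sum_((2 ^ m).+1 <= p < (2 ^ m.+1).+1 | prime p) / (INR p * ln (INR p)) <= 4 / INR m ^ 2.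
  have h := chebyshev_block (2 ^ m); rewrite exp2_dbl.
  have q0 : 0 < INR (2 ^ m)%N by apply: INR_pos; rewrite expn_gt0.
  set c := / (INR (2 ^ m)%N * (INR m * ln 2) ^ 2).
  have ml : 0 < INR m * ln 2 by nra.
  have c0 : 0 < c by apply: Rinv_0_lt_compat; apply: Rmult_lt_0_compat => //; apply: pow_lt.
  apply: (Rle_trans _ (\sum_((2 ^ m).+1 <= p < (2 * 2 ^ m).+1 | prime p) (ln (INR p) * c))).
    apply: rsum_le_nat => p /andP[pm _] pp.
    have p2 := INR_prime_ge2 pp; have l0 := ln_prime_gt0 pp.
    have pm' : INR (2 ^ m)%N <= INR p by apply/INR_le/ltnW.
    have lp : INR m * ln 2 <= ln (INR p) by rewrite -ln_pow2; apply: ln_le.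
    have -> : / (INR p * ln (INR p)) = ln (INR p) * / (INR p * ln (INR p) ^ 2) by field; lra.
    apply: Rmult_le_compat_l; first lra.
    apply: Rinv_le_contravar; first by apply: Rmult_lt_0_compat => //; apply: pow_lt.
    apply: Rmult_le_compat; try lra; first by apply: pow_le; lra.
    by apply: pow_incr; lra.
  rewrite rsum_mull.
  apply: (Rle_trans _ _ _ (Rmult_le_compat_r _ _ _ (Rlt_le _ _ c0) h)).
  have -> : INR (2 ^ m)%N * (2 * ln 2) * c = 2 / (INR m ^ 2) * / ln 2 by rewrite /c; field; lra.
  have -> : 4 / INR m ^ 2 = 2 / INR m ^ 2 * 2 by field; lra.
  apply: Rmult_le_compat_l; first by apply: Rmult_le_pos; [lra | left; apply: Rinv_0_lt_compat; nra].
  have := Rinv_le_contravar (/ 2) (ln 2) ltac:(lra) ltac:(lra); rewrite Rinv_inv; lra.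
apply: (Rle_trans _ _ _ (Rplus_le_compat _ _ _ _ IH b)).
rewrite S_INR.
suff : 4 / INR m ^ 2 <= 8 / INR m - 8 / (INR m + 1) by lra.
have -> : 8 / INR m - 8 / (INR m + 1) = 4 * (2 / (INR m * (INR m + 1))) by field; lra.
rewrite /Rdiv; apply: Rmult_le_compat_l; first lra.
have -> : 2 * / (INR m * (INR m + 1)) = / (INR m * (INR m + 1) / 2) by field; lra.
apply: Rinv_le_contravar; nra.
Qed.

(** * Sums of [1 / psi] and sums over geometric scales *)

(** This is Dedekind's psi function taken at the radical of [l]. The square-free [q] coprime to [l]
    have density proportional to [rad l / psi l], and [q] runs up to a bound divided by [rad l],
    which leaves the weight [1 / psi l]. *)
Definition psi (l : nat) : nat := (\prod_(p <- primes l) p.+1)%N.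
Definition ipsi (l : nat) : R := / INR (psi l).

Lemma psi_gt0 l : (0 < psi l)%N.
Proof. by rewrite /psi; apply: prodn_gt0. Qed.

Lemma ipsi_gt0 l : 0 < ipsi l.
Proof. exact/Rinv_0_lt_compat/INR_pos/psi_gt0. Qed.

Lemma ipsi_ge0 l : 0 <= ipsi l.
Proof. exact/Rlt_le/ipsi_gt0. Qed.

Lemma big_primes_mul (S : Type) (idx : S) (op : Monoid.com_law idx) (f : nat -> S) p m :
  prime p -> (0 < m)%N ->
  \big[op/idx]_(q <- primes (p * m)) f q =
  if (p %| m)%N then \big[op/idx]_(q <- primes m) f q
  else op (f p) (\big[op/idx]_(q <- primes m) f q).
Proof.
move=> pp m0; case: ifP => pm.
  apply: perm_big; apply: uniq_perm; rewrite ?primes_uniq // => q.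
  rewrite primesM ?(prime_gt0 pp) // primes_prime // inE.
  by case: eqP => // ->; rewrite mem_primes pp m0 pm.
rewrite -(big_cons _ _ p (primes m) xpredT f) /=.
apply: perm_big; apply: uniq_perm; rewrite /= ?primes_uniq ?andbT //.
  by rewrite mem_primes pm !andbF.
by move=> q; rewrite primesM ?(prime_gt0 pp) // primes_prime // !inE.
Qed.

Lemma psi_mul p m : prime p -> (0 < m)%N ->
  psi (p * m) = (if (p %| m)%N then psi m else p.+1 * psi m)%N.
Proof. by move=> pp m0; rewrite /psi big_primes_mul. Qed.

Lemma ipsi_mul p m : prime p -> (0 < m)%N ->
  ipsi (p * m) = if (p %| m)%N then ipsi m else ipsi m / (INR p + 1).
Proof.
move=> pp m0; rewrite /ipsi psi_mul //; case: ifP => // _.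
rewrite mult_INR S_INR; field; split.
  by apply: not_0_INR; have := psi_gt0 m; lia.
by have := INR_prime_ge2 pp; lra.
Qed.

Definition pwsum (d : nat) (f : nat -> R) (M : nat) : R :=
  \sum_(1 <= l < M.+1 | coprime l d) ipsi l * f l.

Definition psum (d M : nat) : R := \sum_(1 <= l < M.+1 | coprime l d) ipsi l.

Lemma pwsum1 d M : pwsum d (fun=> 1) M = psum d M.
Proof. by apply: eq_bigr => i _; rewrite Rmult_1_r. Qed.

(** The multiples of [p] are written [p * m]. Their weight is [ipsi m] when [p] divides [m] and
    [ipsi m / (p + 1)] otherwise; the last term corrects the full sum over [m] by the difference
    [p / (p + 1)]. *)
Lemma pwsum_split d p f M : prime p -> ~~ (p %| d)%N ->
  pwsum d f M = pwsum (d * p) f M + pwsum d (fun m => f (p * m)%N) (M %/ p)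
    - INR p / (INR p + 1) * pwsum (d * p) (fun m => f (p * m)%N) (M %/ p).
Proof.
move=> pp pd; have p2 := INR_prime_ge2 pp.
rewrite /pwsum (bigID (fun l => p %| l)%N) /= Rplus_comm /Rminus Rplus_assoc.
have cp l : coprime l (d * p) = coprime l d && ~~ (p %| l)%N.
  by rewrite coprimeMr [coprime l p]coprime_sym (prime_coprime _ pp).
congr (_ + _); first by apply: eq_bigl => l; rewrite cp.
rewrite (eq_bigl (fun l => (p %| l)%N && coprime l d)); last by move=> l; rewrite andbC.
rewrite (sum_multiples _ (fun l => coprime l d)) ?prime_gt0 //.
rewrite (eq_bigl (fun l => coprime l d)); last first.
  by move=> m; rewrite coprimeMl (prime_coprime _ pp) pd.
rewrite (bigID (fun l => p %| l)%N) /= [in RHS](bigID (fun l => p %| l)%N) /= Rplus_assoc.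
congr (_ + _).
  rewrite big_nat_cond [RHS]big_nat_cond; apply: eq_bigr => m /andP[/andP[m0 _] /andP[_ pm]].
  by rewrite ipsi_mul // pm.
rewrite (eq_bigl (fun l => coprime l d && ~~ (p %| l)%N) _ cp).
rewrite -rsum_mulr -rsum_opp -big_split /=.
rewrite big_nat_cond [RHS]big_nat_cond.
apply: eq_bigr => m /andP[/andP[m0 _] /andP[_ /negbTE pm]].
by rewrite ipsi_mul // pm; field; lra.
Qed.

Lemma psum0 d : psum d 0 = 0.
Proof. by rewrite /psum big_geq. Qed.

Lemma psum_ge0 d M : 0 <= psum d M.
Proof. by apply: rsum_ge0 => *; exact: ipsi_ge0. Qed.

Lemma psum_mono d m n : (m <= n)%N -> psum d m <= psum d n.
Proof. by move=> mn; apply: rsum_sub_range => // *; exact: ipsi_ge0. Qed.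

Lemma psum_dvd d e M : (d %| e)%N -> psum e M <= psum d M.
Proof.
move=> de; apply: rsum_le_pred => l _; last by move=> _; exact: ipsi_ge0.
exact: coprime_dvdr.
Qed.

Lemma psum_rec d p M : prime p -> ~~ (p %| d)%N ->
  psum d M = psum (d * p) M + psum d (M %/ p) - INR p / (INR p + 1) * psum (d * p) (M %/ p).
Proof. by move=> pp pd; rewrite -!pwsum1 (pwsum_split _ _ pp pd). Qed.

Lemma inv_p1 p : prime p -> INR p / (INR p + 1) = 1 - / (INR p + 1).
Proof. by move=> pp; have := INR_prime_ge2 pp => ?; field; lra. Qed.

Lemma inv_p1_pos p : prime p -> 0 < / (INR p + 1) < 1.
Proof.
move=> pp; have := INR_prime_ge2 pp => p2; split; first by apply: Rinv_0_lt_compat; lra.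
rewrite -{2}Rinv_1; apply: Rinv_lt_contravar; lra.
Qed.

Lemma psum_block_le d p M : prime p -> ~~ (p %| d)%N -> psum d M - psum d (M %/ p) <= psum (d * p) M.
Proof.
move=> pp pd; rewrite (psum_rec M pp pd) inv_p1 //.
have := inv_p1_pos pp; have := psum_ge0 (d * p) (M %/ p); nra.
Qed.

Lemma psum_block_ge d p M : prime p -> ~~ (p %| d)%N ->
  psum (d * p) M / (INR p + 1) <= psum d M - psum d (M %/ p).
Proof.
move=> pp pd; rewrite (psum_rec M pp pd) inv_p1 //.
have := inv_p1_pos pp; have := psum_mono (d * p) (leq_div M p); rewrite /Rdiv; nra.
Qed.

(* The sum over [M, M / p, M / p^2, ...]: up to the factor [ln p], an integral of
   [F] on the logarithmic scale. *)
Definition gsum (p : nat) (F : nat -> R) (M : nat) : R := \sum_(0 <= j < M) F (M %/ p ^ j)%N.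

Lemma gsum0 p F : gsum p F 0 = 0.
Proof. by rewrite /gsum big_geq. Qed.

(** Since [M < p ^ M], a range of [M] terms reaches every nonzero quotient, and all further terms
    are [F 0]. This is why [F 0 = 0] is assumed and why no logarithm appears in the range. *)
Lemma gsum_rec p F M : (1 < p)%N -> F 0%N = 0 -> gsum p F M = F M + gsum p F (M %/ p).
Proof.
move=> p1 F0; case: M => [|M]; first by rewrite div0n gsum0 F0; lra.
rewrite /gsum big_nat_recl //= expn0 divn1; congr (_ + _).
have lt : (M.+1 %/ p <= M)%N by rewrite -ltnS ltn_Pdiv.
rewrite [RHS](big_nat_widen _ _ _ _ _ lt) [RHS]big_mkcond /=.
apply: eq_big_nat => j _; rewrite expnS divnMA; case: ltnP => // hj.
by rewrite divn_small ?F0 //; apply: (leq_ltn_trans hj); exact: ltn_expl.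
Qed.

Lemma gsum_unroll p F M n : (1 < p)%N -> F 0%N = 0 ->
  gsum p F M = \sum_(0 <= i < n) F (M %/ p ^ i)%N + gsum p F (M %/ p ^ n).
Proof.
move=> p1 F0; elim: n => [|n IH]; first by rewrite big_geq // expn0 divn1; lra.
by rewrite IH big_nat_recr //= (gsum_rec _ p1 F0) expnSr divnMA; lra.
Qed.

Lemma gsum_le p (F irad_sum : nat -> R) M : (forall m, (m <= M)%N -> F m <= irad_sum m) -> gsum p F M <= gsum p irad_sum M.
Proof. by move=> FG; apply: rsum_le => j _; apply: FG; exact: leq_div. Qed.

Lemma gsum_ge0 p (F : nat -> R) M : (forall m, 0 <= F m) -> 0 <= gsum p F M.
Proof. by move=> F0; apply: rsum_ge0. Qed.

Lemma gsum_scale p F c M : gsum p (fun m => c * F m) M = c * gsum p F M.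
Proof. by rewrite /gsum rsum_mulr. Qed.

Definition mono (F : nat -> R) := forall m n, (m <= n)%N -> F m <= F n.

Lemma mono_ge0 F : mono F -> F 0%N = 0 -> forall m, 0 <= F m.
Proof. by move=> mF F0 m; rewrite -F0; apply: mF. Qed.

Lemma gsum_mono p F : (1 < p)%N -> mono F -> F 0%N = 0 -> mono (gsum p F).
Proof.
move=> p1 mF F0 m n; elim/ltn_ind: n m => n IH m mn.
rewrite (gsum_rec m p1 F0) (gsum_rec n p1 F0); apply: Rplus_le_compat; first exact: mF.
case: n IH mn => [|n] IH mn.
  by rewrite (_ : m = 0%N) ?div0n; [lra | lia].
by apply: IH; [rewrite ltn_Pdiv | exact: leq_div2r].
Qed.

Lemma gsum_ge p F M : (1 < p)%N -> mono F -> F 0%N = 0 -> F M <= gsum p F M.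
Proof.
move=> p1 mF F0; rewrite (gsum_rec M p1 F0).
have := @gsum_ge0 p F (M %/ p) (mono_ge0 mF F0); lra.
Qed.

Lemma div_antimono M a b : (0 < a)%N -> (a <= b)%N -> (M %/ b <= M %/ a)%N.
Proof. by move=> a0 ab; apply: leq_div2l. Qed.

(** A division by [p] spans at most [k] halvings, and [F] is largest at the first of them. *)
Lemma gsum_two_le p k F M : (1 < p)%N -> (p <= 2 ^ k)%N -> mono F -> F 0%N = 0 ->
  gsum 2 F M <= INR k * gsum p F M.
Proof.
move=> p1 pk mF F0; elim/ltn_ind: M => -[|M] IH; first by rewrite !gsum0; lra.
have F00 := mono_ge0 mF F0.
rewrite (gsum_unroll M.+1 k (isT : (1 < 2)%N) F0) (gsum_rec M.+1 p1 F0) Rmult_plus_distr_l.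
apply: Rplus_le_compat.
  apply: (Rle_trans _ (\sum_(0 <= i < k) F M.+1)).
    by apply: rsum_le => i _; apply: mF; exact: leq_div.
  apply: (Rle_trans _ _ _ (rsum_const_le _ _ (F00 _))).
  by rewrite size_iota subn0; lra.
apply: (Rle_trans _ (gsum 2 F (M.+1 %/ p))); last by apply: IH; rewrite ltn_Pdiv.
by apply: gsum_mono => //; apply: div_antimono => //; lia.
Qed.

Lemma gsum_two_ge_aux p k F M n : (1 < p)%N -> (2 ^ k <= p)%N -> mono F -> F 0%N = 0 -> (n <= k)%N ->
  INR n * F (M %/ p)%N + gsum 2 F (M %/ p) <= gsum 2 F (M %/ 2 ^ (k - n)).
Proof.
move=> p1 ilog2 mF F0; elim: n => [|n IH] nk.
  rewrite subn0 /= Rmult_0_l Rplus_0_l; apply: gsum_mono => //.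
  by apply: div_antimono => //; rewrite expn_gt0.
have e : (k - n = (k - n.+1).+1)%N by lia.
rewrite S_INR (gsum_rec (_ %/ 2 ^ (k - n.+1)) (isT : (1 < 2)%N) F0) -divnMA -expnSr -e.
have h1 := IH (ltnW nk).
suff : F (M %/ p)%N <= F (M %/ 2 ^ (k - n.+1))%N by lra.
apply: mF; apply: div_antimono; first by rewrite expn_gt0.
by apply: leq_trans ilog2; rewrite leq_exp2l //; lia.
Qed.

(** Here the [k] halvings inside a division by [p] are bounded below by the value at the end of the
    division, whence the shift to [M %/ p]. *)
Lemma gsum_two_ge p k F M : (1 < p)%N -> (2 ^ k <= p)%N -> mono F -> F 0%N = 0 ->
  INR k * gsum p F (M %/ p) <= gsum 2 F M.
Proof.
move=> p1 ilog2 mF F0; elim/ltn_ind: M => -[|M] IH; first by rewrite div0n !gsum0; lra.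
have := @gsum_two_ge_aux p k F M.+1 k p1 ilog2 mF F0 (leqnn k).
rewrite subnn expn0 divn1 (gsum_rec (M.+1 %/ p) p1 F0).
have := IH (M.+1 %/ p)%N (ltn_Pdiv p1 (ltn0Sn M)).
have := pos_INR k; nra.
Qed.

Definition gsum2 (F : nat -> R) : nat -> R := gsum 2 (gsum 2 F).

Lemma gsum2_le p k F M : (1 < p)%N -> (p <= 2 ^ k)%N -> mono F -> F 0%N = 0 ->
  gsum2 F M <= INR k ^ 2 * gsum p (gsum p F) M.
Proof.
move=> p1 pk mF F0; rewrite /gsum2.
have m2 : mono (gsum 2 F) by exact: gsum_mono.
apply: (Rle_trans _ _ _ (gsum_two_le M p1 pk m2 (gsum0 _ _))).
rewrite /= Rmult_1_r Rmult_assoc; apply: Rmult_le_compat_l; first exact: pos_INR.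
by rewrite -gsum_scale; apply: gsum_le => m _; exact: gsum_two_le.
Qed.

(** The factor [k ^ 2 / 2] is the triangular sum [1 + ... + k]: within one division by [p], the
    inner sum gains one more copy of [F (M %/ p)] at each halving. *)
Lemma gsum2_ge p k F M : (1 < p)%N -> (2 ^ k <= p)%N -> mono F -> F 0%N = 0 ->
  INR k ^ 2 / 2 * gsum p (gsum p F) (M %/ p) <= gsum2 F M.
Proof.
move=> p1 ilog2 mF F0; elim/ltn_ind: M => -[|M] IH; first by rewrite div0n /gsum2 !gsum0; lra.
have F00 := mono_ge0 mF F0.
have m2 : mono (gsum 2 F) by exact: gsum_mono.
rewrite (gsum_rec (M.+1 %/ p) p1 (gsum0 _ _)).
have IH1 := IH (M.+1 %/ p)%N (ltn_Pdiv p1 (ltn0Sn M)).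
set X := (M.+1 %/ p)%N in IH1 *.
rewrite /gsum2 (gsum_unroll M.+1 k (isT : (1 < 2)%N) (gsum0 _ _)).
have h1 : gsum2 F X <= gsum 2 (gsum 2 F) (M.+1 %/ 2 ^ k).
  by apply: (gsum_mono (isT : (1 < 2)%N) m2 (gsum0 _ _)); apply: div_antimono => //; rewrite expn_gt0.
suff : INR k ^ 2 / 2 * gsum p F X <= \sum_(0 <= i < k) gsum 2 F (M.+1 %/ 2 ^ i) by lra.
have hT : INR k * gsum p F (X %/ p) <= gsum 2 F X by exact: gsum_two_ge.
have hs n : (n <= k)%N -> INR n ^ 2 / 2 * F X + INR n * gsum 2 F X <=
   \sum_(0 <= i < n) gsum 2 F (M.+1 %/ 2 ^ (k - i.+1)).
  elim: n => [|n IHn] nk; first by rewrite big_geq //=; lra.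
  rewrite big_nat_recr //= -/(INR n.+1) S_INR.
  have := IHn (ltnW nk); have := @gsum_two_ge_aux p k F M.+1 n.+1 p1 ilog2 mF F0 nk.
  rewrite -/X S_INR; have := F00 X; have := pos_INR n; nra.
have := hs k (leqnn k).
rewrite big_nat_rev /= add0n.
rewrite (eq_big_nat _ _ (F2 := fun i => gsum 2 F (M.+1 %/ 2 ^ i))); last first.
  by move=> i /andP[_ ik]; do 2 f_equal; congr (_ ^ _)%N; lia.
rewrite (gsum_rec X p1 F0).
have := Rmult_le_compat_l _ _ _ (pos_INR k) hT.
have := @gsum_ge0 p F (X %/ p) F00; have : 0 <= INR k ^ 2 by apply: pow_le; exact: pos_INR.
move=> k2 t0; have := Rmult_le_pos _ _ k2 t0; rewrite /=; lra.
Qed.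

(** With [l = p ^ j * m] and [m] prime to [p], the power of [p] has weight 1 for [j = 0] and
    [1 / (p + 1)] for every [j >= 1]. *)
Lemma psum_T d p M : prime p -> ~~ (p %| d)%N ->
  psum d M = psum (d * p) M + / (INR p + 1) * gsum p (psum (d * p)) (M %/ p).
Proof.
move=> pp pd; elim/ltn_ind: M => -[|M] IH; first by rewrite div0n gsum0 !psum0; lra.
rewrite (psum_rec M.+1 pp pd) (IH (M.+1 %/ p)%N (ltn_Pdiv (prime_gt1 pp) (ltn0Sn M))).
by rewrite (gsum_rec (M.+1 %/ p) (prime_gt1 pp) (psum0 _)) inv_p1 //; lra.
Qed.

Lemma psum_T_ge d p M : prime p -> ~~ (p %| d)%N ->
  / (INR p + 1) * gsum p (psum (d * p)) M <= psum d M.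
Proof.
move=> pp pd; rewrite (psum_T M pp pd) (gsum_rec M (prime_gt1 pp) (psum0 _)).
have := inv_p1_pos pp; have := psum_ge0 (d * p) M; nra.
Qed.

Lemma psum_le_T d p M : prime p -> ~~ (p %| d)%N -> psum d M <= gsum p (psum (d * p)) M.
Proof.
move=> pp pd; rewrite (psum_T M pp pd) (gsum_rec M (prime_gt1 pp) (psum0 _)).
have := inv_p1_pos pp; have := @gsum_ge0 p (psum (d * p)) (M %/ p) (psum_ge0 _); nra.
Qed.

(** With [l = p ^ j * m] as in [psum_T], the extra factor [j] counts the [i] with [1 <= i <= j],
    which turns the single sum over powers of [p] into a double one. *)
Lemma sum_h_logn d p M : prime p -> ~~ (p %| d)%N ->
  pwsum d (fun l => INR (logn p l)) M = / (INR p + 1) * gsum p (gsum p (psum (d * p))) (M %/ p).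
Proof.
move=> pp pd; have p1 := prime_gt1 pp.
elim/ltn_ind: M => -[|M] IH; first by rewrite div0n gsum0 /pwsum big_geq //; lra.
rewrite (pwsum_split _ _ pp pd).
have -> : pwsum (d * p) (fun l => INR (logn p l)) M.+1 = 0.
  rewrite /pwsum big1 // => l; rewrite coprimeMr => /andP[_].
  by rewrite coprime_sym => /logn_coprime ->; rewrite Rmult_0_r.
have e (e : nat) n : pwsum e (fun m => INR (logn p (p * m))) n = psum e n + pwsum e (fun l => INR (logn p l)) n.
  rewrite /psum /pwsum -big_split /= big_nat_cond [RHS]big_nat_cond.
  apply: eq_bigr => m /andP[/andP[m0 _] _].
  by rewrite lognM ?(prime_gt0 pp) // lognE pp (prime_gt0 pp) dvdnn divnn (prime_gt0 pp) logn1 plus_INR /=; lra.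
rewrite !e.
have -> : pwsum (d * p) (fun l => INR (logn p l)) (M.+1 %/ p) = 0.
  rewrite /pwsum big1 // => l; rewrite coprimeMr => /andP[_].
  by rewrite coprime_sym => /logn_coprime ->; rewrite Rmult_0_r.
rewrite (IH (M.+1 %/ p)%N (ltn_Pdiv p1 (ltn0Sn M))) (gsum_rec (M.+1 %/ p) p1 (gsum0 _ _)).
have := psum_rec M.+1 pp pd; have := psum_T M.+1 pp pd; lra.
Qed.

Lemma sum_h_logn_dvd d p M : prime p -> (p %| d)%N -> pwsum d (fun l => INR (logn p l)) M = 0.
Proof.
move=> pp pd; rewrite /pwsum big1 // => l cl.
by rewrite [logn p l](logn_coprime) ?Rmult_0_r // coprime_sym; apply: coprime_dvdr pd cl.
Qed.

Lemma sum_h_ln d M N : (M <= N)%N ->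
  pwsum d (fun l => ln (INR l)) M =
  \sum_(1 <= p < N.+1 | prime p) ln (INR p) * pwsum d (fun l => INR (logn p l)) M.
Proof.
move=> MN; rewrite /pwsum.
under [RHS]eq_bigr do rewrite -rsum_mulr.
rewrite exchange_big /= big_nat_cond [RHS]big_nat_cond.
apply: eq_bigr => l /andP[/andP[l0 lM] _].
rewrite (@ln_logn l N); last by apply/andP; split => //; lia.
by rewrite -rsum_mulr; apply: eq_bigr => p _; lra.
Qed.

(** * The second-order inequality and its integration *)

Lemma gsum_widen p F M n : (1 < p)%N -> F 0%N = 0 -> (M <= n)%N ->
  gsum p F M = \sum_(0 <= j < n) F (M %/ p ^ j)%N.
Proof.
move=> p1 F0 Mn; rewrite (gsum_unroll M n p1 F0) divn_small ?gsum0 ?Rplus_0_r //.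
by apply: (leq_ltn_trans Mn); exact: ltn_expl.
Qed.

Lemma gsum_diff_le p b F irad_sum M : (1 < p)%N -> F 0%N = 0 ->
  (forall m, F m - F (m %/ b)%N <= irad_sum m) -> gsum p F M - gsum p F (M %/ b) <= gsum p irad_sum M.
Proof.
move=> p1 F0 FG; rewrite (@gsum_widen p F (M %/ b) M) ?leq_div // /gsum -rsum_sub.
apply: rsum_le => j _; rewrite -divnMA mulnC divnMA; exact: FG.
Qed.

Lemma gsum_le_log p F M n : (1 < p)%N -> mono F -> F 0%N = 0 -> (M < 2 ^ n)%N ->
  gsum p F M <= INR n * F M.
Proof.
move=> p1 mF F0 Mn; rewrite (gsum_unroll M n p1 F0) divn_small; last first.
  by case: n Mn => [|n] Mn //; apply: (leq_trans Mn); rewrite leq_exp2r.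
rewrite gsum0 Rplus_0_r; apply: (Rle_trans _ (\sum_(0 <= i < n) F M)).
  by apply: rsum_le => i _; apply: mF; exact: leq_div.
apply: (Rle_trans _ _ _ (rsum_const_le _ _ (mono_ge0 mF F0 _))).
by rewrite size_iota subn0; lra.
Qed.

(** At most [p] powers of [p] are relevant below [2 ^ p], and each has weight [1 / (p + 1)], so the
    multiples of [p] weigh no more than the rest. *)
Lemma psum_half d p M : prime p -> ~~ (p %| d)%N -> (M < 2 ^ p)%N ->
  psum d M <= 2 * psum (d * p) M.
Proof.
move=> pp pd Mp; rewrite (psum_T M pp pd).
have h1 : gsum p (psum (d * p)) (M %/ p) <= INR p * psum (d * p) M.
  apply: (Rle_trans _ (INR p * psum (d * p) (M %/ p))).
    apply: gsum_le_log; [exact: prime_gt1 | exact: psum_mono | exact: psum0 |].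
    by apply: leq_ltn_trans Mp; exact: leq_div.
  by apply: Rmult_le_compat_l; [exact: pos_INR | apply/psum_mono/leq_div].
have [i0 i1] := inv_p1_pos pp.
have e : / (INR p + 1) * INR p <= 1 by rewrite Rmult_comm; have := inv_p1 pp; rewrite /Rdiv; lra.
have := psum_ge0 (d * p) M => h0.
have : / (INR p + 1) * gsum p (psum (d * p)) (M %/ p) <= / (INR p + 1) * (INR p * psum (d * p) M) by nra.
nra.
Qed.

Definition ilog2 (p : nat) := trunc_log 2 p.

Lemma ilog2P p : (1 < p)%N -> (2 ^ ilog2 p <= p < 2 ^ (ilog2 p).+1)%N.
Proof. by move=> p1; rewrite trunc_logP ?(ltnW p1) // trunc_log_ltn. Qed.

Lemma ilog2_gt0 p : (1 < p)%N -> (0 < ilog2 p)%N.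
Proof. by move=> p1; rewrite trunc_log_gt0 /=; lia. Qed.

Lemma ilog2_ln p : (1 < p)%N -> ln (INR p) <= 2 * INR (ilog2 p) * ln 2 /\ INR (ilog2 p) * ln 2 <= ln (INR p).
Proof.
move=> p1; have /andP[h1 h2] := ilog2P p1.
have k1 := INR_ge1 (ilog2_gt0 p1); have g := ln2_gt.
have p0 : 0 < INR p by apply: INR_pos; lia.
split.
  have := ln_le p0 (INR_le (ltnW h2)); rewrite ln_pow2 S_INR; nra.
rewrite -ln_pow2; apply: ln_le; last exact: INR_le.
by apply: INR_pos; rewrite expn_gt0.
Qed.

(* The primes of this window are the ones that drive [second_order]; [d] may not
   use any of them. *)
Definition avoid (k d : nat) := forall p, prime p -> (2 ^ k < p <= 2 ^ (8 * k))%N -> ~~ (p %| d)%N.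

Lemma ln_lt_exp2 M n : (M < 2 ^ n)%N -> ln (INR M) <= INR n.
Proof.
move=> ipsi; case: M ipsi => [|M] ipsi.
  have := pos_INR n; have -> : ln (INR 0) = 0; last by [].
  by rewrite /ln; case: (Rlt_dec 0 (INR 0)) => // h1; exfalso; move: h1; rewrite /=; lra.
have := ln_le (INR_pos (ltn0Sn M)) (INR_le (ltnW ipsi)); rewrite ln_pow2.
have := ln2_lt1; have := pos_INR n; nra.
Qed.

Lemma pwsum_ln_le d M n : (M < 2 ^ n)%N -> pwsum d (fun l => ln (INR l)) M <= INR n * psum d M.
Proof.
move=> Mn; rewrite /psum -rsum_mulr; apply: rsum_le_nat => l /andP[l0 lM] _.
rewrite Rmult_comm; apply: Rmult_le_compat_r; first exact: ipsi_ge0.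
by apply: ln_lt_exp2; lia.
Qed.

(** This undoes the shift by [p] in [sum_h_logn] at the price of one value of [F]. *)
Lemma gsum_twice_le p F M : (1 < p)%N -> mono F -> F 0%N = 0 ->
  gsum p (gsum p F) M <= F M + 2 * gsum p (gsum p F) (M %/ p).
Proof.
move=> p1 mF F0; rewrite (gsum_rec M p1 (gsum0 _ _)) (gsum_rec M p1 F0).
have := @gsum_ge p (gsum p F) (M %/ p) p1 (gsum_mono p1 mF F0) (gsum0 _ _); lra.
Qed.

(* For [p > 2 ^ k] removing the multiples of [p] costs at most a factor 2, so each
   such prime contributes a double sum of [psum d] itself to [sum ipsi l * ln l]. *)
Lemma second_order k d M : (0 < k)%N -> avoid k d -> (M < 2 ^ (2 ^ k))%N ->
  gsum2 (psum d) M <= 40960 * (INR k * INR (2 ^ k)%N) * psum d M.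
Proof.
move=> k0 ad hM; have k1 := INR_ge1 k0.
have kt : INR k <= INR (2 ^ k)%N by apply/INR_le/ltnW/ltn_expl.
have := pwsum_ln_le d hM.
set N := maxn M (2 ^ (8 * k)).
rewrite (@sum_h_ln d M N); last exact: leq_maxl.
set F := psum d; have mF : mono F by exact: psum_mono. have F0 : F 0%N = 0 by exact: psum0.
have Fp : 0 <= F M by exact: psum_ge0.
have Bp : 0 <= gsum2 F M by apply: gsum_ge0 => m; apply: gsum_ge0; exact: psum_ge0.
(* The factors [64 k] and [16 k] are the two sums over the window, of [1 / (p ln p)] and of
   [ln p / p]. As the right side is at most [2 ^ k * F M] and [k <= 2 ^ k], this gives [gsum2 F M <=
   128 * 64 * k * 5 * 2 ^ k * F M]. *)
suff key : gsum2 F M / 128 * (/ (64 * INR k)) - F M / 4 * (16 * INR k) <=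
   \sum_(1 <= p < N.+1 | prime p) ln (INR p) * pwsum d (fun l => INR (logn p l)) M.
  move=> h1; have {h1} := Rle_trans _ _ _ key h1 => h1.
  have e : gsum2 F M / 128 * (/ (64 * INR k)) * (8192 * INR k) = gsum2 F M by field; lra.
  have h2 : gsum2 F M / 128 * (/ (64 * INR k)) <= 5 * INR (2 ^ k)%N * F M by rewrite -/F in h1; nra.
  have h3 := Rmult_le_compat_r (8192 * INR k) _ _ ltac:(lra) h2; rewrite e in h3; lra.
have sg0 p : prime p -> 0 <= ln (INR p) * pwsum d (fun l => INR (logn p l)) M.
  move=> pp; apply: Rmult_le_pos; first exact: ln_INR_ge0.
  by apply: rsum_ge0 => l _; apply: Rmult_le_pos; [exact: ipsi_ge0 | exact: pos_INR].
apply: (Rle_trans _ (\sum_((2 ^ k).+1 <= p < (2 ^ (8 * k)).+1 | prime p)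
    ln (INR p) * pwsum d (fun l => INR (logn p l)) M)); last first.
  by apply: rsum_sub_range => //; rewrite ltnS leq_maxr.
apply: (Rle_trans _ (\sum_((2 ^ k).+1 <= p < (2 ^ (8 * k)).+1 | prime p)
   (gsum2 F M / 128 * / (INR p * ln (INR p)) - F M / 4 * (ln (INR p) / INR p)))).
  rewrite rsum_sub !rsum_mulr.
  have := Rmult_le_compat_l (gsum2 F M / 128) _ _ ltac:(lra) (sum_inv_plnp_lower k0).
  have := Rmult_le_compat_l (F M / 4) _ _ ltac:(lra) (sum_primes_range_upper k).
  lra.
apply: rsum_le_nat => p /andP[p1 p2] pp.
have pd : ~~ (p %| d)%N by apply: ad => //; rewrite p1.
rewrite (sum_h_logn _ pp pd).
have pg := prime_gt1 pp; have pr := INR_prime_ge2 pp; have l0 := ln_prime_gt0 pp.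
(* The primes of the window exceed [2 ^ k], so [M < 2 ^ (2 ^ k)] lies below [2 ^ p]. *)
have half m : (m <= M)%N -> F m <= 2 * psum (d * p) m.
  move=> mM; apply: psum_half => //; apply: (leq_ltn_trans mM); apply: (leq_trans hM).
  by rewrite leq_exp2l // ltnW.
have tt : gsum p (gsum p F) (M %/ p) <= 2 * gsum p (gsum p (psum (d * p))) (M %/ p).
  rewrite -gsum_scale; apply: gsum_le => m mM; rewrite -gsum_scale; apply: gsum_le => m' mm'.
  apply: half; apply: (leq_trans mm'); apply: (leq_trans mM); exact: leq_div.
have /andP[_ pk] := ilog2P pg.
have [h1 h2] := ilog2_ln pg.
have hB := @gsum2_le p (ilog2 p).+1 F M pg (ltnW pk) mF F0.
have hTT := gsum_twice_le M pg mF F0.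
have tt0 : 0 <= gsum p (gsum p F) M by apply: gsum_ge0 => m; apply: gsum_ge0; exact: psum_ge0.
have hk : INR (ilog2 p).+1 <= 4 * ln (INR p).
  rewrite S_INR; have := ln2_gt; have := INR_ge1 (ilog2_gt0 pg).
  have := @ln_le 2 _ ltac:(lra) pr; nra.
have hk2 : INR (ilog2 p).+1 ^ 2 <= 16 * ln (INR p) ^ 2.
  have := pos_INR (ilog2 p).+1; nra.
have hB2 : gsum2 F M <= 16 * ln (INR p) ^ 2 * (F M + 2 * (2 * gsum p (gsum p (psum (d * p))) (M %/ p))).
  apply: (Rle_trans _ _ _ hB); apply: Rmult_le_compat => //; [nra | lra].
set Z := gsum p (gsum p (psum (d * p))) (M %/ p) in hB2 *.
have Z0 : 0 <= Z by apply: gsum_ge0 => m; apply: gsum_ge0; exact: psum_ge0.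
set L := ln (INR p) in l0 hB2 *; set P := INR p in pr *.
have e1 : L * (/ (P + 1) * Z) >= L * Z / (2 * P).
  have : / (2 * P) <= / (P + 1) by apply: Rinv_le_contravar; lra.
  have : 0 <= L * Z by apply: Rmult_le_pos; lra.
  rewrite /Rdiv; nra.
have e2 : gsum2 F M / 128 * / (P * L) - F M / 4 * (L / P) <= L * Z / (2 * P).
  have c0 : 0 < / (128 * P * L) by apply: Rinv_0_lt_compat; nra.
  have := Rmult_le_compat_l _ _ _ (Rlt_le _ _ c0) hB2.
  have -> : / (128 * P * L) * gsum2 F M = gsum2 F M / 128 * / (P * L) by field; lra.
  have -> : / (128 * P * L) * (16 * L ^ 2 * (F M + 2 * (2 * Z))) = F M / 8 * (L / P) + L * Z / (2 * P).
    by field; lra.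
  have : 0 <= F M * (L / P) by apply: Rmult_le_pos => //; apply: Rmult_le_pos; [lra | left; apply: Rinv_0_lt_compat; lra].
  lra.
lra.
Qed.

Section FirstOrder.
Variables (F : nat -> R) (K : R) (N : nat).
Hypotheses (mF : mono F) (F0 : F 0%N = 0) (K0 : 0 < K).
Hypothesis hB : forall m, (m <= N)%N -> gsum2 F m <= K * F m.

(* Discrete form of: [J'' >= J / K] gives [(J'^2)' >= (J^2)' / K]. *)
Lemma gsum2_first_order M : (M <= N)%N -> gsum2 F M <= sqrt (2 * K) * gsum 2 F M.
Proof.
move=> MN; have F00 := mono_ge0 mF F0.
have I0 m : 0 <= gsum 2 F m by exact: gsum_ge0.
have B0 m : 0 <= gsum2 F m by exact: gsum_ge0.
have sq : gsum2 F M ^ 2 <= 2 * K * gsum 2 F M ^ 2.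
  elim/ltn_ind: M MN => -[|M] IH MN; first by rewrite /gsum2 !gsum0 /=; lra.
  have two : (1 < 2)%N by [].
  have h1 := IH (M.+1 %/ 2)%N (ltn_Pdiv two (ltn0Sn M)) (leq_trans (leq_div _ _) MN).
  have eB : gsum2 F M.+1 = gsum 2 F M.+1 + gsum2 F (M.+1 %/ 2) by rewrite /gsum2 (gsum_rec M.+1 two (gsum0 _ _)).
  have eI := gsum_rec M.+1 two F0.
  have := hB MN; have := I0 (M.+1 %/ 2)%N; have := B0 (M.+1 %/ 2)%N; have := B0 M.+1.
  have := F00 M.+1; have := I0 M.+1.
  set b := gsum2 F M.+1 in eB *; set b' := gsum2 F _ in eB h1 *.
  set i := gsum 2 F M.+1 in eB eI *; set i' := gsum 2 F _ in eI h1 *; set f := F M.+1 in eI *.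
  move=> i0 f0 b0 b'0 i'0 hb.
  have : b ^ 2 - b' ^ 2 <= 2 * i * b by nra.
  have : 2 * K * (i ^ 2 - i' ^ 2) >= 2 * (K * f) * i by nra.
  nra.
apply: Rsqr_incr_0_var; last by apply: Rmult_le_pos => //; exact: sqrt_pos.
rewrite Rsqr_mult Rsqr_sqrt; last lra.
by rewrite /Rsqr /= in sq *; lra.
Qed.

(** One halving removes [gsum 2 F m] from [gsum2 F m], and by [gsum2_first_order] this is at least
    the fraction [1 / sqrt (2 K)] of it. *)
Lemma gsum2_growth M i : (M <= N)%N -> 1 <= 2 * K ->
  gsum2 F (M %/ 2 ^ i) <= (1 - / sqrt (2 * K)) ^ i * gsum2 F M.
Proof.
move=> MN K1.
have s1 : 1 <= sqrt (2 * K) by rewrite -sqrt_1; apply: sqrt_le_1; lra.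
have is0 : 0 < / sqrt (2 * K) by apply: Rinv_0_lt_compat; lra.
have is1 : / sqrt (2 * K) <= 1 by rewrite -Rinv_1; apply: Rinv_le_contravar; lra.
elim: i => [|i IH]; first by rewrite expn0 divn1 /=; lra.
rewrite expnSr divnMA /= Rmult_assoc.
set m := (M %/ 2 ^ i)%N in IH *.
apply: (Rle_trans _ ((1 - / sqrt (2 * K)) * gsum2 F m)); last first.
  by apply: Rmult_le_compat_l; lra.
have mN : (m <= N)%N by apply: leq_trans MN; exact: leq_div.
have h1 := gsum2_first_order mN.
have eB : gsum2 F m = gsum 2 F m + gsum2 F (m %/ 2) by rewrite /gsum2 (gsum_rec m (isT : (1 < 2)%N) (gsum0 _ _)).
have : / sqrt (2 * K) * gsum2 F m <= gsum 2 F m.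
  have := Rmult_le_compat_l _ _ _ (Rlt_le _ _ is0) h1.
  by rewrite -Rmult_assoc Rinv_l ?Rmult_1_l //; lra.
lra.
Qed.
End FirstOrder.

(** * Local decay *)

Lemma avoid_mul k d b : avoid k d -> (0 < b <= 2 ^ k)%N -> avoid k (d * b).
Proof.
move=> ad /andP[b0 bk] p pp hp; rewrite Euclid_dvdM // negb_or ad //=.
by apply/negP => /(dvdn_leq b0); case/andP: hp; lia.
Qed.

Definition rt (k : nat) : R := sqrt (INR k * INR (2 ^ k)%N).
Definition delta (k : nat) : R := / rt k.

Lemma exp2_gt0 k : 0 < INR (2 ^ k)%N.
Proof. by apply: INR_pos; rewrite expn_gt0. Qed.

Lemma rt_gt0 k : (0 < k)%N -> 0 < rt k.
Proof.
move=> k0; apply: sqrt_lt_R0; apply: Rmult_lt_0_compat; [exact: INR_pos | exact: exp2_gt0].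
Qed.

Lemma rt_sq k : rt k * rt k = INR k * INR (2 ^ k)%N.
Proof. by apply: sqrt_sqrt; apply: Rmult_le_pos; [exact: pos_INR | exact/Rlt_le/exp2_gt0]. Qed.

Lemma delta_gt0 k : (0 < k)%N -> 0 < delta k.
Proof. by move=> k0; apply/Rinv_0_lt_compat/rt_gt0. Qed.

Lemma quarter_exp k : (4 <= k)%N -> (k * (2 ^ (k %/ 4)) ^ 2 <= 2 ^ k)%N.
Proof.
move=> k4; set q := (k %/ 4)%N.
have q1 : (1 <= q)%N by rewrite /q leq_divRL.
have ek : (k = q * 4 + k %% 4)%N := divn_eq k 4.
set r := (k %% 4)%N in ek.
have hq : (4 * q <= 4 ^ q)%N.
  elim: (q) q1 => // n IH _; case: n IH => // n IH.
  by rewrite expnS; have := IH isT; lia.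
have hr : (r.+1 <= 2 ^ r)%N by exact: ltn_expl.
have -> : (2 ^ k = (2 ^ q) ^ 2 * (4 ^ q * 2 ^ r))%N.
  rewrite (_ : 4 ^ q = 2 ^ (2 * q))%N; last by rewrite expnM.
  rewrite {1}ek -expnM mulnA -expnD -expnD; congr (2 ^ _)%N; lia.
rewrite mulnC leq_mul2l; apply/orP; right.
apply: (@leq_trans (4 * q * r.+1)); first by rewrite {1}ek; nia.
exact: leq_mul.
Qed.

(** Up to [2 ^ (k / 4)] even the number of integers is small enough, so the primes of that range can
    be bounded one by one without any saving in [p]. *)
Lemma quarter_exp_rt k : (4 <= k)%N -> INR (2 ^ (k %/ 4))%N <= INR (2 ^ k)%N * delta k.
Proof.
move=> k4; have k0 : (0 < k)%N by lia.
have := INR_le (quarter_exp k4); rewrite mult_INR [in X in X -> _]INR_exp.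
set a := INR (2 ^ (k %/ 4))%N; set t := INR (2 ^ k)%N => hq.
have a0 : 0 < a by exact: exp2_gt0. have t0 : 0 < t by exact: exp2_gt0.
have r0 := rt_gt0 k0; have rs := rt_sq k; rewrite -/t in rs.
apply: (Rmult_le_reg_r (rt k)) => //.
rewrite /delta Rmult_assoc Rinv_l ?Rmult_1_r; last lra.
apply: Rsqr_incr_0_var; last lra.
rewrite /Rsqr.
have -> : a * rt k * (a * rt k) = (a * a) * (INR k * t) by rewrite -rs; lra.
have : INR k * a ^ 2 * t <= t * t by apply: Rmult_le_compat_r; lra.
rewrite /=; lra.
Qed.

(** The difference over [(M / b, M]] passes to numbers prime to [b] by [psum_block_le]. Of the two
    sums over powers of [p], one is absorbed with its factor [1 / (p + 1)] by [psum_T_ge], and the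
    other, multiplied by [ln p], becomes a sum over halvings. *)
Lemma prime_term_small d b p M : prime p -> prime b -> ~~ (b %| d)%N ->
  ln (INR p) * (pwsum d (fun l => INR (logn p l)) M - pwsum d (fun l => INR (logn p l)) (M %/ b)) <=
  2 * gsum 2 (psum (d * b)) M.
Proof.
move=> pp pb bd; have pg := prime_gt1 pp.
set F := psum (d * b).
have mF : mono F by exact: psum_mono. have F0 : F 0%N = 0 by exact: psum0.
have I0 : 0 <= gsum 2 F M by apply: gsum_ge0; exact: psum_ge0.
case: (boolP (p %| d)%N) => pd; first by rewrite !(sum_h_logn_dvd _ pp pd); lra.
suff hg : pwsum d (fun l => INR (logn p l)) M - pwsum d (fun l => INR (logn p l)) (M %/ b) <= gsum p F (M %/ p).
  have /andP[kpl _] := ilog2P pg.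
  have hT := @gsum_two_ge p (ilog2 p) F M pg kpl mF F0.
  have [h1 _] := ilog2_ln pg; have k1 := INR_ge1 (ilog2_gt0 pg).
  have l0 := ln_prime_gt0 pp.
  have tp0 : 0 <= gsum p F (M %/ p) by apply: gsum_ge0; exact: psum_ge0.
  apply: (Rle_trans _ (ln (INR p) * gsum p F (M %/ p))); first by apply: Rmult_le_compat_l; lra.
  apply: (Rle_trans _ (2 * INR (ilog2 p) * gsum p F (M %/ p))); last lra.
  apply: Rmult_le_compat_r => //; have := ln2_lt1; nra.
rewrite !(sum_h_logn _ pp pd) -Rmult_minus_distr_l.
have [i0 i1] := inv_p1_pos pp.
(* For [p = b] the two double sums telescope to a single one. *)
case: (eqVneq p b) => [e|pnb].
  subst b; rewrite -/F (gsum_rec (M %/ p) pg (gsum0 _ _)).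
  have tp0 : 0 <= gsum p F (M %/ p) by apply: gsum_ge0; exact: psum_ge0.
  have -> : gsum p F (M %/ p) + gsum p (gsum p F) (M %/ p %/ p) - gsum p (gsum p F) (M %/ p %/ p) = gsum p F (M %/ p) by lra.
  nra.
have pdb : ~~ (p %| d * b)%N by rewrite Euclid_dvdM // negb_or pd dvdn_prime2.
have bdp : ~~ (b %| d * p)%N by rewrite Euclid_dvdM // negb_or bd dvdn_prime2 // eq_sym.
apply: (Rle_trans _ (/ (INR p + 1) * gsum p (gsum p (psum (d * b * p))) (M %/ p))).
  apply: Rmult_le_compat_l; first lra.
  have -> : (M %/ b %/ p = M %/ p %/ b)%N by rewrite -!divnMA mulnC.
  apply: gsum_diff_le => //; first exact: gsum0.
  move=> m; apply: gsum_diff_le => //; first exact: psum0.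
  by move=> m'; rewrite mulnAC; apply: psum_block_le.
rewrite -gsum_scale; apply: gsum_le => m _; exact: psum_T_ge.
Qed.

(** Here both sums over powers of [p] are kept and compared with [gsum2], which gains
    [1 / ln p ^ 2]; this makes the total over large primes converge. *)
Lemma prime_term_large d b p M : prime p -> prime b -> ~~ (b %| d)%N -> p != b ->
  ln (INR p) * (pwsum d (fun l => INR (logn p l)) M - pwsum d (fun l => INR (logn p l)) (M %/ b)) <=
  8 * gsum2 (psum (d * b)) M * / (INR p * ln (INR p)).
Proof.
move=> pp pb bd pnb; have pg := prime_gt1 pp.
set F := psum (d * b).
have mF : mono F by exact: psum_mono. have F0 : F 0%N = 0 by exact: psum0.
have B0 : 0 <= gsum2 F M by apply: gsum_ge0 => m; apply: gsum_ge0; exact: psum_ge0.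
have l0 := ln_prime_gt0 pp; have p2 := INR_prime_ge2 pp.
have ip0 : 0 < / (INR p * ln (INR p)) by apply: Rinv_0_lt_compat; nra.
case: (boolP (p %| d)%N) => pd; first by rewrite !(sum_h_logn_dvd _ pp pd) Rminus_diag Rmult_0_r; nra.
rewrite !(sum_h_logn _ pp pd) -Rmult_minus_distr_l.
have [i0 i1] := inv_p1_pos pp.
have bdp : ~~ (b %| d * p)%N by rewrite Euclid_dvdM // negb_or bd dvdn_prime2 // eq_sym.
set D := _ - _.
have hD : D <= gsum p (gsum p F) (M %/ p).
  have -> : D = gsum p (gsum p (psum (d * p))) (M %/ p) - gsum p (gsum p (psum (d * p))) (M %/ p %/ b).
    by rewrite /D (divnAC M b p).
  apply: gsum_diff_le => //; first exact: gsum0.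
  move=> m; apply: gsum_diff_le => //; first exact: psum0.
  move=> m'; apply: (Rle_trans _ (psum (d * p * b) m')); first exact: psum_block_le.
  by apply: psum_dvd; rewrite mulnAC dvdn_mulr.
have /andP[kpl _] := ilog2P pg.
have hB := @gsum2_ge p (ilog2 p) F M pg kpl mF F0.
have [h1 _] := ilog2_ln pg; have k1 := INR_ge1 (ilog2_gt0 pg).
have tt0 : 0 <= gsum p (gsum p F) (M %/ p) by apply: gsum_ge0 => m; apply: gsum_ge0; exact: psum_ge0.
set Z := gsum p (gsum p F) (M %/ p) in hD hB tt0.
set L := ln (INR p) in l0 h1 ip0 *; set P := INR p in p2 ip0 i0 i1 *.
have Lk : L <= 2 * INR (ilog2 p) by have := ln2_lt1; nra.
have LZ : L ^ 2 * Z <= 8 * gsum2 F M.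
  have : L ^ 2 <= 4 * INR (ilog2 p) ^ 2 by nra.
  nra.
apply: (Rle_trans _ (L * (/ (P + 1) * Z))).
  by apply: Rmult_le_compat_l; [lra | apply: Rmult_le_compat_l; lra].
apply: (Rle_trans _ (L * (/ P * Z))).
  apply: Rmult_le_compat_l; first lra; apply: Rmult_le_compat_r => //.
  by apply: Rinv_le_contravar; lra.
have -> : L * (/ P * Z) = (L ^ 2 * Z) * / (P * L) by field; lra.
by apply: Rmult_le_compat_r; lra.
Qed.

(** Every [l] of the block [(M / b, M]] has [ln l >= ln M - ln b >= X / 2]. *)
Lemma pwsum_block_ge d b M X : (0 < b)%N -> (0 < M)%N -> ln (INR b) <= X / 2 -> X <= ln (INR M) ->
  X / 2 * (psum d M - psum d (M %/ b)) <=
  pwsum d (fun l => ln (INR l)) M - pwsum d (fun l => ln (INR l)) (M %/ b).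
Proof.
move=> b0 M0 hb hX; have hM := leq_div M b.
have e1 : psum d M - psum d (M %/ b) = \sum_((M %/ b).+1 <= l < M.+1 | coprime l d) ipsi l.
  by rewrite /psum (@rsum_cat_nat (M %/ b).+1 1 M.+1) //; lra.
have e2 : pwsum d (fun l => ln (INR l)) M - pwsum d (fun l => ln (INR l)) (M %/ b) =
    \sum_((M %/ b).+1 <= l < M.+1 | coprime l d) ipsi l * ln (INR l).
  by rewrite /pwsum (@rsum_cat_nat (M %/ b).+1 1 M.+1) //; lra.
rewrite e1 e2 -rsum_mulr; apply: rsum_le_nat => l /andP[l1 l2] _.
rewrite Rmult_comm; apply: Rmult_le_compat_l; first exact: ipsi_ge0.
have l0 : (0 < l)%N := leq_ltn_trans (leq0n _) l1.
have hl : (M <= l * b)%N by rewrite ltnW // -ltn_divLR.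
have := ln_le (INR_pos M0) (INR_le hl).
by rewrite mult_INR ln_mult; [lra | exact: INR_pos | exact: INR_pos].
Qed.

(* Primes up to [2 ^ (k / 4)] are too few to matter; the others contribute
   [gsum2 / (p ln p)] each, and [gsum2_first_order] saves a square root. *)
Lemma local_decay : exists CB, 0 < CB /\ forall c k d b M,
  0 < c -> (12 <= k)%N -> avoid k d -> prime b -> (b <= 5)%N -> ~~ (b %| d)%N ->
  (M < 2 ^ (2 ^ k))%N -> 6 <= c * INR (2 ^ k)%N -> c * INR (2 ^ k)%N <= ln (INR M) ->
  psum (d * b) M <= CB / c * delta k * psum d M.
Proof.
set s := sqrt (2 * 40960).
have s0 : 0 < s by apply: sqrt_lt_R0; lra.
(* 12 is [2 * 6], from the factor [X / 2] and from a block of mass at least [psum (d * b) M / 6]; 18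
   is [3 * 6], from [b <= 2 ^ 3] and [b + 1 <= 6]. In the last factor, 2 comes from the small primes
   and [512 = 8 * 64] from the large ones. *)
exists (12 * 18 * (2 + 512 * s)); split; first lra.
move=> c k d b M c0 k12 ad pb b5 bd hM hc hX.
have k0 : (0 < k)%N by lia.
set t := INR (2 ^ k)%N in hc hX *; have t0 : 0 < t by exact: exp2_gt0.
have M0 : (0 < M)%N.
  case: M hX {hM} => // h1; exfalso; move: h1; have -> : ln (INR 0) = 0; last lra.
  by rewrite /ln; case: (Rlt_dec 0 (INR 0)) => // h1; exfalso; move: h1; rewrite /=; lra.
have b2 := INR_prime_ge2 pb.
have bk : (0 < b <= 2 ^ k)%N.
  rewrite prime_gt0 //=; apply: (leq_trans b5); apply: (@leq_trans (2 ^ 3)) => //; rewrite leq_exp2l //; lia.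
have adb := avoid_mul ad bk.
have lb : ln (INR b) <= c * t / 2.
  have : ln (INR b) <= ln (INR (2 ^ 3)%N) by apply: ln_le; [lra | apply: INR_le; lia].
  rewrite ln_pow2; have := ln2_lt1; rewrite [INR 3]/=; lra.
have hblk := pwsum_block_ge d (prime_gt0 pb) M0 lb hX.
have hge := psum_block_ge M pb bd.
set F := psum (d * b) in hge *.
have mF : mono F by exact: psum_mono. have F0 : F 0%N = 0 by exact: psum0.
have F00 : 0 <= F M by exact: psum_ge0.
have I0 : 0 <= gsum 2 F M by apply: gsum_ge0; exact: psum_ge0.
have B0 : 0 <= gsum2 F M by apply: gsum_ge0 => m; apply: gsum_ge0; exact: psum_ge0.
have MN : (M <= 2 ^ (2 ^ k))%N by exact: ltnW.
rewrite (sum_h_ln d MN) (@sum_h_ln d (M %/ b) (2 ^ (2 ^ k))) in hblk; last first.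
  by apply: leq_trans MN; exact: leq_div.
rewrite -rsum_sub in hblk.
set q := (k %/ 4)%N.
have q3 : (3 <= q)%N by rewrite /q leq_divRL.
have qk : (q <= 2 ^ k)%N.
  by apply: leq_trans (ltnW (ltn_expl _ (isT : (1 < 2)%N))); exact: leq_div.
rewrite (@rsum_cat_nat (2 ^ q).+1) // in hblk; last by rewrite ltnS leq_exp2l.
have hs : \sum_(1 <= p < (2 ^ q).+1 | prime p)
    (ln (INR p) * pwsum d (fun l => INR (logn p l)) M - ln (INR p) * pwsum d (fun l => INR (logn p l)) (M %/ b))
    <= INR (2 ^ q)%N * (2 * gsum 2 F M).
  apply: (Rle_trans _ (\sum_(1 <= p < (2 ^ q).+1 | prime p) 2 * gsum 2 F M)).
    by apply: rsum_le => p pp; rewrite -Rmult_minus_distr_l; exact: prime_term_small.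
  apply: (Rle_trans _ _ _ (rsum_const_le _ _ _)); first lra.
  by rewrite size_iota subn1 /=; lra.
have hl : \sum_((2 ^ q).+1 <= p < (2 ^ 2 ^ k).+1 | prime p)
    (ln (INR p) * pwsum d (fun l => INR (logn p l)) M - ln (INR p) * pwsum d (fun l => INR (logn p l)) (M %/ b))
    <= 8 * gsum2 F M * (8 / INR q).
  apply: (Rle_trans _ (\sum_((2 ^ q).+1 <= p < (2 ^ 2 ^ k).+1 | prime p)
      8 * gsum2 F M * / (INR p * ln (INR p)))).
    apply: rsum_le_nat => p /andP[pq _] pp; rewrite -Rmult_minus_distr_l.
    apply: prime_term_large => //; rewrite neq_ltn; apply/orP; right.
    apply: (leq_ltn_trans b5); apply: leq_ltn_trans pq; apply: (@leq_trans (2 ^ 3)) => //.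
    by rewrite leq_exp2l.
  by rewrite rsum_mulr; apply: Rmult_le_compat_l; [lra | apply: sum_inv_plnp_upper; lia].
have r0 := rt_gt0 k0; have rs := rt_sq k; rewrite -/t in rs.
have k1 := INR_ge1 k0.
have hB1 : gsum2 F M <= s * rt k * gsum 2 F M.
  have -> : s * rt k = sqrt (2 * (40960 * (INR k * t))).
    rewrite /s /rt -sqrt_mult; [congr sqrt; rewrite -/t; lra | lra | rewrite -/t; nra].
  apply: (@gsum2_first_order F _ M) => //; first nra.
  by move=> m mM; apply: second_order => //; exact: leq_ltn_trans mM hM.
have hI : gsum 2 F M <= 18 * psum d M.
  have h1 := @gsum_two_le b 3 F M (prime_gt1 pb) (leq_trans b5 (isT : (5 <= 2 ^ 3)%N)) mF F0.
  have h2 := psum_T_ge M pb bd; rewrite -/F in h2.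
  have b5' : INR b <= 5 by have := INR_le b5; rewrite /=; lra.
  have tb : gsum b F M <= (INR b + 1) * psum d M.
    have := Rmult_le_compat_l (INR b + 1) _ _ ltac:(lra) h2.
    by rewrite -Rmult_assoc Rinv_r ?Rmult_1_l //; lra.
  have := psum_ge0 d M; rewrite [INR 3]/= in h1; nra.
have hq : 8 / INR q <= 64 / INR k.
  have kq : INR k <= 8 * INR q.
    have : (k <= 8 * q)%N by have := divn_eq k 4; have := ltn_mod k 4; rewrite -/q; lia.
    by move/INR_le; rewrite mult_INR /=; lra.
  have q0 : 0 < INR q by apply: INR_pos; lia.
  apply: (Rmult_le_reg_r (INR q * INR k)); first nra.
  have -> : 8 / INR q * (INR q * INR k) = 8 * INR k by field; lra.
  have -> : 64 / INR k * (INR q * INR k) = 64 * INR q by field; lra.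
  lra.
have d0 := delta_gt0 k0.
have hrk : rt k / INR k = t * delta k.
  rewrite /delta; apply: (Rmult_eq_reg_r (INR k * rt k)); last nra.
  have -> : rt k / INR k * (INR k * rt k) = rt k * rt k by field; lra.
  by rewrite rs; field; lra.
have hq2 : INR (2 ^ q)%N <= t * delta k by apply: quarter_exp_rt; lia.
have tot : c * t / 2 * (psum d M - psum d (M %/ b)) <= (2 + 512 * s) * (t * delta k) * gsum 2 F M.
  apply: (Rle_trans _ _ _ hblk); apply: (Rle_trans _ _ _ (Rplus_le_compat _ _ _ _ hs hl)).
  have h1 : 8 * gsum2 F M * (8 / INR q) <= 8 * (s * rt k * gsum 2 F M) * (64 / INR k).
    apply: Rmult_le_compat => //; try lra.
    by apply: Rmult_le_pos; [lra | left; apply: Rinv_0_lt_compat; apply: INR_pos; lia].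
  have e : 8 * (s * rt k * gsum 2 F M) * (64 / INR k) = 512 * s * (rt k / INR k) * gsum 2 F M by field; lra.
  rewrite e hrk in h1; nra.
have b5' : INR b <= 5 by have := INR_le b5; rewrite /=; lra.
have hF6 : F M / 6 <= psum d M - psum d (M %/ b).
  apply: Rle_trans hge; apply: Rmult_le_compat_l => //; apply: Rinv_le_contravar; lra.
have ct : 0 < c * t by nra.
have fin : c * t * F M <= 12 * ((2 + 512 * s) * (t * delta k) * (18 * psum d M)).
  have h1 : (2 + 512 * s) * (t * delta k) * gsum 2 F M <= (2 + 512 * s) * (t * delta k) * (18 * psum d M).
    by apply: Rmult_le_compat_l => //; apply: Rmult_le_pos; [lra | nra].
  have h2 : c * t / 2 * (F M / 6) <= c * t / 2 * (psum d M - psum d (M %/ b)) by apply: Rmult_le_compat_l; lra.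
  lra.
apply: (Rmult_le_reg_l (c * t)) => //; apply: (Rle_trans _ _ _ fin).
by apply: Req_le; field; lra.
Qed.

(** * Growth and removal of one prime *)

Lemma exp_ge_pow4 x : 0 <= x -> (x / 4) ^ 4 <= exp x.
Proof.
move=> x0; have -> : exp x = exp (x / 4) ^ 4.
  by rewrite /= Rmult_1_r -!exp_plus; congr exp; lra.
by apply: pow_incr; have := exp_ineq1_le (x / 4); lra.
Qed.

Lemma exp2_exp k : INR (2 ^ k)%N = exp (INR k * ln 2).
Proof. by rewrite -ln_pow2 exp_ln //; exact: exp2_gt0. Qed.

(** The thresholds on [k] below all rest on this comparison; the third power is what
    [A * k ^ 2 <= rt k] amounts to. *)
Lemma cube_beats A : exists k0, (0 < k0)%N /\ forall k, (k0 <= k)%N -> A * INR k ^ 3 <= INR (2 ^ k)%N.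
Proof.
have [n hn] := INR_unbounded (4096 * Rabs A).
exists n.+1; split => // k nk.
have kr : 4096 * Rabs A <= INR k by have := INR_le nk; rewrite S_INR; lra.
have k0 : 0 < INR k by apply: INR_pos; lia.
have g := ln2_gt.
apply: (Rle_trans _ (INR k ^ 4 / 4096)).
  have h1 : A <= Rabs A by exact: Rle_abs.
  have k3 : 0 <= INR k ^ 3 by apply: pow_le; lra.
  have -> : INR k ^ 4 / 4096 = INR k / 4096 * INR k ^ 3 by field.
  by apply: Rmult_le_compat_r => //; lra.
rewrite exp2_exp; apply: Rle_trans (exp_ge_pow4 _); last by nra.
have -> : INR k ^ 4 / 4096 = (INR k / 8) ^ 4 by field.
by apply: pow_incr; nra.
Qed.

Lemma rt_le_t eps : 0 < eps -> exists k0, (0 < k0)%N /\ forall k, (k0 <= k)%N -> rt k <= eps * INR (2 ^ k)%N.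
Proof.
move=> e0; have [k0 [k00 hk]] := cube_beats (/ eps ^ 2).
exists k0; split => // k kk; have := hk k kk.
have t0 := exp2_gt0 k; have k1 : 1 <= INR k by apply: INR_ge1; lia.
have e2 : 0 < eps ^ 2 by apply: pow_lt.
move=> h1.
have h2 : INR k <= eps ^ 2 * INR (2 ^ k)%N.
  have := Rmult_le_compat_l _ _ _ (Rlt_le _ _ e2) h1.
  rewrite -Rmult_assoc Rinv_r ?Rmult_1_l; last lra.
  have : INR k <= INR k ^ 3 by nra.
  lra.
apply: Rsqr_incr_0_var; last nra.
rewrite /Rsqr rt_sq; nra.
Qed.

Lemma k_le_rt A : exists k0, (0 < k0)%N /\ forall k, (k0 <= k)%N -> A * INR k <= rt k.
Proof.
have [k0 [k00 hk]] := cube_beats (A ^ 2).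
exists k0; split => // k kk; have := hk k kk.
have t0 := exp2_gt0 k; have k1 : 1 <= INR k by apply: INR_ge1; lia.
move=> h1; apply: Rsqr_incr_0_var; last by apply/Rlt_le/rt_gt0; lia.
rewrite /Rsqr rt_sq.
have -> : A * INR k * (A * INR k) = A ^ 2 * INR k ^ 2 by ring.
have a2 : 0 <= A ^ 2 by nra.
have : A ^ 2 * INR k ^ 2 <= A ^ 2 * INR k ^ 3 by apply: Rmult_le_compat_l => //; nra.
nra.
Qed.

Lemma t_large A : exists k0, (0 < k0)%N /\ forall k, (k0 <= k)%N -> A <= INR (2 ^ k)%N.
Proof.
have [k0 [k00 hk]] := cube_beats (Rabs A).
exists k0; split => // k kk; have := hk k kk.
have k1 : 1 <= INR k by apply: INR_ge1; lia.
have := Rle_abs A; have := Rabs_pos A => a0 a1.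
have : 1 <= INR k ^ 3 by rewrite -(pow1 3); apply: pow_incr; lra.
nra.
Qed.

Lemma leq_of_INR m n : INR m <= INR n -> (m <= n)%N.
Proof. by move=> h1; apply/leP; exact: RIneq.INR_le. Qed.

Lemma leq_expl a b j : (a <= b)%N -> (a ^ j <= b ^ j)%N.
Proof. by case: j => // j ab; rewrite leq_exp2r. Qed.

Lemma exp_ln_le x y : 0 < y -> ln x <= ln y -> x <= y.
Proof.
move=> y0 h1; case: (Rle_lt_dec x 0) => [|x0]; first lra.
by case: (Rle_lt_dec x y) => // yx; have := ln_increasing _ _ y0 yx; lra.
Qed.

(** [g] is the free prime to which [local_decay] is applied. The bound by [1 / 4] is included
    because the rate must stay below the decay of [hat]: it makes the tail in [hsum_up] a convergent
    geometric series. *)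
Definition growth_rate (c CG : R) (k0 : nat) := forall k d g M i,
  (k0 <= k)%N -> avoid k d -> prime g -> (g <= 5)%N -> ~~ (g %| d)%N ->
  c * INR (2 ^ k)%N <= ln (INR M) -> (M * 2 ^ i < 2 ^ (2 ^ k))%N ->
  CG * delta k <= / 4 /\ (1 - CG * delta k) ^ i * psum d (M * 2 ^ i) <= psum d M.

Lemma ln_ge_pos M x : 0 < x -> x <= ln (INR M) -> (0 < M)%N.
Proof.
case: M => // x0 h1; exfalso; move: h1; have -> : ln (INR 0) = 0; last lra.
by rewrite /ln; case: (Rlt_dec 0 (INR 0)) => // h1; exfalso; move: h1; rewrite /=; lra.
Qed.

(** The block [(m / 2, m]] lies in [(m / g, m]], whose mass is at most [psum (d * g) m], a fraction
    of order [delta k] of [psum d m]. *)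
Lemma growth c : 0 < c -> exists CG k0, 0 < CG /\ (12 <= k0)%N /\ growth_rate c CG k0.
Proof.
move=> c0; have [CB [CB0 hCB]] := local_decay.
have [k1 [k10 hk1]] := t_large (6 / c).
set CG := CB / c; have CG0 : 0 < CG by apply: Rdiv_lt_0_compat.
have [k2 [k20 hk2]] := k_le_rt (4 * CG).
exists CG, (maxn 12 (maxn k1 k2)); split => //; split; first by lia.
move=> k d g M i kk ad pg g5 gd hM.
have hk12 : (12 <= k)%N by lia.
have c6 : 6 <= c * INR (2 ^ k)%N.
  have := hk1 k ltac:(lia) => h1; have := Rmult_le_compat_l c _ _ ltac:(lra) h1.
  have -> : c * (6 / c) = 6 by field; lra.
  lra.
have dl : CG * delta k <= / 4.
  have h1 := hk2 k ltac:(lia).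
  have r0 : 0 < rt k by apply: rt_gt0; lia.
  have kr : 1 <= INR k by apply: INR_ge1; lia.
  apply: (Rmult_le_reg_r (4 * rt k)); first lra.
  have -> : CG * delta k * (4 * rt k) = 4 * CG by rewrite /delta; field; lra.
  nra.
have d0 : 0 < CG * delta k by apply: Rmult_lt_0_compat => //; apply: delta_gt0; lia.
have M0 : (0 < M)%N by apply: ln_ge_pos hM; lra.
elim: i => [|i IH] hi; first by split => //; rewrite expn0 muln1 /=; lra.
split => //.
have hi' : (M * 2 ^ i < 2 ^ 2 ^ k)%N.
  by apply: leq_ltn_trans hi; rewrite leq_mul2l leq_exp2l // leqnSn orbT.
have [_ {}IH] := IH hi'.
apply: Rle_trans IH.
rewrite /= [_ * (_ ^ i)]Rmult_comm Rmult_assoc; apply: Rmult_le_compat_l; first by apply: pow_le; lra.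
set m := (M * 2 ^ i.+1)%N in hi *.
have mM : (M <= m)%N by rewrite /m leq_pmulr // expn_gt0.
have lm : c * INR (2 ^ k)%N <= ln (INR m).
  by apply: (Rle_trans _ _ _ hM); apply: ln_le; [exact: INR_pos | exact: INR_le].
have h1 := hCB c k d g m c0 hk12 ad pg g5 gd hi c6 lm.
have h2 := psum_block_le m pg gd.
have h3 : psum d (m %/ g) <= psum d (M * 2 ^ i).
  apply: psum_mono; rewrite -(mulnK (M * 2 ^ i) (isT : (0 < 2)%N)) -mulnA -expnSr -/m.
  by apply: leq_div2l => //; exact: prime_gt1.
rewrite -/CG in h1; lra.
Qed.

Lemma bernoulli x i : 0 <= x <= 1 -> 1 - INR i * x <= (1 - x) ^ i.
Proof.
move=> x01; elim: i => [|i IH]; first by rewrite /=; lra.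
rewrite S_INR /=; have := pos_INR i; have p0 : 0 <= (1 - x) ^ i by apply: pow_le; lra.
nra.
Qed.

Lemma nfloor_spec x : 0 <= x -> INR (nfloor x) <= x < INR (nfloor x) + 1.
Proof.
move=> x0; rewrite /nfloor; have [h1 h2] := base_Int_part x.
have z0 : (0 <= Int_part x)%Z.
  have : (-1 < Int_part x)%Z; last by lia.
  by apply: lt_IZR; lra.
by rewrite INR_IZR_INZ Znat.Z2Nat.id //; lra.
Qed.

(** By [growth], with 3 as the free prime, [psum (d * p)] loses at most half of its value over about
    [1 / (delta k * ln p)] divisions by [p]. All these terms count in [psum_T_ge], so that many
    copies of [psum (d * p) M] fit in a multiple of [(p + 1) * psum d M]. *)
Lemma psum_ratio c : 0 < c -> exists C k0, 0 < C /\ forall k d p M,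
  (k0 <= k)%N -> avoid k d -> ~~ (3 %| d)%N -> prime p -> p != 3%N -> ~~ (p %| d)%N ->
  (p <= 2 ^ k)%N -> 2 * c * INR (2 ^ k)%N <= ln (INR M) -> (M < 2 ^ (2 ^ k.-1))%N ->
  psum (d * p) M <= C * delta k * (INR p * ln (INR p)) * psum d M.
Proof.
move=> c0; have [CG [k1 [CG0 [k112 gr]]]] := growth c0.
have [k2 [k20 hk2]] := k_le_rt (8 * CG).
have m0 : 0 < Rmin c (/ 2) by apply: Rmin_glb_lt; lra.
have [k3 [k30 hk3]] := @rt_le_t (2 * CG * Rmin c (/ 2)) ltac:(apply: Rmult_lt_0_compat; lra).
exists (128 * CG), (maxn k1 (maxn k2 k3)); split; first lra.
move=> k d p M; rewrite !geq_max => /and3P[kk1 kk2 kk3] ad d3 pp p3 pd pk hM hM2.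
have k0 : (0 < k)%N := leq_trans k20 kk2.
have kr := INR_ge1 k0.
have {}hk2 := hk2 k kk2. have {}hk3 := hk3 k kk3.
have r0 : 0 < rt k := rt_gt0 k0.
set t := INR (2 ^ k)%N in hM hk3 *; have t0 : 0 < t := exp2_gt0 k.
(* [X] is the number of halvings over which the total loss [X * CG * delta k] is exactly [1 / 2]. *)
set X := rt k / (2 * CG).
have X0 : 4 * INR k <= X.
  apply: (Rmult_le_reg_r (2 * CG)); first lra.
  have -> : X * (2 * CG) = rt k by rewrite /X; field; lra.
  lra.
have Xm : X <= Rmin c (/ 2) * t.
  apply: (Rmult_le_reg_r (2 * CG)); first lra.
  have -> : X * (2 * CG) = rt k by rewrite /X; field; lra.
  lra.
have Xc : X <= c * t.
  by apply: (Rle_trans _ _ _ Xm); apply: Rmult_le_compat_r; [lra | exact: Rmin_l].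
have Xh : X <= / 2 * t.
  by apply: (Rle_trans _ _ _ Xm); apply: Rmult_le_compat_r; [lra | exact: Rmin_r].
have [I1 I2] := @nfloor_spec X ltac:(lra).
set I := nfloor X in I1 I2.
have pg := prime_gt1 pp.
set e := (ilog2 p).+1.
have /andP[kpl kpu] := ilog2P pg.
have ek : (e <= k.+1)%N by rewrite /e ltnS -(@leq_exp2l 2) // (leq_trans kpl).
have eI : (e <= I)%N.
  have : INR e <= INR I by have := INR_le ek; rewrite S_INR; lra.
  by move/leq_of_INR.
have pe : (p <= 2 ^ e)%N by exact: ltnW.
set J := (I %/ e)%N.
have I2k : (I <= 2 ^ k.-1)%N.
  apply: leq_of_INR; have : t = 2 * INR (2 ^ k.-1)%N.
    by rewrite /t -{1}(prednK k0) expnS mult_INR /=; lra.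
  lra.
have adp : avoid k (d * p) by apply: avoid_mul => //; rewrite prime_gt0.
have d3p : ~~ (3 %| d * p)%N by rewrite Euclid_dvdM // negb_or d3 dvdn_prime2 // eq_sym.
have Mpos : (0 < M)%N by apply: ln_ge_pos hM; nra.
have step j : (j < J)%N -> / 2 * psum (d * p) M <= psum (d * p) (M %/ p ^ j).
  move=> jJ.
  have ejI : (e * j + 1 <= I)%N.
    have : (e * j.+1 <= I)%N by apply: leq_trans (leq_divM I e); rewrite mulnC leq_mul2r jJ orbT.
    by apply: leq_trans; rewrite mulnS addnC leq_add2r.
  have pj0 : (0 < p ^ j)%N by rewrite expn_gt0 prime_gt0.
  have pj : (p ^ j <= 2 ^ (e * j))%N by rewrite expnM leq_expl.
  set M' := (M %/ p ^ j)%N.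
  have MM' : (M < 2 * M' * p ^ j)%N.
    have M'0 : (0 < M')%N.
      rewrite /M' divn_gt0 //; apply: leq_of_INR.
      apply: exp_ln_le; first exact: INR_pos.
      have h1 := ln_le (INR_pos pj0) (INR_le pj); rewrite ln_pow2 in h1.
      have h2 : INR (e * j) <= INR I by apply: INR_le; apply: leq_trans ejI; exact: leq_addr.
      have := ln2_lt1; have := pos_INR (e * j); nra.
    have := ltn_ceil M pj0; rewrite -/M' => h1; apply: (leq_trans h1); rewrite leq_mul2r; lia.
  (* The exponent has one more than [e * j] because of the rounding in [M %/ p ^ j]. *)
  have Mi : (M <= M' * 2 ^ (e * j + 1))%N.
    rewrite addn1 expnS mulnCA mulnA; apply: (leq_trans (ltnW MM')); rewrite leq_mul2l pj orbT //.
  have lM' : c * t <= ln (INR M').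
    have h1 := ln_le (INR_pos Mpos) (INR_le Mi).
    have M'0 : (0 < M')%N by case: (M') MM' => //; rewrite muln0 mul0n.
    rewrite mult_INR ln_mult in h1; [|exact: INR_pos|exact: exp2_gt0].
    rewrite ln_pow2 in h1.
    have h2 := INR_le ejI; have := ln2_lt1; have := pos_INR (e * j + 1); nra.
  have hlt : (M' * 2 ^ (e * j + 1) < 2 ^ (2 ^ k))%N.
    have -> : (2 ^ 2 ^ k = 2 ^ 2 ^ k.-1 * 2 ^ 2 ^ k.-1)%N by rewrite -expnD addnn -mul2n -expnS prednK.
    apply: (@leq_ltn_trans (M' * 2 ^ (2 ^ k.-1))).
      by rewrite leq_mul2l leq_exp2l ?(leq_trans ejI) // orbT.
    by rewrite ltn_mul2r expn_gt0 /=; apply: leq_ltn_trans hM2; exact: leq_div.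
  have [hd hg] := gr k (d * p)%N 3%N M' (e * j + 1)%N kk1 adp isT isT d3p lM' hlt.
  apply: Rle_trans hg.
  have hx0 : 0 < CG * delta k by apply: Rmult_lt_0_compat => //; exact: delta_gt0.
  have hb := @bernoulli (CG * delta k) (e * j + 1) ltac:(lra).
  have hm := psum_mono (d * p) Mi.
  have h2 : INR (e * j + 1) * (CG * delta k) <= / 2.
    apply: (Rle_trans _ (X * (CG * delta k))).
      by apply: Rmult_le_compat_r; [lra | have := INR_le ejI; lra].
    by apply: Req_le; rewrite /X /delta; field; lra.
  have := psum_ge0 (d * p) M; nra.
have hT := psum_T_ge M pp pd.
have hsum : INR J * (/ 2 * psum (d * p) M) <= gsum p (psum (d * p)) M.
  rewrite (gsum_unroll M J pg (psum0 _)).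
  have t00 : 0 <= gsum p (psum (d * p)) (M %/ p ^ J) by apply: gsum_ge0; exact: psum_ge0.
  suff : INR J * (/ 2 * psum (d * p) M) <= \sum_(0 <= i < J) psum (d * p) (M %/ p ^ i) by lra.
  have -> : INR J * (/ 2 * psum (d * p) M) = \sum_(0 <= i < J) (/ 2 * psum (d * p) M).
    elim: (J) => [|n IH]; first by rewrite big_geq //=; lra.
    by rewrite rsum_recr // -IH S_INR; lra.
  by apply: rsum_le_nat => i /andP[_ iJ] _; exact: step.
have hJ : X / (4 * INR e) <= INR J.
  have e0 : 0 < INR e by exact: INR_pos.
  have h1 : (I <= 2 * (J * e))%N.
    have := divn_eq I e; have := ltn_pmod I (ltn0Sn (ilog2 p)); rewrite -/e -/J.
    have : (e <= J * e)%N by rewrite leq_pmull // /J divn_gt0.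
    move=> h3 h4 h5; rewrite h5 mul2n -addnn leq_add2l; exact: ltnW (leq_trans h4 h3).
  have h2 := INR_le h1; rewrite !mult_INR [INR 2]/= in h2.
  apply: (Rmult_le_reg_r (4 * INR e)); first lra.
  have -> : X / (4 * INR e) * (4 * INR e) = X by field; lra.
  lra.
have el : INR e <= 4 * ln (INR p).
  rewrite S_INR; have [_ h2] := ilog2_ln pg; have := ln2_gt; have := INR_ge1 (ilog2_gt0 pg).
  have := @ln_le 2 _ ltac:(lra) (INR_prime_ge2 pp); nra.
have l0 := ln_prime_gt0 pp; have p2 := INR_prime_ge2 pp.
set L := ln (INR p) in el l0 *; set P := INR p in hT p2 *.
have hJ2 : rt k / (32 * CG * L) <= INR J.
  apply: Rle_trans hJ.
  have -> : X / (4 * INR e) = rt k / (8 * CG * INR e) by rewrite /X; field; have := pos_INR (ilog2 p); rewrite S_INR; lra.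
  apply: Rmult_le_compat_l; first lra.
  apply: Rinv_le_contravar; first by apply: Rmult_lt_0_compat; [lra | exact: INR_pos].
  nra.
have Hp0 := psum_ge0 (d * p) M.
have h1 : rt k / (32 * CG * L) * (/ 2 * psum (d * p) M) <= (P + 1) * psum d M.
  apply: (Rle_trans _ (INR J * (/ 2 * psum (d * p) M))); first by apply: Rmult_le_compat_r; lra.
  apply: (Rle_trans _ _ _ hsum).
  have := Rmult_le_compat_l (P + 1) _ _ ltac:(lra) hT.
  by rewrite -Rmult_assoc Rinv_r ?Rmult_1_l //; lra.
have hc : 0 < 64 * CG * L * delta k.
  by apply: Rmult_lt_0_compat; [nra | exact: delta_gt0].
have := Rmult_le_compat_l _ _ _ (Rlt_le _ _ hc) h1.
have -> : 64 * CG * L * delta k * (rt k / (32 * CG * L) * (/ 2 * psum (d * p) M)) = psum (d * p) M.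
  by rewrite /delta; field; lra.
move=> h2; apply: (Rle_trans _ _ _ h2).
have -> : 128 * CG * delta k * (P * L) * psum d M = 64 * CG * L * delta k * (2 * P * psum d M) by lra.
apply: Rmult_le_compat_l; first lra.
have := psum_ge0 d M; nra.
Qed.

(** * The hat-weighted sums *)

Lemma Rpower_pos x y : 0 < Rpower x y.
Proof. exact: exp_pos. Qed.

Lemma Rpower_mono x y a : 0 < x -> x <= y -> 0 <= a -> Rpower x a <= Rpower y a.
Proof. by move=> x0 xy a0; apply: Rle_Rpower_l => //; split. Qed.

Lemma exp_le x y : x <= y -> exp x <= exp y.
Proof. by move=> [xy|->]; [left; exact: exp_increasing | lra]. Qed.

Section Weight.
Variable a : R.
Hypothesis a0 : 0 < a.

Definition hat (u : R) : R := Rmin (Rpower u a) (/ u).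

Lemma hat_gt0 u : 0 < u -> 0 < hat u.
Proof. by move=> u0; apply: Rmin_glb_lt; [exact: Rpower_pos | exact: Rinv_0_lt_compat]. Qed.

Lemma hat_le_inv u : hat u <= / u.
Proof. exact: Rmin_r. Qed.

Lemma hat_le_pow u : hat u <= Rpower u a.
Proof. exact: Rmin_l. Qed.

Lemma hat_le1 u : 0 < u -> hat u <= 1.
Proof.
move=> u0; case: (Rle_lt_dec u 1) => h1.
  apply: (Rle_trans _ _ _ (hat_le_pow u)).
  have -> : 1 = Rpower 1 a by rewrite /Rpower ln_1 Rmult_0_r exp_0.
  by apply: Rpower_mono; lra.
apply: (Rle_trans _ _ _ (hat_le_inv u)); rewrite -Rinv_1; apply: Rinv_le_contravar; lra.
Qed.

Lemma hat_ge u : / 2 <= u <= 1 -> Rpower (/ 2) a <= hat u.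
Proof.
move=> [u1 u2]; apply: Rmin_glb; first by apply: Rpower_mono; lra.
apply: (@Rle_trans _ 1).
  have -> : 1 = Rpower 1 a by rewrite /Rpower ln_1 Rmult_0_r exp_0.
  by apply: Rpower_mono; lra.
rewrite -{1}Rinv_1; apply: Rinv_le_contravar; lra.
Qed.

Definition lipc : R := (a + 1) * exp (a + 1).

Lemma lipc_gt0 : 0 < lipc.
Proof. by apply: Rmult_lt_0_compat; [lra | exact: exp_pos]. Qed.

(** The two branches of [hat] scale by [s ^ (- a)] and by [s]; both exponents lie between
    [- (a + 1)] and [a + 1]. *)
Lemma hat_scale u s : 0 < u -> 1 <= s ->
  Rpower s (- (a + 1)) * hat u <= hat (u / s) <= Rpower s (a + 1) * hat u.
Proof.
move=> u0 s1.
have us : 0 < u / s by apply: Rdiv_lt_0_compat; lra.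
have e1 : Rpower (u / s) a = Rpower s (- a) * Rpower u a.
  rewrite /Rdiv -Rpower_mult_distr //; last by apply: Rinv_0_lt_compat; lra.
  by rewrite Rmult_comm; congr (_ * _); rewrite /Rpower ln_Rinv; [congr exp; lra | lra].
have e2 : / (u / s) = s * / u by field; lra.
have s1' : 1 <= Rpower s 1 by rewrite Rpower_1; lra.
have m x y : x <= y -> Rpower s x <= Rpower s y by move=> xy; apply: Rle_Rpower.
have r1 : Rpower s 1 = s by rewrite Rpower_1; lra.
have p0 := Rpower_pos u a; have iu : 0 < / u by exact: Rinv_0_lt_compat.
split.
  apply: Rmin_glb; rewrite ?e1 ?e2.
    apply: Rmult_le_compat; [exact/Rlt_le/Rpower_pos | exact/Rlt_le/hat_gt0 | apply: m; lra | exact: hat_le_pow].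
  apply: Rmult_le_compat; [exact/Rlt_le/Rpower_pos | exact/Rlt_le/hat_gt0 | | exact: hat_le_inv].
  by rewrite -{2}r1; apply: m; lra.
rewrite {2}/hat; case: (Rle_lt_dec (Rpower u a) (/ u)) => h1.
  rewrite Rmin_left //; apply: (Rle_trans _ _ _ (hat_le_pow _)); rewrite e1.
  by apply: Rmult_le_compat_r; [lra | apply: m; lra].
rewrite Rmin_right; last lra; apply: (Rle_trans _ _ _ (hat_le_inv _)); rewrite e2.
by apply: Rmult_le_compat_r; [lra | rewrite -{1}r1; apply: m; lra].
Qed.

(** With [y = (a + 1) * ln s <= a + 1], this is [exp y - 1 <= y * exp y]. *)
Lemma Rpower_lip s : 1 <= s <= 2 -> Rpower s (a + 1) - 1 <= lipc * (s - 1).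
Proof.
move=> [s1 s2].
have ls : ln s <= s - 1.
  have := exp_ineq1_le (s - 1) => h1; have := @ln_le s (exp (s - 1)) ltac:(lra) ltac:(lra).
  by rewrite ln_exp.
have l0 := ln_ge0 s1.
set y := (a + 1) * ln s.
have y0 : 0 <= y by apply: Rmult_le_pos; lra.
have h1 : exp y * (1 - y) <= 1.
  have := exp_ineq1_le (- y) => h1; have e0 := exp_pos y.
  have := Rmult_le_compat_l _ _ _ (Rlt_le _ _ e0) h1.
  by rewrite -exp_plus (_ : y + - y = 0) ?exp_0; lra.
have ya : y <= a + 1 by rewrite /y; nra.
have ey : exp y <= exp (a + 1) by exact: exp_le.
rewrite /Rpower -/y /lipc.
have yl : y <= (a + 1) * (s - 1) by apply: Rmult_le_compat_l; lra.
have e0 := exp_pos y.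
have : y * exp y <= ((a + 1) * (s - 1)) * exp (a + 1) by apply: Rmult_le_compat; lra.
lra.
Qed.

Lemma hat_lip u s : 0 < u -> 1 <= s <= 2 -> Rabs (hat (u / s) - hat u) <= lipc * (s - 1) * hat u.
Proof.
move=> u0 hs; have [h1 h2] := hat_scale u0 (proj1 hs).
have hl := Rpower_lip hs; have w0 := hat_gt0 u0.
have hi : 1 - Rpower s (- (a + 1)) <= Rpower s (a + 1) - 1.
  rewrite Rpower_Ropp; set z := Rpower s (a + 1); have z0 : 0 < z by exact: Rpower_pos.
  have iz : 0 < / z by exact: Rinv_0_lt_compat.
  have -> : / z = / z * (z - 1) ^ 2 + 2 - z by field; lra.
  have := Rmult_le_pos _ _ (Rlt_le _ _ iz) (pow2_ge_0 (z - 1)); lra.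
apply: Rabs_le; split; nra.
Qed.

(** This is [V_d(L)] of the overview, cut off at [N]. The cut keeps the sum finite but spoils
    exactness under dilation; [tail_small] bounds the resulting error. *)
Definition hsum (N d : nat) (L : R) : R := pwsum d (fun l => hat (INR l / L)) N.

Lemma hsum_ge0 N d L : 0 < L -> 0 <= hsum N d L.
Proof.
move=> L0; rewrite /hsum /pwsum big_nat_cond; apply: rsum_ge0 => l /andP[/andP[l0 _] _].
apply: Rmult_le_pos; first exact: ipsi_ge0.
by apply/Rlt_le/hat_gt0/Rdiv_lt_0_compat => //; exact: INR_pos.
Qed.

Lemma hsum_lip N d L s : 0 < L -> 1 <= s <= 2 ->
  Rabs (hsum N d (s * L) - hsum N d L) <= lipc * (s - 1) * hsum N d L.
Proof.
move=> L0 hs; rewrite /hsum /pwsum -rsum_sub.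
apply: (Rle_trans _ _ _ (rsum_abs _ _ _)); rewrite -rsum_mulr.
apply: rsum_le_nat => l /andP[l0 _] _.
have lp := INR_pos l0.
rewrite -Rmult_minus_distr_l Rabs_mult (Rabs_pos_eq (ipsi l)); last exact: ipsi_ge0.
have -> : INR l / (s * L) = INR l / L / s by field; lra.
have := @hat_lip (INR l / L) s ltac:(apply: Rdiv_lt_0_compat; lra) hs.
have := ipsi_ge0 l; nra.
Qed.

(** Only the [l] between [L / 2] and [L] are kept: there [hat] is at least [2 ^ (- a)], and by
    [psum_block_ge] with the prime 2 their mass is at least a third of [psum (d * 2)]. *)
Lemma hsum_low N d L : ~~ (2 %| d)%N -> 1 <= L -> L <= INR N ->
  Rpower (/ 2) a / 3 * psum (d * 2) (nfloor L) <= hsum N d L.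
Proof.
move=> d2' L1 LN.
have [f1 f2] := @nfloor_spec L ltac:(lra); set M := nfloor L in f1 f2 *.
have MN : (M <= N)%N by apply: leq_of_INR; lra.
have hb := psum_block_ge M (isT : prime 2) d2'.
have q0 := Rpower_pos (/ 2) a.
apply: (Rle_trans _ (Rpower (/ 2) a * (psum d M - psum d (M %/ 2)))).
  rewrite (_ : INR 2 + 1 = 3) in hb; last by rewrite /=; lra.
  by have := Rmult_le_compat_l _ _ _ (Rlt_le _ _ q0) hb; rewrite /Rdiv; lra.
have e1 : psum d M - psum d (M %/ 2) = \sum_((M %/ 2).+1 <= l < M.+1 | coprime l d) ipsi l.
  by rewrite /psum (@rsum_cat_nat (M %/ 2).+1 1 M.+1) ?ltnS ?leq_div //; lra.
rewrite e1 -rsum_mulr.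
apply: (Rle_trans _ (\sum_((M %/ 2).+1 <= l < M.+1 | coprime l d) ipsi l * hat (INR l / L))).
  apply: rsum_le_nat => l /andP[l1 l2] _; rewrite Rmult_comm.
  apply: Rmult_le_compat_l; first exact: ipsi_ge0.
  apply: hat_ge; split.
    have : (M < l * 2)%N by rewrite -ltn_divLR.
    move/INR_le; rewrite S_INR mult_INR [INR 2]/= => h1.
    apply: (Rmult_le_reg_r L); first lra.
    have -> : INR l / L * L = INR l by field; lra.
    lra.
  apply: (Rmult_le_reg_r L); first lra.
  have -> : INR l / L * L = INR l by field; lra.
  have : INR l <= INR M by apply: INR_le.
  lra.
have h1 : (M.+1 <= N.+1)%N by [].
rewrite /hsum /pwsum (big_nat_widen _ _ _ _ _ h1) (big_nat_widenl _ _ _ _ _ (ltn0Sn (M %/ 2))).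
apply: rsum_le_pred => l.
  by move=> _ /andP[/andP[]].
rewrite mem_index_iota => /andP[l0 _] _; apply: Rmult_le_pos; first exact: ipsi_ge0.
by apply/Rlt_le/hat_gt0/Rdiv_lt_0_compat; [exact: INR_pos | lra].
Qed.

Definition geo : R := / (1 - Rpower (/ 2) a).

Lemma half_pow_lt1 : 0 < Rpower (/ 2) a < 1.
Proof.
split; first exact: Rpower_pos.
rewrite /Rpower -exp_0; apply: exp_increasing; rewrite ln_Rinv; last lra.
have := ln2_gt; nra.
Qed.

Lemma geo_gt0 : 0 < geo.
Proof. by apply: Rinv_0_lt_compat; have := half_pow_lt1; lra. Qed.

(** The top block [(M / b, M]] contributes at most [M ^ a * psum (e * b) M]. Each further block
    loses a factor of at least [2 ^ a], and [geo] is the sum of that geometric series. *)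
Lemma left_sum e b M : prime b -> ~~ (b %| e)%N ->
  pwsum e (fun l => Rpower (INR l) a) M <= geo * Rpower (INR M) a * psum (e * b) M.
Proof.
move=> pb be; have [q0 q1] := half_pow_lt1; have g0 := geo_gt0.
elim/ltn_ind: M => -[|M] IH; first by rewrite psum0 /pwsum big_geq //; lra.
have hlt : (M.+1 %/ b < M.+1)%N by rewrite ltn_Pdiv // prime_gt1.
set P := Rpower (INR M.+1) a; have P0 : 0 < P by exact: Rpower_pos.
have h1 : pwsum e (fun l => Rpower (INR l) a) (M.+1 %/ b) <= geo * (Rpower (/ 2) a * P) * psum (e * b) M.+1.
  apply: (Rle_trans _ _ _ (IH _ hlt)).
  case: (posnP (M.+1 %/ b)) => [->|m0].
    rewrite psum0 Rmult_0_r; apply: Rmult_le_pos; last exact: psum_ge0.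
    by apply: Rmult_le_pos; [lra | nra].
  apply: Rmult_le_compat; [| exact: psum_ge0 | | by apply: psum_mono; exact: leq_div].
    by apply: Rmult_le_pos; [lra | exact/Rlt_le/Rpower_pos].
  apply: Rmult_le_compat_l; first lra.
  rewrite /P Rpower_mult_distr; [|lra|exact: INR_pos].
  apply: Rpower_mono; [exact: INR_pos | | lra].
  apply: (Rle_trans _ _ _ (divn_INR _ (prime_gt0 pb))).
  rewrite /Rdiv Rmult_comm; apply: Rmult_le_compat_r; first exact: pos_INR.
  by apply: Rinv_le_contravar; [lra | exact: INR_prime_ge2].
have h2 : pwsum e (fun l => Rpower (INR l) a) M.+1 - pwsum e (fun l => Rpower (INR l) a) (M.+1 %/ b)
    <= P * psum (e * b) M.+1.
  apply: (Rle_trans _ (P * (psum e M.+1 - psum e (M.+1 %/ b)))); last first.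
    by apply: Rmult_le_compat_l; [lra | exact: psum_block_le].
  have e1 : psum e M.+1 - psum e (M.+1 %/ b) = \sum_((M.+1 %/ b).+1 <= l < M.+2 | coprime l e) ipsi l.
    by rewrite /psum (@rsum_cat_nat (M.+1 %/ b).+1 1 M.+2) ?ltnS ?leq_div //; lra.
  have e2 : pwsum e (fun l => Rpower (INR l) a) M.+1 - pwsum e (fun l => Rpower (INR l) a) (M.+1 %/ b) =
     \sum_((M.+1 %/ b).+1 <= l < M.+2 | coprime l e) ipsi l * Rpower (INR l) a.
    by rewrite /pwsum (@rsum_cat_nat (M.+1 %/ b).+1 1 M.+2) ?ltnS ?leq_div //; lra.
  rewrite e1 e2 -rsum_mulr; apply: rsum_le_nat => l /andP[l1 l2] _.
  rewrite Rmult_comm; apply: Rmult_le_compat_r; first exact: ipsi_ge0.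
  apply: Rpower_mono; [apply: INR_pos; exact: leq_ltn_trans (leq0n _) l1 | exact: INR_le | lra].
have eg : geo * (Rpower (/ 2) a) + 1 = geo by rewrite /geo; field; lra.
have : (geo * (Rpower (/ 2) a) + 1) * P * psum (e * b) M.+1 = geo * P * psum (e * b) M.+1 by rewrite eg.
lra.
Qed.

Lemma floor_range c k L : 2 <= c * INR (2 ^ k)%N -> exp (c * INR (2 ^ k)%N) <= L ->
  1 <= L /\ c / 2 * INR (2 ^ k)%N <= ln (INR (nfloor L)).
Proof.
set y := c * _ => y2 hL.
have h1 : 3 <= exp y by have := exp_ineq1_le y; lra.
have [f1 f2] := @nfloor_spec L ltac:(lra).
split; first lra.
have h2 : exp y / 2 <= INR (nfloor L) by lra.
have := @ln_le (exp y / 2) _ ltac:(lra) h2.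
rewrite /Rdiv ln_mult; [|exact: exp_pos|lra].
rewrite ln_exp ln_Rinv; last lra.
have := ln2_lt1; rewrite /y in y2 *; lra.
Qed.

(** For [b = 2] this upper bound has the same order as [hsum_low]. The prime [b] bounds the mass of
    each block by [psum (e * b)], and the second free prime [g] controls the growth of
    [psum (e * b)] itself. *)
Lemma hsum_up c : 0 < c -> exists C k0, 0 < C /\ forall k e b g N L, (k0 <= k)%N ->
  avoid k e -> prime b -> (b <= 5)%N -> ~~ (b %| e)%N ->
  prime g -> (g <= 5)%N -> ~~ (g %| e)%N -> g != b ->
  (N < 2 ^ 2 ^ k.-1)%N -> exp (c * INR (2 ^ k)%N) <= L -> L <= INR N ->
  hsum N e L <= C * psum (e * b) (nfloor L).
Proof.
move=> c0; have [CG [k1 [CG0 [k112 gr]]]] := @growth (c / 2) ltac:(lra).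
have [k2 [k20 hk2]] := t_large (2 / c).
exists (geo + 8), (maxn k1 k2); split; first by have := geo_gt0; lra.
move=> k e b g N L kk ae pb b5 be pg g5 ge gb hN hL LN.
move: kk; rewrite geq_max => /andP[kk1 kk2].
have c2 : 2 <= c * INR (2 ^ k)%N.
  have h1 := hk2 k kk2; have := Rmult_le_compat_l c _ _ ltac:(lra) h1.
  by rewrite (_ : c * (2 / c) = 2); [lra | field; lra].
have [L1 lM] := floor_range c2 hL.
have [f1 f2] := @nfloor_spec L ltac:(lra); set M := nfloor L in f1 f2 lM *.
have k0 : (0 < k)%N := leq_trans k20 kk2.
have M0 : (0 < M)%N by apply: ln_ge_pos lM; lra.
have Mr := INR_ge1 M0.
have MN : (M <= N)%N by apply: leq_of_INR; lra.
set Hm := psum (e * b) M; have Hm0 : 0 <= Hm by exact: psum_ge0.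
have aeb : avoid k (e * b).
  apply: avoid_mul => //; rewrite prime_gt0 //=; apply: (leq_trans b5).
  by apply: (@leq_trans (2 ^ 3)) => //; rewrite leq_exp2l // (leq_trans _ (leq_trans k112 kk1)).
have geb : ~~ (g %| e * b)%N by rewrite Euclid_dvdM // negb_or ge dvdn_prime2.
have w0 l : (0 < l)%N -> 0 <= ipsi l * hat (INR l / L).
  move=> l0; apply: Rmult_le_pos; first exact: ipsi_ge0.
  by apply/Rlt_le/hat_gt0/Rdiv_lt_0_compat; [exact: INR_pos | lra].
(* On the [i]-th doubling the weight is at most [2 * 2 ^ (- i)] and the mass at most
   [(4 / 3) ^ (i + 1) * Hm]. The product is [8 / 3 * (2 / 3) ^ i * Hm], with total at most
   [8 * Hm]. *)
have right i : (M * 2 ^ i < 2 ^ 2 ^ k)%N ->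
  \sum_(M.+1 <= l < (M * 2 ^ i).+1 | coprime l e) ipsi l * hat (INR l / L) <= 8 * (1 - (2 / 3) ^ i) * Hm.
  elim: i => [|i IH] hi; first by rewrite expn0 muln1 big_geq //=; lra.
  have hi' : (M * 2 ^ i < 2 ^ 2 ^ k)%N.
    by apply: leq_ltn_trans hi; rewrite leq_mul2l leq_exp2l // leqnSn orbT.
  have mi : (M <= M * 2 ^ i)%N by rewrite leq_pmulr // expn_gt0.
  have mi2 : (M * 2 ^ i <= M * 2 ^ i.+1)%N by rewrite leq_mul2l leq_exp2l // leqnSn orbT.
  rewrite (@rsum_cat_nat (M * 2 ^ i).+1) //.
  have [hd hg] := gr k (e * b)%N g M i.+1 kk1 aeb pg g5 geb lM hi.
  set m := (M * 2 ^ i.+1)%N in hi hg mi2 *.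
  have hq : (3 / 4) ^ i.+1 * psum (e * b) m <= Hm.
    apply: Rle_trans hg; apply: Rmult_le_compat_r; first exact: psum_ge0.
    by apply: pow_incr; lra.
  have em : (m %/ 2 = M * 2 ^ i)%N by rewrite /m expnSr mulnA mulnK.
  have mass : psum e m - psum e (M * 2 ^ i) <= psum (e * b) m.
    apply: Rle_trans (psum_block_le m pb be).
    have : psum e (m %/ b) <= psum e (M * 2 ^ i) by rewrite -em; apply: psum_mono; apply: leq_div2l => //; exact: prime_gt1.
    lra.
  have e1 : psum e m - psum e (M * 2 ^ i) = \sum_((M * 2 ^ i).+1 <= l < m.+1 | coprime l e) ipsi l.
    by rewrite /psum (@rsum_cat_nat (M * 2 ^ i).+1 1 m.+1) //; lra.
  have t0 := exp2_gt0 i.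
  have blk : \sum_((M * 2 ^ i).+1 <= l < m.+1 | coprime l e) ipsi l * hat (INR l / L) <=
      2 * / INR (2 ^ i)%N * psum (e * b) m.
    apply: (Rle_trans _ (2 * / INR (2 ^ i)%N * (psum e m - psum e (M * 2 ^ i)))); last first.
      apply: Rmult_le_compat_l => //; have := Rinv_0_lt_compat _ t0; lra.
    rewrite e1 -rsum_mulr; apply: rsum_le_nat => l /andP[l1 l2] _.
    rewrite Rmult_comm; apply: Rmult_le_compat_r; first exact: ipsi_ge0.
    apply: (Rle_trans _ _ _ (hat_le_inv _)).
    have l1' : INR M * INR (2 ^ i)%N <= INR l by rewrite -mult_INR; apply: INR_le; exact: ltnW.
    have l0 : 0 < INR l by nra.
    have -> : / (INR l / L) = L * / INR l by field; lra.
    apply: (Rle_trans _ ((2 * INR M) * / (INR M * INR (2 ^ i)%N))); last by apply: Req_le; field; lra.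
    apply: Rmult_le_compat; [lra | by left; apply: Rinv_0_lt_compat | lra |].
    by apply: Rinv_le_contravar => //; nra.
  have := IH hi'.
  have e34 : 2 * / INR (2 ^ i)%N * psum (e * b) m = 8 / 3 * (2 / 3) ^ i * ((3 / 4) ^ i.+1 * psum (e * b) m).
    have -> : / INR (2 ^ i)%N = (2 / 3) ^ i * (3 / 4) ^ i.
      rewrite -Rpow_mult_distr INR_exp -pow_inv; congr (_ ^ _); rewrite /=; field.
    by rewrite /=; field.
  have q23 : 0 <= (2 / 3) ^ i by apply: pow_le; lra.
  rewrite e34 in blk.
  have : 8 / 3 * (2 / 3) ^ i * ((3 / 4) ^ i.+1 * psum (e * b) m) <= 8 / 3 * (2 / 3) ^ i * Hm.
    by apply: Rmult_le_compat_l => //; lra.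
  rewrite [(2 / 3) ^ i.+1]/=; lra.
have e2k : (2 ^ 2 ^ k = 2 ^ 2 ^ k.-1 * 2 ^ 2 ^ k.-1)%N by rewrite -expnD addnn -mul2n -expnS prednK.
have hi : (M * 2 ^ (2 ^ k.-1) < 2 ^ 2 ^ k)%N.
  by rewrite e2k ltn_mul2r expn_gt0 /=; apply: leq_ltn_trans hN.
have hr := right _ hi.
have NM : (N <= M * 2 ^ (2 ^ k.-1))%N.
  by apply: (leq_trans (ltnW hN)); rewrite leq_pmull.
rewrite /hsum /pwsum (@rsum_cat_nat M.+1) //.
have left : \sum_(1 <= l < M.+1 | coprime l e) ipsi l * hat (INR l / L) <= geo * Hm.
  apply: (Rle_trans _ (Rpower (/ L) a * pwsum e (fun l => Rpower (INR l) a) M)).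
    rewrite /pwsum -rsum_mulr; apply: rsum_le_nat => l /andP[l0 _] _.
    have := hat_le_pow (INR l / L); rewrite /Rdiv -Rpower_mult_distr; [|exact: INR_pos|by apply: Rinv_0_lt_compat; lra].
    have := ipsi_ge0 l; nra.
  have h1 := left_sum M pb be.
  have q0 := Rpower_pos (/ L) a.
  apply: (Rle_trans _ _ _ (Rmult_le_compat_l _ _ _ (Rlt_le _ _ q0) h1)).
  have : Rpower (/ L) a * Rpower (INR M) a <= 1.
    rewrite Rpower_mult_distr; [|by apply: Rinv_0_lt_compat; lra|lra].
    have -> : 1 = Rpower 1 a by rewrite /Rpower ln_1 Rmult_0_r exp_0.
    apply: Rpower_mono; [|by apply: (Rmult_le_reg_l L); [lra | rewrite -Rmult_assoc Rinv_r; lra] | lra].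
    by apply: Rmult_lt_0_compat; [apply: Rinv_0_lt_compat; lra | lra].
  have : 0 <= geo * Hm by apply: Rmult_le_pos => //; exact/Rlt_le/geo_gt0.
  rewrite -/Hm; nra.
have rt' : \sum_(M.+1 <= l < N.+1 | coprime l e) ipsi l * hat (INR l / L) <= 8 * Hm.
  apply: (Rle_trans _ (\sum_(M.+1 <= l < (M * 2 ^ 2 ^ k.-1).+1 | coprime l e) ipsi l * hat (INR l / L))).
    have h1 : (N.+1 <= (M * 2 ^ 2 ^ k.-1).+1)%N by [].
    rewrite (big_nat_widen _ _ _ _ _ h1); apply: rsum_le_pred => l; first by move=> _ /andP[].
    by rewrite mem_index_iota => /andP[l0 _] _; apply: w0; exact: leq_ltn_trans (leq0n _) l0.
  apply: (Rle_trans _ _ _ hr).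
  have : 0 <= (2 / 3) ^ 2 ^ k.-1 by apply: pow_le; lra.
  nra.
lra.
Qed.
End Weight.

(** * Dilation by integers *)

Lemma one_sub_exp x : 0 <= x <= / 2 -> exp (- (2 * x)) <= 1 - x.
Proof.
move=> hx; rewrite exp_Ropp.
have h1 := exp_ineq1_le (2 * x).
apply: (Rle_trans _ (/ (1 + 2 * x))); first by apply: Rinv_le_contravar; lra.
apply: (Rmult_le_reg_r (1 + 2 * x)); first lra.
rewrite Rinv_l; nra.
Qed.

Lemma exp_pow x n : exp x ^ n = exp (INR n * x).
Proof.
elim: n => [|n IH]; first by rewrite /= Rmult_0_l exp_0.
by rewrite S_INR /= IH -exp_plus; congr exp; lra.
Qed.

Lemma t_le_exp A e : 0 < e -> exists k0, (0 < k0)%N /\ forall k, (k0 <= k)%N ->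
  A * INR (2 ^ k)%N <= exp (e * INR (2 ^ k)%N).
Proof.
move=> e0; have [k0 [k00 hk]] := t_large (4 * A / e ^ 2).
exists k0; split => // k kk; have := hk k kk; have := exp2_gt0 k; set t := INR _ => t0 h1.
have -> : exp (e * t) = exp (e * t / 2) ^ 2 by rewrite exp_pow /=; congr exp; lra.
apply: (Rle_trans _ ((e * t / 2) ^ 2)); last first.
  by apply: pow_incr; have := exp_ineq1_le (e * t / 2); nra.
have e2 : 0 < e ^ 2 by apply: pow_lt.
have := Rmult_le_compat_l _ _ _ (Rlt_le _ _ e2) h1.
have -> : e ^ 2 * (4 * A / e ^ 2) = 4 * A by field; lra.
move=> h2; have := Rmult_le_compat_r t _ _ ltac:(lra) h2; nra.
Qed.

Lemma exp2_split k : (0 < k)%N -> (2 ^ 2 ^ k = 2 ^ 2 ^ k.-1 * 2 ^ 2 ^ k.-1)%N.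
Proof. by move=> k0; rewrite -expnD addnn -mul2n -expnS prednK. Qed.

(** At most [2 ^ (k - 1)] doublings lead from [M] beyond [N], each at a rate of order [delta k],
    which tends to 0. *)
Lemma psum_top c eps : 0 < c -> 0 < eps -> exists k0, (0 < k0)%N /\ forall k d g M N,
  (k0 <= k)%N -> avoid k d -> prime g -> (g <= 5)%N -> ~~ (g %| d)%N ->
  c * INR (2 ^ k)%N <= ln (INR M) -> (M < 2 ^ 2 ^ k.-1)%N -> (N < 2 ^ 2 ^ k.-1)%N ->
  psum d N <= exp (eps * INR (2 ^ k)%N) * psum d M.
Proof.
move=> c0 e0; have [CG [k1 [CG0 [k112 gr]]]] := growth c0.
have [k2 [k20 hk2]] := k_le_rt (CG / eps).
exists (maxn k1 k2); split; first by rewrite leq_max k20 orbT.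
move=> k d g M N; rewrite geq_max => /andP[kk1 kk2] ad pg g5 gd hM M2 N2.
have k0 : (0 < k)%N := leq_trans k20 kk2.
set i := (2 ^ k.-1)%N.
have hi : (M * 2 ^ i < 2 ^ 2 ^ k)%N by rewrite exp2_split // ltn_mul2r expn_gt0.
have [hd hg] := gr k d g M i kk1 ad pg g5 gd hM hi.
have M0 : (0 < M)%N by apply: ln_ge_pos hM; apply: Rmult_lt_0_compat => //; exact: exp2_gt0.
have NM : (N <= M * 2 ^ i)%N by apply: (leq_trans (ltnW N2)); rewrite leq_pmull.
have x0 : 0 < CG * delta k by apply: Rmult_lt_0_compat => //; exact: delta_gt0.
have h1 := @one_sub_exp (CG * delta k) ltac:(lra).
have h2 : exp (- (2 * (CG * delta k))) ^ i * psum d N <= psum d M.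
  apply: Rle_trans hg; apply: Rmult_le_compat; [|exact: psum_ge0| |exact: psum_mono].
    exact/pow_le/Rlt_le/exp_pos.
  by apply: pow_incr; split => //; exact/Rlt_le/exp_pos.
rewrite exp_pow in h2.
have et : INR (2 ^ k)%N = 2 * INR i by rewrite /i -{1}(prednK k0) expnS mult_INR /=; lra.
have kr := INR_ge1 k0.
have r0 := rt_gt0 k0.
have dle : CG * delta k <= eps.
  have h3 := hk2 k kk2.
  apply: (Rmult_le_reg_r (rt k)) => //.
  have -> : CG * delta k * rt k = CG by rewrite /delta; field; lra.
  have : CG / eps <= rt k by apply: Rle_trans h3; have : 0 < CG / eps by [apply: Rdiv_lt_0_compat]; nra.
  move=> h4; have := Rmult_le_compat_l eps _ _ ltac:(lra) h4.
  by rewrite (_ : eps * (CG / eps) = CG) //; field; lra.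
set X := INR i * - (2 * (CG * delta k)) in h2.
have h3 : psum d N <= exp (- X) * psum d M.
  have := Rmult_le_compat_l _ _ _ (Rlt_le _ _ (exp_pos (- X))) h2.
  by rewrite -Rmult_assoc -exp_plus Rplus_opp_l exp_0 Rmult_1_l.
apply: (Rle_trans _ _ _ h3); apply: Rmult_le_compat_r; first exact: psum_ge0.
apply: exp_le; rewrite /X et; have := pos_INR i; nra.
Qed.

Lemma nfloor_mono x y : 0 <= x -> x <= y -> (nfloor x <= nfloor y)%N.
Proof.
move=> x0 xy; have [h1 h2] := nfloor_spec x0; have [h3 h4] := @nfloor_spec y ltac:(lra).
by rewrite -ltnS; apply/ltP; apply: RIneq.INR_lt; rewrite S_INR; lra.
Qed.

Section Shift.
Variable a : R.
Hypothesis a0 : 0 < a.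
Local Notation hsum := (hsum a).

(** In [pwsum_split] the multiples [p * m] have weight [hat (m / L)], which reproduces the sum at
    [L] except that [m] stops at [N / p]. The missing tail is bounded through [hat u <= 1 / u] and
    gives the last term. *)
Lemma hsum_shift_raw N d p L : prime p -> ~~ (p %| d)%N -> 0 < L -> (0 < N)%N ->
  Rabs (hsum N d (INR p * L) - hsum N d L - (hsum N (d * p) (INR p * L) - hsum N (d * p) L)) <=
  hsum N (d * p) L / (INR p + 1) + INR p * L / INR N * psum d N.
Proof.
move=> pp pd L0 N0; have p2 := INR_prime_ge2 pp; have Np := INR_pos N0.
set f := fun l => hat a (INR l / L).
have e1 e : pwsum e (fun m => hat a (INR (p * m) / (INR p * L))) (N %/ p) = pwsum e f (N %/ p).
  rewrite /pwsum; apply: eq_bigr => m _; congr (_ * hat _ _); rewrite mult_INR; field; lra.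
have hs := pwsum_split (fun l => hat a (INR l / (INR p * L))) N pp pd.
rewrite !e1 -/(hsum N d (INR p * L)) -/(hsum N (d * p) (INR p * L)) in hs.
set tl := fun e => \sum_((N %/ p).+1 <= l < N.+1 | coprime l e) ipsi l * f l.
have e2 e : pwsum e f (N %/ p) = hsum N e L - tl e.
  by rewrite /hsum /pwsum /tl (@rsum_cat_nat (N %/ p).+1 1 N.+1) ?ltnS ?leq_div // /f; lra.
have f0 l : (0 < l)%N -> 0 <= ipsi l * f l.
  move=> l0; apply: Rmult_le_pos; first exact: ipsi_ge0.
  by apply/Rlt_le/hat_gt0/Rdiv_lt_0_compat => //; exact: INR_pos.
have t0 e : 0 <= tl e.
  rewrite /tl big_nat_cond; apply: rsum_ge0 => l /andP[/andP[l0 _] _].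
  by apply: f0; exact: leq_ltn_trans (leq0n _) l0.
have t1 : tl (d * p)%N <= tl d.
  apply: rsum_le_pred => l; rewrite mem_index_iota => /andP[l0 _].
    by apply: coprime_dvdr; exact: dvdn_mulr.
  by move=> _; apply: f0; exact: leq_ltn_trans (leq0n _) l0.
have t2 : tl d <= INR p * L / INR N * psum d N.
  apply: (Rle_trans _ (\sum_((N %/ p).+1 <= l < N.+1 | coprime l d) (INR p * L / INR N * ipsi l))).
    apply: rsum_le_nat => l /andP[l1 _] _; rewrite Rmult_comm.
    apply: Rmult_le_compat_r; first exact: ipsi_ge0.
    apply: (Rle_trans _ _ _ (hat_le_inv _ _)).
    have l0 : 0 < INR l by apply: INR_pos; exact: leq_ltn_trans (leq0n _) l1.
    have hl : INR N <= INR l * INR p.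
      by rewrite -mult_INR; apply: INR_le; apply: ltnW; rewrite -ltn_divLR // prime_gt0.
    have -> : / (INR l / L) = L * / INR l by field; lra.
    have -> : INR p * L / INR N = L * (INR p / INR N) by field; lra.
    apply: Rmult_le_compat_l; first lra.
    apply: (Rmult_le_reg_r (INR l * INR N)); first nra.
    have -> : / INR l * (INR l * INR N) = INR N by field; lra.
    have -> : INR p / INR N * (INR l * INR N) = INR l * INR p by field; lra.
    lra.
  rewrite rsum_mulr; apply: Rmult_le_compat_l.
    by apply: Rmult_le_pos; [nra | left; exact: Rinv_0_lt_compat].
  by apply: rsum_sub_range => // l _; exact: ipsi_ge0.
rewrite !e2 inv_p1 // in hs.
have [i0 i1] := inv_p1_pos pp.
have v0 := hsum_ge0 a N (d * p) L0.
have -> : hsum N d (INR p * L) - hsum N d L - (hsum N (d * p) (INR p * L) - hsum N (d * p) L) =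
   hsum N (d * p) L * / (INR p + 1) - tl d + (1 - / (INR p + 1)) * tl (d * p)%N by lra.
have := t0 d; have := t0 (d * p)%N => td tdp.
apply: Rabs_le; rewrite /Rdiv; nra.
Qed.

(* 2, 3 and 5 are kept out of [d] because they serve as the auxiliary primes of
   [local_decay] and [growth]. *)
Definition coprime30 (d : nat) := [/\ ~~ (2 %| d)%N, ~~ (3 %| d)%N & ~~ (5 %| d)%N].

Lemma small_primes p : prime p -> (p <= 5)%N -> [\/ p = 2%N, p = 3%N | p = 5%N].
Proof.
by case: p => [|[|[|[|[|[|p]]]]]] // _ _; [apply: Or31 | apply: Or32 | apply: Or33].
Qed.

(** The bounds refer to one scale [Ls] above all the [L] in use. The route is [hsum_up] at [L],
    monotonicity of [psum] from [L] to [Ls], then [hsum_low] at [Ls]. *)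
Lemma hsum_ratio c : 0 < c -> exists C k0, 0 < C /\ (12 <= k0)%N /\ forall k N Ls, (k0 <= k)%N ->
  (N < 2 ^ 2 ^ k.-1)%N -> Ls <= INR N ->
  forall d L, coprime30 d -> avoid k d -> exp (c * INR (2 ^ k)%N) <= L -> L <= Ls ->
  hsum N d L <= C * hsum N d Ls /\
  (Rpower (/ 2) a / 3 * psum (d * 2) (nfloor Ls) <= hsum N d Ls) /\
  forall p, prime p -> ~~ (p %| d)%N -> (p <= 2 ^ k)%N ->
  hsum N (d * p) L <= C * delta k * (INR p * ln (INR p)) * hsum N d Ls.
Proof.
move=> c0; have [CU [k1 [CU0 hU]]] := hsum_up a0 c0.
have [CB [CB0 hCB]] := local_decay.
have [CR [k2 [CR0 hR]]] := @psum_ratio (c / 4) ltac:(lra).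
have [k3 [k30 hk3]] := t_large (12 / c).
set cl := Rpower (/ 2) a / 3.
have cl0 : 0 < cl by apply: Rdiv_lt_0_compat; [exact: Rpower_pos | lra].
set C2 := CU / cl * (1 + CB / (c / 2) + CR).
have CBc : 0 < CB / (c / 2) by apply: Rdiv_lt_0_compat; lra.
have CUc : 0 < CU / cl by apply: Rdiv_lt_0_compat.
exists C2, (maxn 12 (maxn k1 (maxn k2 k3))); split; first by apply: Rmult_lt_0_compat; lra.
split; first by rewrite leq_max.
move=> k N Ls; rewrite !geq_max => /and4P[k12 kk1 kk2 kk3] hN LsN d L [d2 d3 d5] ad hL LLs.
have k0 : (0 < k)%N by apply: leq_trans k12.
have c12 : 12 <= c * INR (2 ^ k)%N.
  have h1 := hk3 k kk3; have := Rmult_le_compat_l c _ _ ltac:(lra) h1.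
  by rewrite (_ : c * (12 / c) = 12); [lra | field; lra].
set t := INR (2 ^ k)%N in c12 hL.
have [L1 lM] := @floor_range c k L ltac:(rewrite -/t; lra) hL.
have [Ls1 lMs] := @floor_range c k Ls ltac:(rewrite -/t; lra) ltac:(rewrite -/t; lra).
have fm : (nfloor L <= nfloor Ls)%N by apply: nfloor_mono; lra.
set Ms := nfloor Ls in fm lMs *.
have MsN : (Ms <= N)%N by apply: leq_of_INR; have := @nfloor_spec Ls ltac:(lra); rewrite -/Ms; lra.
have Ms2 : (Ms < 2 ^ 2 ^ k.-1)%N by apply: leq_ltn_trans hN.
have Ms3 : (Ms < 2 ^ 2 ^ k)%N by apply: (leq_trans Ms2); rewrite leq_exp2l // leq_exp2l // leq_pred.
have low : cl * psum (d * 2) Ms <= hsum N d Ls by apply: hsum_low => //; lra.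
have d0 := delta_gt0 k0.
have hv0 : 0 <= hsum N d Ls by apply: hsum_ge0 => //; lra.
have h2low : psum (d * 2) Ms <= / cl * hsum N d Ls.
  apply: (Rmult_le_reg_l cl) => //; rewrite -Rmult_assoc Rinv_r; lra.
have LN : L <= INR N by lra.
have up e b g : avoid k e -> prime b -> (b <= 5)%N -> ~~ (b %| e)%N ->
  prime g -> (g <= 5)%N -> ~~ (g %| e)%N -> g != b -> hsum N e L <= CU * psum (e * b) Ms.
  move=> ae pb b5 be pg g5 ge gb.
  apply: (Rle_trans _ _ _ (hU k e b g N L kk1 ae pb b5 be pg g5 ge gb hN hL LN)).
  by apply: Rmult_le_compat_l; [lra | exact: psum_mono].
split.
  have h1 := up d 2%N 3%N ad isT isT d2 isT isT d3 isT.
  apply: (Rle_trans _ _ _ h1).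
  apply: (Rle_trans _ (CU * (/ cl * hsum N d Ls))); first by apply: Rmult_le_compat_l; lra.
  have -> : CU * (/ cl * hsum N d Ls) = CU / cl * 1 * hsum N d Ls by field; lra.
  apply: Rmult_le_compat_r => //; rewrite /C2; apply: Rmult_le_compat_l; lra.
split => // p pp pd pk.
have adp : avoid k (d * p) by apply: avoid_mul => //; rewrite prime_gt0.
have avd2 : avoid k (d * 2) by apply: avoid_mul => //; exact: (@leq_pexp2l 2 1 k isT k0).
have l0 := ln_prime_gt0 pp; have p2 := INR_prime_ge2 pp.
have pl : 1 <= INR p * ln (INR p).
  have := @ln_le 2 _ ltac:(lra) p2; have := ln2_gt; nra.
suff key : exists X, hsum N (d * p) L <= CU * X /\
    X <= (CB / (c / 2) + CR) * delta k * (INR p * ln (INR p)) * psum (d * 2) Ms.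
  have [X [hX1 hX2]] := key.
  apply: (Rle_trans _ _ _ hX1).
  set irad_sum := delta k * (INR p * ln (INR p)).
  have G0 : 0 <= irad_sum by apply: Rmult_le_pos; lra.
  apply: (Rle_trans _ (CU * ((CB / (c / 2) + CR) * irad_sum * (/ cl * hsum N d Ls)))).
    apply: Rmult_le_compat_l; first lra.
    apply: (Rle_trans _ _ _ hX2).
    have -> : (CB / (c / 2) + CR) * delta k * (INR p * ln (INR p)) * psum (d * 2) Ms =
      (CB / (c / 2) + CR) * irad_sum * psum (d * 2) Ms by rewrite /irad_sum; lra.
    by apply: Rmult_le_compat_l => //; apply: Rmult_le_pos; lra.
  have -> : CU * ((CB / (c / 2) + CR) * irad_sum * (/ cl * hsum N d Ls)) = CU / cl * (CB / (c / 2) + CR) * (irad_sum * hsum N d Ls).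
    by field; lra.
  have -> : C2 * delta k * (INR p * ln (INR p)) * hsum N d Ls = C2 * (irad_sum * hsum N d Ls) by rewrite /irad_sum; lra.
  apply: Rmult_le_compat_r; first exact: Rmult_le_pos.
  by rewrite /C2; apply: Rmult_le_compat_l; lra.
have loc b : prime b -> (b <= 5)%N -> ~~ (b %| d * 2)%N ->
    psum (d * 2 * b) Ms <= (CB / (c / 2) + CR) * delta k * (INR p * ln (INR p)) * psum (d * 2) Ms.
  move=> pb b5 bd.
  have h1 := hCB (c / 2) k (d * 2)%N b Ms ltac:(lra) k12 avd2 pb b5 bd Ms3 ltac:(rewrite -/t; lra) lMs.
  apply: (Rle_trans _ _ _ h1); apply: Rmult_le_compat_r; first exact: psum_ge0.
  have h2 : 0 < (CB / (c / 2)) * delta k by apply: Rmult_lt_0_compat.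
  have h3 : 0 < CR * delta k by apply: Rmult_lt_0_compat.
  nra.
have d23 : ~~ (3 %| d * 2)%N by rewrite Euclid_dvdM // negb_or d3.
have d25 : ~~ (5 %| d * 2)%N by rewrite Euclid_dvdM // negb_or d5.
(* For [p <= 5] the free primes are permuted so that [hsum N (d * p) L] is bounded by
   [psum (d * 2 * b)] with [b] equal to 3 or 5, where [local_decay] applies. For [p > 5] the prime 2
   is used for [b], and [psum_ratio] applies with 3 still free. *)
case: (leqP p 5) => p5.
  case: (small_primes pp p5) => ep; subst p.
  - exists (psum (d * 2 * 3) Ms); split; last exact: loc.
    by apply: (up _ 3%N 5%N).
  - exists (psum (d * 2 * 3) Ms); split; last exact: loc.
    rewrite mulnAC; apply: (up _ 2%N 5%N) => //; rewrite Euclid_dvdM // negb_or ?d2 ?d5 //.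
  - exists (psum (d * 2 * 5) Ms); split; last exact: loc.
    rewrite mulnAC; apply: (up _ 2%N 3%N) => //; rewrite Euclid_dvdM // negb_or ?d2 ?d3 //.
exists (psum (d * 2 * p) Ms); split.
  rewrite mulnAC; apply: (up _ 2%N 3%N) => //.
    by rewrite Euclid_dvdM // negb_or d2 dvdn_prime2 // eq_sym gtn_eqF // (leq_trans _ p5).
  by rewrite Euclid_dvdM // negb_or d3 dvdn_prime2 // eq_sym gtn_eqF // (leq_trans _ p5).
have pd2 : ~~ (p %| d * 2)%N by rewrite Euclid_dvdM // negb_or pd dvdn_prime2 // gtn_eqF // (leq_trans _ p5).
have p3 : p != 3%N by rewrite gtn_eqF // (leq_trans _ p5).
have h1 := hR k (d * 2)%N p Ms kk2 avd2 d23 pp p3 pd2 pk ltac:(move: lMs; rewrite -/t; lra) Ms2.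
apply: (Rle_trans _ _ _ h1); apply: Rmult_le_compat_r; first exact: psum_ge0.
have h2 : 0 < (CB / (c / 2)) * delta k by apply: Rmult_lt_0_compat.
nra.
Qed.
End Shift.

Lemma rt_le_t1 k : rt k <= INR (2 ^ k)%N.
Proof.
have t0 := exp2_gt0 k; have kt : INR k <= INR (2 ^ k)%N by apply/INR_le/ltnW/ltn_expl.
have k0 := pos_INR k.
apply: Rsqr_incr_0_var; last lra.
by rewrite /Rsqr rt_sq; apply: Rmult_le_compat_r; lra.
Qed.

Lemma small_n_bounds c1 k n : 0 < c1 <= 1 -> (0 < k)%N -> (0 < n)%N -> INR n <= c1 * rt k / INR k ->
  (n <= 2 ^ k)%N /\ ln (INR n) <= INR k /\ delta k * (INR n * ln (INR n)) <= c1.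
Proof.
move=> hc k0 n0 hn; have kr := INR_ge1 k0; have r0 := rt_gt0 k0; have rt1 := rt_le_t1 k.
have ik : / INR k <= 1 by rewrite -Rinv_1; apply: Rinv_le_contravar; lra.
have ik0 : 0 < / INR k by apply: Rinv_0_lt_compat; lra.
have n1 : INR n <= rt k.
  apply: (Rle_trans _ _ _ hn); rewrite /Rdiv.
  have : c1 * rt k <= rt k by nra.
  have : 0 < c1 * rt k by nra.
  nra.
have nk : INR n <= INR (2 ^ k)%N by lra.
have lk : ln (INR n) <= INR k.
  have := ln_le (INR_pos n0) nk; rewrite ln_pow2; have := ln2_lt1; nra.
split; first exact: leq_of_INR.
split => //.
have l0 := ln_INR_ge0 n.
have h1 : INR n * ln (INR n) <= c1 * rt k / INR k * INR k.
  by apply: Rmult_le_compat => //; exact: pos_INR.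
have e : c1 * rt k / INR k * INR k = c1 * rt k by field; lra.
rewrite e in h1.
have d0 := delta_gt0 k0.
have := Rmult_le_compat_l _ _ _ (Rlt_le _ _ d0) h1.
have -> : delta k * (c1 * rt k) = c1 by rewrite /delta; field; lra.
lra.
Qed.

Lemma Rabs_def2_le x y : Rabs x <= y -> - y <= x <= y.
Proof. by move=> h1; have := Rle_abs x; have := Rle_abs (- x); rewrite Rabs_Ropp; lra. Qed.

Section Shift2.
Variable a : R.
Hypothesis a0 : 0 < a.
Local Notation hsum := (hsum a).

(** The cut [N] exceeds [Ls] by a factor [exp (e0 * 2 ^ k)]. A quarter of this exponent pays for
    each of the growth of [psum d] up to [N], the factor [2 ^ k / cl] between [psum d] and [hsum],
    and [1 / delta k <= 2 ^ k]. *)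
Lemma tail_small c e0 : 0 < c -> 0 < e0 -> exists k0, (12 <= k0)%N /\ forall k N Ls d x, (k0 <= k)%N ->
  (N < 2 ^ 2 ^ k.-1)%N -> Ls <= INR N * exp (- (e0 * INR (2 ^ k)%N)) ->
  coprime30 d -> avoid k d -> exp (c * INR (2 ^ k)%N) <= Ls -> 0 < x -> x <= Ls ->
  Rpower (/ 2) a / 3 * psum (d * 2) (nfloor Ls) <= hsum N d Ls ->
  x / INR N * psum d N <= delta k * hsum N d Ls.
Proof.
move=> c0 e00.
have [k1 [k10 hk1]] := @psum_top (c / 2) (e0 / 4) ltac:(lra) ltac:(lra).
set cl := Rpower (/ 2) a / 3.
have cl0 : 0 < cl by apply: Rdiv_lt_0_compat; [exact: Rpower_pos | lra].
have [k2 [k20 hk2]] := @t_le_exp (/ cl) (e0 / 4) ltac:(lra).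
have [k3 [k30 hk3]] := @t_le_exp 1 (e0 / 4) ltac:(lra).
have [k4 [k40 hk4]] := t_large (2 / c).
exists (maxn 12 (maxn k1 (maxn k2 (maxn k3 k4)))); split; first by rewrite leq_max.
move=> k N Ls d x; rewrite !geq_max => /and5P[k12 kk1 kk2 kk3 kk4] hN LsN [d2 d3 d5] ad hL x0 xL low.
have {}hk2 := hk2 k kk2. have {}hk3 := hk3 k kk3. have {}hk4 := hk4 k kk4.
have k0 : (0 < k)%N by apply: leq_trans k12.
set t := INR (2 ^ k)%N in LsN hL hk2 hk3 hk4 *.
have t0 : 0 < t := exp2_gt0 k.
have c2 : 2 <= c * t.
  have := Rmult_le_compat_l c _ _ ltac:(lra) hk4.
  by rewrite (_ : c * (2 / c) = 2); [lra | field; lra].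
have [Ls1 lMs] := @floor_range c k Ls c2 hL; rewrite -/t in lMs.
set Ms := nfloor Ls in lMs low *.
have ee : exp (- (e0 * t)) <= 1 by rewrite -exp_0; apply: exp_le; nra.
have N0 : 0 < INR N.
  case: (posnP N) => [e|/INR_pos //]; exfalso; move: LsN; rewrite e /= Rmult_0_l; lra.
have LsN' : Ls <= INR N by nra.
have MsN : (Ms <= N)%N by apply: leq_of_INR; have := @nfloor_spec Ls ltac:(lra); rewrite -/Ms; lra.
have Ms2 : (Ms < 2 ^ 2 ^ k.-1)%N by apply: leq_ltn_trans hN.
have Ms3 : (Ms < 2 ^ 2 ^ k)%N by apply: (leq_trans Ms2); rewrite leq_exp2l // leq_exp2l // leq_pred.
have h1 := hk1 k d 3%N Ms N kk1 ad isT isT d3 lMs Ms2 hN; rewrite -/t in h1.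
have h2 : psum d Ms <= t * psum (d * 2) Ms.
  apply: (Rle_trans _ _ _ (psum_le_T Ms (isT : prime 2) d2)).
  by apply: gsum_le_log => //; [exact: psum_mono | exact: psum0].
have hv0 : 0 <= hsum N d Ls by apply: hsum_ge0 => //; lra.
have h2low : psum (d * 2) Ms <= / cl * hsum N d Ls.
  apply: (Rmult_le_reg_l cl) => //; rewrite -Rmult_assoc Rinv_r; lra.
have xN : x / INR N <= exp (- (e0 * t)).
  apply: (Rmult_le_reg_r (INR N)) => //.
  have -> : x / INR N * INR N = x by field; lra.
  lra.
have xN0 : 0 <= x / INR N by apply: Rmult_le_pos; [lra | left; exact: Rinv_0_lt_compat].
have icl : 0 < / cl by exact: Rinv_0_lt_compat.
set q := exp (e0 / 4 * t) in h1 hk2 hk3.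
have q0 : 0 < q by exact: exp_pos.
have eq4 : exp (- (e0 * t)) * q ^ 3 * q = 1.
  have -> : exp (- (e0 * t)) * q ^ 3 * q = exp (- (e0 * t)) * q ^ 4 by rewrite /=; ring.
  by rewrite /q exp_pow -exp_plus -exp_0; congr exp; rewrite /=; field.
set z := exp (- (e0 * t)) in xN eq4; have z0 : 0 < z by exact: exp_pos.
set W := hsum N d Ls in hv0 h2low *.
have s1 : psum d N <= q * (t * (/ cl * W)).
  apply: (Rle_trans _ _ _ h1); apply: Rmult_le_compat_l; first lra.
  by apply: (Rle_trans _ _ _ h2); apply: Rmult_le_compat_l; lra.
have s2 : x / INR N * psum d N <= z * (q * (t * (/ cl * W))).
  by apply: Rmult_le_compat => //; [exact: psum_ge0].
apply: (Rle_trans _ _ _ s2).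
have -> : z * (q * (t * (/ cl * W))) = z * q * (/ cl * t) * W by ring.
apply: Rmult_le_compat_r => //.
have dt : / t <= delta k.
  by apply: Rinv_le_contravar; [exact: rt_gt0 | exact: rt_le_t1].
apply: Rle_trans dt.
have q1 : 1 <= q by rewrite /q -exp_0; apply: exp_le; nra.
apply: (Rle_trans _ (z * q * q)); first by apply: Rmult_le_compat_l => //; nra.
apply: (Rmult_le_reg_r t) => //; rewrite Rinv_l; last lra.
apply: (Rle_trans _ (z * q * q * q)); first by apply: Rmult_le_compat_l; [nra | lra].
rewrite -eq4.
have : 0 < z * q * q * q by do 3 apply: Rmult_lt_0_compat => //.
rewrite /=; nra.
Qed.

(* Induction on [n]: a prime [p > 5] moves into [d], where dilation by [p] is
   compared with dilation by [p - 1]; as the prime factors of [d] exceed [n], those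
   of [p - 1] are still available. *)
Lemma hsum_shift c e0 : 0 < c -> 0 < e0 -> exists C1 c1 k0, 0 < C1 /\ 0 < c1 <= 1 /\ (12 <= k0)%N /\
  forall k N Ls, (k0 <= k)%N -> (N < 2 ^ 2 ^ k.-1)%N -> Ls <= INR N * exp (- (e0 * INR (2 ^ k)%N)) ->
  forall n d L, (0 < n)%N -> INR n <= c1 * rt k / INR k -> coprime30 d -> avoid k d ->
  (forall q, prime q -> (q %| d)%N -> (n < q)%N) ->
  exp (c * INR (2 ^ k)%N) <= L -> INR n * L <= Ls ->
  Rabs (hsum N d (INR n * L) - hsum N d L) <= C1 * delta k * ln (INR n) * hsum N d Ls.
Proof.
move=> c0 e00.
have [C [k1 [C0 [k112 hR]]]] := hsum_ratio a0 c0.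
have [k2 [k212 hT]] := tail_small c0 e00.
set lp := lipc a; have lp0 : 0 < lp := lipc_gt0 a0.
(* [C1 / 2] collects the direct errors: two sums over multiples of a prime at most 5, the Lipschitz
   step, the term over [p + 1], and the tail. The other half is the induction hypothesis for
   [d * p], halved because [c1] is chosen so that [C * delta k * p * ln p <= 1 / 2]. *)
set C1 := 2 * (10 * C + 2 * lp * C + C + 2).
set c1 := Rmin 1 (/ (2 * C)).
have c10 : 0 < c1 by apply: Rmin_glb_lt; [lra | apply: Rinv_0_lt_compat; lra].
have c11 : c1 <= 1 by exact: Rmin_l.
have cC : C * c1 <= / 2.
  have h1 : c1 <= / (2 * C) by exact: Rmin_r.
  have := Rmult_le_compat_l C _ _ ltac:(lra) h1.
  by rewrite (_ : C * / (2 * C) = / 2) //; field; lra.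
have lpC : 0 < lp * C by apply: Rmult_lt_0_compat.
have C10 : 0 < C1 by rewrite /C1; lra.
exists C1, c1, (maxn k1 k2); split => //; split; first by split.
split; first by rewrite leq_max k112.
move=> k N Ls; rewrite geq_max => /andP[kk1 kk2] hN hLs.
have k0 : (0 < k)%N by apply: leq_trans (leq_trans k112 kk1).
set t := INR (2 ^ k)%N in hLs *; have t0 : 0 < t := exp2_gt0 k.
have d0 := delta_gt0 k0.
have ee : exp (- (e0 * t)) <= 1 by rewrite -exp_0; apply: exp_le; nra.
have hLsN : Ls <= INR N by have := pos_INR N; nra.
elim/ltn_ind => n IH d L n0 hn cd ad hd hL nL.
have L0 : 0 < L by have := exp_pos (c * t); lra.
have nr := INR_ge1 n0.
have LLs : L <= Ls by nra.
have Ls0 : 0 < Ls by lra.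
have Lst : exp (c * t) <= Ls by lra.
have N0 : (0 < N)%N by case: (N) hLsN => //=; lra.
have hE0 e : 0 <= hsum N e Ls by exact: hsum_ge0.
case: (eqVneq n 1%N) => [->|n1].
  by rewrite Rmult_1_l Rminus_diag Rabs_R0 ln_1; lra.
have ng1 : (1 < n)%N by rewrite ltn_neqAle eq_sym n1.
(* A composite [n = m * p] is two successive dilations, and the bound is additive in [ln n]. *)
case: (boolP (prime n)) => [pn|npn]; last first.
  set p := pdiv n; have pp : prime p by exact: pdiv_prime.
  set m := (n %/ p)%N.
  have en : n = (m * p)%N by rewrite /m divnK // pdiv_dvd.
  have m0 : (0 < m)%N by case: (m) en n0 => // ->.
  have m1 : (1 < m)%N.
    rewrite ltn_neqAle m0 andbT; apply/eqP => e; move: npn; rewrite en -e mul1n pp //.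
  have pr := INR_prime_ge2 pp.
  have mr := INR_ge1 m0.
  have eN : INR n = INR m * INR p by rewrite {1}en mult_INR.
  have pltn : (p < n)%N by rewrite [X in (_ < X)%N]en ltn_Pmull // prime_gt0.
  have mltn : (m < n)%N by rewrite [X in (_ < X)%N]en ltn_Pmulr // prime_gt1.
  have h1 := IH m mltn d L m0 ltac:(have := INR_le (ltnW mltn); lra) cd ad
     (fun q pq qd => ltn_trans mltn (hd q pq qd)) hL ltac:(rewrite eN in nL; nra).
  have h2 := IH p pltn d (INR m * L) (prime_gt0 pp) ltac:(have := INR_le (ltnW pltn); lra) cd ad
     (fun q pq qd => ltn_trans pltn (hd q pq qd)) ltac:(nra) ltac:(rewrite eN in nL; nra).
  have -> : INR n * L = INR p * (INR m * L) by rewrite eN; ring.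
  rewrite eN ln_mult; [|lra|lra].
  have -> : hsum N d (INR p * (INR m * L)) - hsum N d L =
     (hsum N d (INR p * (INR m * L)) - hsum N d (INR m * L)) + (hsum N d (INR m * L) - hsum N d L) by ring.
  apply: (Rle_trans _ _ _ (Rabs_triang _ _)); lra.
have nd : ~~ (n %| d)%N by apply/negP => /(hd n pn); rewrite ltnn.
have [n2k [_ dn]] := small_n_bounds (conj c10 c11) k0 n0 hn.
have [hV [low hr]] := hR k N Ls kk1 hN hLsN d L cd ad hL LLs.
have {}hr := hr n pn nd n2k.
have nL0 : L <= INR n * L by nra.
have hnL : exp (c * t) <= INR n * L by lra.
have [_ [_ hr2]] := hR k N Ls kk1 hN hLsN d (INR n * L) cd ad hnL nL.
have {}hr2 := hr2 n pn nd n2k.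
have htl := hT k N Ls d (INR n * L) kk2 hN hLs cd ad Lst ltac:(nra) nL low.
have raw := hsum_shift_raw a pn nd L0 N0.
have l0 := ln_prime_gt0 pn.
have lh : / 2 <= ln (INR n).
  have := @ln_le 2 _ ltac:(lra) (INR_prime_ge2 pn); have := ln2_gt; lra.
set E := hsum N d Ls in hV low hr hr2 htl *.
have E0 : 0 <= E by exact: hE0.
set D := delta k in d0 dn hr hr2 htl *.
set l := ln (INR n) in l0 lh dn hr hr2 *.
set P := INR n in nr raw nL nL0 hnL hr hr2 htl dn *.
have DE : 0 <= D * E by nra.
have DlE : 0 <= D * l * E by apply: Rmult_le_pos => //; nra.
have vn0 : 0 <= hsum N (d * n) L by exact: hsum_ge0.
have vnP0 : 0 <= hsum N (d * n) (P * L) by apply: hsum_ge0; nra.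
have q1 : hsum N (d * n) L / (P + 1) <= C * D * l * E.
  apply: (Rmult_le_reg_r (P + 1)); first lra.
  have -> : hsum N (d * n) L / (P + 1) * (P + 1) = hsum N (d * n) L by field; lra.
  apply: (Rle_trans _ _ _ hr).
  have -> : C * D * (P * l) * E = C * (D * l * E) * P by ring.
  have -> : C * D * l * E * (P + 1) = C * (D * l * E) * (P + 1) by ring.
  apply: Rmult_le_compat_l; [nra | lra].
have q2 : D * E <= 2 * (D * l * E).
  have -> : 2 * (D * l * E) = D * E * (2 * l) by ring.
  have := Rmult_le_compat_l _ _ _ DE (_ : 1 <= 2 * l); move=> /(_ ltac:(lra)); lra.
set X := hsum N d (P * L) - hsum N d L in raw *.
(* The primes 2, 3, 5 may not enter [d]; for them both sums over [d * n] are bounded separately, the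
   factor [n] being at most 5. *)
case: (leqP n 5) => n5.
  have P5 : P <= 5 by have := INR_le n5; rewrite /P /=; lra.
  have a1 : hsum N (d * n) L <= 5 * C * (D * l * E).
    apply: (Rle_trans _ _ _ hr); have -> : C * D * (P * l) * E = P * (C * (D * l * E)) by ring.
    have -> : 5 * C * (D * l * E) = 5 * (C * (D * l * E)) by ring.
    by apply: Rmult_le_compat_r => //; nra.
  have a2 : hsum N (d * n) (P * L) <= 5 * C * (D * l * E).
    apply: (Rle_trans _ _ _ hr2); have -> : C * D * (P * l) * E = P * (C * (D * l * E)) by ring.
    have -> : 5 * C * (D * l * E) = 5 * (C * (D * l * E)) by ring.
    by apply: Rmult_le_compat_r => //; nra.
  have -> : C1 * D * l * E = C1 * (D * l * E) by ring.
  have r1 := Rabs_def2_le raw.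
  apply: Rabs_le.
  have : C * (D * l * E) >= 0 by nra.
  have : lp * C * (D * l * E) >= 0 by nra.
  rewrite /C1; split; lra.
have n1p : (0 < n.-1)%N by rewrite -subn1 subn_gt0.
have enP : P = INR n.-1 + 1 by rewrite /P -{1}(prednK n0) S_INR.
have P7 : 6 <= P by have := INR_le n5; rewrite /P /=; lra.
have cdn : coprime30 (d * n).
  case: cd => d2 d3 d5; split; rewrite Euclid_dvdM // negb_or ?d2 ?d3 ?d5 dvdn_prime2 //= eq_sym gtn_eqF //;
   by apply: leq_ltn_trans n5.
have adn : avoid k (d * n) by apply: avoid_mul => //; rewrite n0.
have hdn q : prime q -> (q %| d * n)%N -> (n.-1 < q)%N.
  move=> pq; rewrite Euclid_dvdM // => /orP[/(hd q pq)|].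
    by move=> h1; apply: leq_ltn_trans h1; exact: leq_pred.
  by rewrite dvdn_prime2 // => /eqP ->; rewrite prednK.
have ih := IH n.-1 ltac:(by rewrite prednK) (d * n)%N L n1p ltac:(rewrite -/P in hn; lra) cdn adn hdn hL ltac:(nra).
set Q := INR n.-1 in enP ih; rewrite -/D in ih.
have [_ [_ hrs]] := hR k N Ls kk1 hN hLsN d Ls cd ad Lst (Rle_refl _).
have {}hrs := hrs n pn nd n2k; rewrite -/D -/E -/P -/l in hrs.
have hhalf : hsum N (d * n) Ls <= / 2 * E.
  apply: (Rle_trans _ _ _ hrs); apply: Rmult_le_compat_r => //.
  have -> : C * D * (P * l) = C * (D * (P * l)) by ring.
  nra.
have lQ : ln Q <= l by rewrite /l; apply: ln_le; rewrite /Q; [exact: INR_pos | apply: INR_le; exact: leq_pred].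
have lQ0 : 0 <= ln Q by exact: ln_INR_ge0.
have ih2 : Rabs (hsum N (d * n) (Q * L) - hsum N (d * n) L) <= C1 / 2 * (D * l * E).
  apply: (Rle_trans _ _ _ ih).
  have -> : C1 / 2 * (D * l * E) = C1 * D * l * (/ 2 * E) by field.
  have CD : 0 < C1 * D by exact: Rmult_lt_0_compat.
  apply: Rmult_le_compat; [by apply: Rmult_le_pos; lra | exact: hsum_ge0 | | exact: hhalf].
  by apply: Rmult_le_compat_l; lra.
have QL : exp (c * t) <= Q * L by nra.
have [_ [_ hrq]] := hR k N Ls kk1 hN hLsN d (Q * L) cd ad QL ltac:(nra).
have {}hrq := hrq n pn nd n2k; rewrite -/D -/E -/P -/l in hrq.
(* The Lipschitz factor [1 / (n - 1)] cancels the factor [n] in the bound of [hsum_ratio], which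
   leaves [delta k * ln n]. *)
have lip : Rabs (hsum N (d * n) (P * L) - hsum N (d * n) (Q * L)) <= 2 * lp * C * (D * l * E).
  have s12 : 1 <= P / Q <= 2.
    split; apply: (Rmult_le_reg_r Q); try lra.
      by have -> : P / Q * Q = P by [field; lra]; lra.
    by have -> : P / Q * Q = P by [field; lra]; lra.
  have QL0 : 0 < Q * L by nra.
  have := hsum_lip a0 N (d * n) QL0 s12.
  have -> : P / Q * (Q * L) = P * L by field; lra.
  move=> h1; apply: (Rle_trans _ _ _ h1); rewrite -/lp.
  have e1 : P / Q - 1 = / Q by rewrite enP; field; lra.
  rewrite e1.
  have iQ : 0 < / Q by apply: Rinv_0_lt_compat; lra.
  apply: (Rle_trans _ (lp * / Q * (C * D * (P * l) * E))); first by apply: Rmult_le_compat_l => //; nra.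
  have -> : lp * / Q * (C * D * (P * l) * E) = (P / Q) * (lp * C * (D * l * E)) by field; lra.
  have -> : 2 * lp * C * (D * l * E) = 2 * (lp * C * (D * l * E)) by ring.
  by apply: Rmult_le_compat_r; [nra | lra].
have -> : C1 * D * l * E = C1 * (D * l * E) by ring.
have r1 := Rabs_def2_le raw. have r2 := Rabs_def2_le ih2. have r3 := Rabs_def2_le lip.
apply: Rabs_le.
have cd0 : C * (D * l * E) >= 0 by nra.
have eC : C1 / 2 * (D * l * E) = (11 * C + 2 * lp * C + 2) * (D * l * E) by rewrite /C1; field.
have eC2 : C1 * (D * l * E) = (22 * C + 4 * lp * C + 4) * (D * l * E) by rewrite /C1; field.
rewrite eC in r2; rewrite eC2; move: r1 r2 r3 q1 q2 htl cd0 {eC eC2}; clear.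
set Y := hsum N (d * n) L / (P + 1); set Y2 := P * L / INR N * psum d N.
move=> r1 r2 r3 q1 q2 htl cd0; split; lra.
Qed.
End Shift2.

(** * Dilation by real numbers *)

Lemma coprime30_1 : coprime30 1.
Proof. by split. Qed.

Lemma avoid_1 k : avoid k 1.
Proof. by move=> p pp _; rewrite dvdn1 gtn_eqF // prime_gt1. Qed.

Lemma dyadic_bracket f : 1 <= f -> exists i, INR (2 ^ i)%N <= f < 2 * INR (2 ^ i)%N.
Proof.
move=> f1; have [h1 h2] := @nfloor_spec f ltac:(lra).
have n0 : (0 < nfloor f)%N by apply/ltP; apply: RIneq.INR_lt; rewrite /=; lra.
exists (trunc_log 2 (nfloor f)).
have l1 := @trunc_logP 2 (nfloor f) isT n0.
have l2 : (nfloor f < 2 ^ (trunc_log 2 (nfloor f)).+1)%N by exact: trunc_log_ltn.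
have := INR_le l1; have := INR_le l2; rewrite S_INR expnS mult_INR [INR 2]/=; lra.
Qed.

Section RealShift.
Variable a : R.
Hypothesis a0 : 0 < a.
Local Notation hsum := (hsum a).

(* Write [f = 2 ^ i * f'] with [1 <= f' < 2] and replace [f'] by [m / n] with [n] as
   large as [hsum_shift] allows. *)
Lemma hsum_real_shift c e0 (A : nat) : 0 < c -> 0 < e0 -> exists C k0, 0 < C /\ (12 <= k0)%N /\
  forall k N L f, (k0 <= k)%N -> (N < 2 ^ 2 ^ k.-1)%N -> 1 <= f -> f <= INR (2 ^ (A * k))%N ->
  exp (c * INR (2 ^ k)%N) <= L -> f * L <= INR N * exp (- (e0 * INR (2 ^ k)%N)) ->
  Rabs (hsum N 1 (f * L) - hsum N 1 L) <= C * (INR k * delta k) * hsum N 1 (f * L).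
Proof.
(* [c / 2] leaves room below [L], since the argument passes through the scale [L1 / n]. *)
move=> c0 e00; have c20 : 0 < c / 2 by lra.
have [C1 [c1 [k1 [C10 [hc1 [k112 hS]]]]]] := hsum_shift a0 c20 e00.
have [CR [k2 [CR0 [k212 hR]]]] := hsum_ratio a0 c20.
have [k3 [k30 hk3]] := k_le_rt (2 / c1).
have [k4 [k40 hk4]] := @t_le_exp 1 (c / 2) c20.
set lp := lipc a; have lp0 : 0 < lp := lipc_gt0 a0.
exists (INR A * C1 + 2 * C1 + lp * CR * (4 / c1)), (maxn k1 (maxn k2 (maxn k3 k4))).
have A0 := pos_INR A.
have p1 : 0 < lp * CR * (4 / c1).
  by apply: Rmult_lt_0_compat; [exact: Rmult_lt_0_compat | apply: Rdiv_lt_0_compat; lra].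
split; first nra.
split; first by rewrite leq_max k112.
move=> k N L f; rewrite !geq_max => /and4P[kk1 kk2 kk3 kk4] hN f1 fA hL hf.
have k0 : (0 < k)%N := leq_trans k30 kk3.
have {}hk3 := hk3 k kk3; have {}hk4 := hk4 k kk4.
set t := INR (2 ^ k)%N in hL hf hk4; have t0 : 0 < t := exp2_gt0 k.
set Ls := f * L in hf *.
have d0 := delta_gt0 k0; have kr := INR_ge1 k0; have r0 := rt_gt0 k0.
have L0 : 0 < L by have := exp_pos (c * t); lra.
have Ls0 : 0 < Ls by rewrite /Ls; nra.
have ee : exp (- (e0 * t)) <= 1 by rewrite -exp_0; apply: exp_le; nra.
have hLsN : Ls <= INR N by have := pos_INR N; nra.
set E := hsum N 1 Ls; have E0 : 0 <= E by exact: hsum_ge0.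
have sh n L' : (0 < n)%N -> INR n <= c1 * rt k / INR k -> exp (c / 2 * t) <= L' -> INR n * L' <= Ls ->
   Rabs (hsum N 1 (INR n * L') - hsum N 1 L') <= C1 * delta k * ln (INR n) * E.
  move=> n0 hn hL' nL'; apply: (hS k N Ls kk1 hN hf n 1%N L' n0 hn coprime30_1 (@avoid_1 k) _ hL' nL').
  by move=> q pq; rewrite dvdn1 gtn_eqF // prime_gt1.
have half : exp (c / 2 * t) * exp (c / 2 * t) = exp (c * t) by rewrite -exp_plus; congr exp; field.
have hh1 : 1 <= exp (c / 2 * t) by rewrite -exp_0; apply: exp_le; nra.
have [i [i1 i2]] := dyadic_bracket f1.
have iA : (i <= A * k)%N.
  have h1 : (2 ^ i <= 2 ^ (A * k))%N by apply: leq_of_INR; lra.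
  by move: h1; rewrite leq_exp2l.
set x := c1 * rt k / (2 * INR k).
have x1 : 1 <= x.
  apply: (Rmult_le_reg_r (2 * INR k)); first lra.
  have -> : x * (2 * INR k) = c1 * rt k by rewrite /x; field; lra.
  have := Rmult_le_compat_l c1 _ _ ltac:(lra) hk3.
  have -> : c1 * (2 / c1 * INR k) = 2 * INR k by field; lra.
  lra.
have [n1 n2] := @nfloor_spec x ltac:(lra).
set n := nfloor x in n1 n2.
have n0 : (0 < n)%N by apply/ltP; apply: RIneq.INR_lt; rewrite /=; lra.
have nr := INR_ge1 n0.
have nx : x / 2 <= INR n by lra.
have e2x : c1 * rt k / INR k = 2 * x by rewrite /x; field; lra.
have nc : INR n <= c1 * rt k / INR k by lra.
have c2 : INR 2 <= c1 * rt k / INR k by rewrite e2x /=; lra.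
have [n2k [ln_n _]] := small_n_bounds hc1 k0 n0 nc.
have nt : INR n <= t by exact: INR_le.
have t2i := exp2_gt0 i.
(* The power of 2 is reached by at most [A * k] doublings, each costing a multiple of [delta k]. *)
have dy j : (j <= i)%N -> Rabs (hsum N 1 (INR (2 ^ j)%N * L) - hsum N 1 L) <= INR j * (C1 * delta k * E).
  elim: j => [|j IH] ji; first by rewrite Rmult_1_l Rminus_diag Rabs_R0 /=; lra.
  have t2j := exp2_gt0 j.
  have jl : INR (2 ^ j.+1)%N <= INR (2 ^ i)%N by apply: INR_le; rewrite leq_exp2l.
  have ej : INR (2 ^ j.+1)%N = INR 2 * INR (2 ^ j)%N by rewrite expnS mult_INR.
  have tj1 : 1 <= INR (2 ^ j)%N by apply: INR_ge1; rewrite expn_gt0.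
  have Lj : exp (c / 2 * t) <= INR (2 ^ j)%N * L by nra.
  have up : INR 2 * (INR (2 ^ j)%N * L) <= Ls.
    rewrite -Rmult_assoc -ej /Ls; apply: Rmult_le_compat_r; lra.
  have h1 := sh 2%N (INR (2 ^ j)%N * L) isT c2 Lj up.
  rewrite ej Rmult_assoc.
  have -> : hsum N 1 (INR 2 * (INR (2 ^ j)%N * L)) - hsum N 1 L =
    (hsum N 1 (INR 2 * (INR (2 ^ j)%N * L)) - hsum N 1 (INR (2 ^ j)%N * L)) + (hsum N 1 (INR (2 ^ j)%N * L) - hsum N 1 L) by ring.
  apply: (Rle_trans _ _ _ (Rabs_triang _ _)).
  have l2 : ln (INR 2) <= 1 by rewrite (_ : INR 2 = 2) //; have := ln2_lt1; lra.
  have CE : 0 <= C1 * delta k * E by apply: Rmult_le_pos => //; nra.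
  have h2 : C1 * delta k * ln (INR 2) * E <= C1 * delta k * E by rewrite Rmult_assoc (Rmult_comm (ln _)) -Rmult_assoc; nra.
  have := IH (ltnW ji); rewrite (S_INR j); lra.
have hdy := dy i (leqnn i).
set L1 := INR (2 ^ i)%N * L in hdy.
have L1L : L <= L1 by rewrite /L1; have := INR_ge1 (_ : (0 < 2 ^ i)%N); rewrite expn_gt0 => /(_ isT); nra.
set f' := f / INR (2 ^ i)%N.
have f'1 : 1 <= f' < 2.
  have ef : f' * INR (2 ^ i)%N = f by rewrite /f'; field; lra.
  split; [apply: (Rmult_le_reg_r (INR (2 ^ i)%N)) | apply: (Rmult_lt_reg_r (INR (2 ^ i)%N))]; lra.
have eLs : Ls = f' * L1 by rewrite /Ls /f' /L1; field; lra.
have [m1 m2] := @nfloor_spec (INR n * f') ltac:(nra).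
set m := nfloor (INR n * f') in m1 m2.
have nm : (n <= m)%N.
  rewrite -ltnS; apply/ltP; apply: RIneq.INR_lt; rewrite S_INR; nra.
have m0 : (0 < m)%N := leq_trans n0 nm.
have mr := INR_le nm.
set L0' := L1 / INR n.
have eL1 : L1 = INR n * L0' by rewrite /L0'; field; lra.
have L0'0 : exp (c / 2 * t) <= L0'.
  apply: (Rmult_le_reg_r (INR n)); first lra.
  rewrite (Rmult_comm L0') -eL1.
  have : exp (c / 2 * t) * INR n <= exp (c / 2 * t) * exp (c / 2 * t) by apply: Rmult_le_compat_l; lra.
  lra.
have L0'p : 0 < L0' by lra.
have mL : INR m * L0' <= Ls.
  rewrite eLs eL1 -Rmult_assoc; apply: Rmult_le_compat_r; lra.
have nL : INR n * L0' <= Ls by nra.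
have mc : INR m <= c1 * rt k / INR k by rewrite e2x; nra.
have [_ [ln_m _]] := small_n_bounds hc1 k0 m0 mc.
have sn := sh n L0' n0 nc L0'0 nL.
have sm := sh m L0' m0 mc L0'0 mL.
rewrite -eL1 in sn.
(* [s] is the ratio of [f'] to [m / n]. The Lipschitz bound covers it, as [s - 1 <= 1 / n] is of
   order [k * delta k]. *)
set s := INR n * f' / INR m.
have mp : 0 < INR m by lra.
have im : 0 < / INR m by exact: Rinv_0_lt_compat.
have es : s * INR m = INR n * f' by rewrite /s; field; lra.
have s12 : 1 <= s <= 2 by split; apply: (Rmult_le_reg_r (INR m)); lra.
have sm1 : s - 1 <= / INR n.
  apply: (Rle_trans _ (/ INR m)); last by apply: Rinv_le_contravar; lra.
  apply: (Rmult_le_reg_r (INR m)) => //; rewrite Rinv_l; lra.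
have mL0 : 0 < INR m * L0' by nra.
have lip := hsum_lip a0 N 1 mL0 s12.
have eLs2 : s * (INR m * L0') = Ls by rewrite eLs eL1 -Rmult_assoc es; ring.
rewrite eLs2 -/E -/lp in lip.
have mL' : exp (c / 2 * t) <= INR m * L0' by nra.
have [hvm _] := hR k N Ls kk2 hN hLsN 1%N (INR m * L0') coprime30_1 (@avoid_1 k) mL' mL.
rewrite -/E in hvm.
have in0 : 0 < / INR n by apply: Rinv_0_lt_compat; lra.
have inn : / INR n <= 4 / c1 * (INR k * delta k).
  have -> : 4 / c1 * (INR k * delta k) = / (x / 2) by rewrite /x /delta; field; lra.
  by apply: Rinv_le_contravar; lra.
have lip2 : Rabs (E - hsum N 1 (INR m * L0')) <= lp * CR * (4 / c1) * (INR k * delta k) * E.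
  apply: (Rle_trans _ _ _ lip).
  apply: (Rle_trans _ (lp * (4 / c1 * (INR k * delta k)) * (CR * E))); last by apply: Req_le; ring.
  have v0 : 0 <= hsum N 1 (INR m * L0') by exact: hsum_ge0.
  apply: Rmult_le_compat => //; first by apply: Rmult_le_pos; lra.
  by apply: Rmult_le_compat_l; lra.
have DE : 0 <= C1 * delta k * E by apply: Rmult_le_pos => //; nra.
have sn2 : C1 * delta k * ln (INR n) * E <= C1 * (INR k * delta k) * E.
  have -> : C1 * delta k * ln (INR n) * E = (C1 * delta k * E) * ln (INR n) by ring.
  have -> : C1 * (INR k * delta k) * E = (C1 * delta k * E) * INR k by ring.
  exact: Rmult_le_compat_l.
have sm2 : C1 * delta k * ln (INR m) * E <= C1 * (INR k * delta k) * E.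
  have -> : C1 * delta k * ln (INR m) * E = (C1 * delta k * E) * ln (INR m) by ring.
  have -> : C1 * (INR k * delta k) * E = (C1 * delta k * E) * INR k by ring.
  exact: Rmult_le_compat_l.
have hi : INR i * (C1 * delta k * E) <= INR A * C1 * (INR k * delta k) * E.
  have -> : INR A * C1 * (INR k * delta k) * E = (INR A * INR k) * (C1 * delta k * E) by ring.
  by apply: Rmult_le_compat_r => //; rewrite -mult_INR; exact: INR_le.
have q1 := Rabs_def2_le hdy; have q2 := Rabs_def2_le sn; have q3 := Rabs_def2_le sm; have q4 := Rabs_def2_le lip2.
have -> : (INR A * C1 + 2 * C1 + lp * CR * (4 / c1)) * (INR k * delta k) * E =
  INR A * C1 * (INR k * delta k) * E + 2 * (C1 * (INR k * delta k) * E) + lp * CR * (4 / c1) * (INR k * delta k) * E by ring.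
move: q1 q2 q3 q4 hi sn2 sm2.
set Z1 := INR A * C1 * (INR k * delta k) * E; set Z2 := C1 * (INR k * delta k) * E.
set Z3 := lp * CR * (4 / c1) * (INR k * delta k) * E; set Z4 := INR i * _.
set Z5 := C1 * delta k * ln (INR n) * E; set Z6 := C1 * delta k * ln (INR m) * E.
clear; move=> *; apply: Rabs_le; split; lra.
Qed.
End RealShift.

(** * A sieve for the square-free cofactor *)

Section Sieve.
Variable D : nat -> nat.

Definition sifted (P : seq nat) (q : nat) : bool := all (fun p => ~~ (D p %| q)%N) P.
Definition sifted_card (P : seq nat) (n : nat) : R := INR (count (sifted P) (iota 1 n)).

Lemma sifted_cardE P n : sifted_card P n = \sum_(1 <= q < n.+1 | sifted P q) 1.
Proof. by rewrite /sifted_card INR_sum_bool /index_iota subSS subn0. Qed.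

(* Since [D p] is coprime to the other moduli, dividing a multiple of [D p] by
   [D p] does not change whether it survives the rest of the sieve. *)
Lemma sieve_step p P n : (0 < D p)%N -> (forall p', p' \in P -> coprime (D p') (D p)) ->
  sifted_card (p :: P) n = sifted_card P n - sifted_card P (n %/ D p).
Proof.
move=> D0 cP; rewrite !sifted_cardE.
rewrite [X in _ = X - _](bigID (fun q => D p %| q)%N) /=.
have -> : \sum_(1 <= q < n.+1 | sifted P q && (D p %| q)%N) 1 =
          \sum_(1 <= q < (n %/ D p).+1 | sifted P q) 1.
  rewrite (eq_bigl (fun q => (D p %| q)%N && sifted P q)); last by move=> q; rewrite andbC.
  rewrite (sum_multiples (fun=> 1) (sifted P)) //; apply: eq_bigl => m.
  by apply: eq_in_all => p' p'P; rewrite Gauss_dvdr // cP.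
rewrite (eq_bigl (fun q => sifted P q && ~~ (D p %| q)%N)); last by move=> q; rewrite andbC.
lra.
Qed.

Lemma nfloor_div y d : 0 <= y -> (0 < d)%N -> nfloor (y / INR d) = (nfloor y %/ d)%N.
Proof.
move=> y0 d0; have dp := INR_pos d0.
have [h1 h2] := nfloor_spec y0.
have yd : 0 <= y / INR d by apply: Rmult_le_pos => //; left; exact: Rinv_0_lt_compat.
have [h3 h4] := nfloor_spec yd.
have e : y / INR d * INR d = y by field; lra.
apply/eqP; rewrite eqn_leq; apply/andP; split.
  rewrite leq_divRL // -ltnS; apply/ltP; apply: RIneq.INR_lt; rewrite S_INR mult_INR.
  have : INR (nfloor (y / INR d)) * INR d <= y by rewrite -[X in _ <= X]e; apply: Rmult_le_compat_r; lra.
  lra.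
rewrite -ltnS ltn_divLR //; apply/ltP; apply: RIneq.INR_lt; rewrite mult_INR S_INR.
have : y < (INR (nfloor (y / INR d)) + 1) * INR d by rewrite -[X in X < _]e; apply: Rmult_lt_compat_r.
lra.
Qed.

(** A power of [y], unlike the constant 1, also bounds the error for small [y] and is multiplicative
    under division by the moduli. The exponent exceeds [1 / 2], so that the moduli [p ^ 2] give a
    convergent product, and is below 1, so that a power is saved. *)
Lemma floor_error y : 0 < y -> Rabs (INR (nfloor y) - y) <= Rpower y (3 / 4).
Proof.
move=> y0; have [h1 h2] := @nfloor_spec y ltac:(lra).
rewrite Rabs_minus_sym Rabs_pos_eq; last lra.
case: (Rle_lt_dec 1 y) => y1.
  apply: (@Rle_trans _ 1); first lra.
  have -> : 1 = Rpower 1 (3 / 4) by rewrite /Rpower ln_1 Rmult_0_r exp_0.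
  by apply: Rpower_mono; lra.
apply: (Rle_trans _ y); first by have := pos_INR (nfloor y); lra.
have h3 : ln y < 0 by rewrite -ln_1; apply: ln_increasing.
rewrite -{1}(exp_ln y) // /Rpower; apply: exp_le; lra.
Qed.

(** The error is a product over the moduli instead of the number of subsets of [P], so that all the
    primes up to [N] can be sieved at once. *)
Lemma sieve P y : (forall p, p \in P -> (1 < D p)%N) -> uniq P ->
  (forall p p', p \in P -> p' \in P -> p != p' -> coprime (D p) (D p')) -> 0 < y ->
  Rabs (sifted_card P (nfloor y) - y * \prod_(p <- P) (1 - / INR (D p))) <=
  Rpower y (3 / 4) * \prod_(p <- P) (1 + Rpower (INR (D p)) (- (3 / 4))).
Proof.
elim: P y => [|p P IH] y hD uP cP y0.
  rewrite !big_nil !Rmult_1_r; have -> : sifted_card [::] (nfloor y) = INR (nfloor y).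
    by rewrite /sifted_card (eq_count (a2 := predT)) // count_predT size_iota.
  exact: floor_error.
have D1 : (1 < D p)%N by apply: hD; rewrite inE eqxx.
have D0 : (0 < D p)%N := ltnW D1. have Dr := INR_pos D0.
case/andP: (uP) => pP uP'.
rewrite sieve_step //; last first.
  move=> p' p'P; apply: cP; rewrite ?inE ?eqxx ?p'P ?orbT //.
  by apply: contraNneq pP => <-.
rewrite !big_cons -nfloor_div //; last lra.
have IH' z : 0 < z -> Rabs (sifted_card P (nfloor z) - z * \prod_(p <- P) (1 - / INR (D p))) <=
  Rpower z (3 / 4) * \prod_(p <- P) (1 + Rpower (INR (D p)) (- (3 / 4))).
  move=> z0; apply: IH => //; first by move=> q qP; apply: hD; rewrite inE qP orbT.
  by move=> q q' qP qP'; apply: cP; rewrite inE ?qP ?qP' orbT.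
have h1 := IH' y y0; have h2 := IH' (y / INR (D p)) ltac:(apply: Rdiv_lt_0_compat => //).
move: h1 h2; set A := \prod_(p <- P) _; set E := \prod_(p <- P) _ => h1 h2.
have -> : Rpower y (3 / 4) * ((1 + Rpower (INR (D p)) (- (3 / 4))) * E) =
   Rpower y (3 / 4) * E + Rpower (y / INR (D p)) (3 / 4) * E.
  rewrite /Rdiv -Rpower_mult_distr //; last exact: Rinv_0_lt_compat.
  have -> : Rpower (/ INR (D p)) (3 * / 4) = Rpower (INR (D p)) (- (3 * / 4)).
    by rewrite /Rpower ln_Rinv //; congr exp; ring.
  ring.
have -> : sifted_card P (nfloor y) - sifted_card P (nfloor (y / INR (D p))) - y * ((1 - / INR (D p)) * A) =
   (sifted_card P (nfloor y) - y * A) + - (sifted_card P (nfloor (y / INR (D p))) - y / INR (D p) * A).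
  by rewrite /Rdiv; ring.
apply: (Rle_trans _ _ _ (Rabs_triang _ _)); rewrite Rabs_Ropp; lra.
Qed.
End Sieve.

(** Sieving by these moduli leaves the [q] prime to [l] and, away from the primes of [l], free of
    squares. *)
Definition sieve_mod (l p : nat) : nat := if (p %| l)%N then p else (p * p)%N.
Definition primes_to (N : nat) : seq nat := [seq p <- iota 1 N | prime p].

Lemma mem_primes_to N p : (p \in primes_to N) = prime p && (p <= N)%N.
Proof.
rewrite mem_filter mem_iota add1n ltnS; case: (boolP (prime p)) => //= pp.
by rewrite prime_gt0.
Qed.

Lemma big_primes_to N (F : nat -> R) :
  \prod_(p <- primes_to N) F p = \prod_(1 <= p < N.+1 | prime p) F p.
Proof. by rewrite big_filter /index_iota subSS subn0. Qed.

Lemma big_primes_dvd N l (F : nat -> R) : (0 < l <= N)%N ->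
  \prod_(p <- primes l) F p = \prod_(1 <= p < N.+1 | prime p && (p %| l)%N) F p.
Proof.
move=> /andP[l0 lN]; rewrite -[RHS]big_filter; apply: perm_big; apply: uniq_perm.
- exact: primes_uniq.
- by rewrite filter_uniq // iota_uniq.
move=> p; rewrite mem_primes mem_filter l0 mem_index_iota /=.
case: (boolP (prime p)) => //= pp; case: (boolP (p %| l)%N) => //= pl.
by rewrite prime_gt0 //= ltnS (leq_trans (dvdn_leq l0 pl)).
Qed.

Definition sieve_const (N : nat) : R := \prod_(1 <= p < N.+1 | prime p) (1 - / INR p ^ 2).

Lemma sieve_const_bounds N : / 2 <= sieve_const N <= 1.
Proof.
case: N => [|N]; first by rewrite /sieve_const big_geq //; lra.
(* The left side is the product of [1 - 1 / n ^ 2] over all integers [n] from 2, which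
   telescopes. *)
suff : (INR N.+1 + 1) / (2 * INR N.+1) <= sieve_const N.+1 <= 1.
  have n1 := INR_ge1 (ltn0Sn N); move=> [h1 h2]; split => //; apply: Rle_trans h1.
  apply: (Rmult_le_reg_r (2 * INR N.+1)); first lra.
  have -> : (INR N.+1 + 1) / (2 * INR N.+1) * (2 * INR N.+1) = INR N.+1 + 1 by field; lra.
  lra.
elim: N => [|N [IH1 IH2]].
  by rewrite /sieve_const big_mkcond big_nat1 /=; split; [apply: Req_le; field | lra].
have n1 := INR_ge1 (ltn0Sn N).
rewrite /sieve_const big_mkcond big_nat_recr // -big_mkcond -/(sieve_const N.+1) /=.
rewrite -[(match N with O => 1 | S _ => INR N + 1 end)]/(INR N.+1).
set x := INR N.+1 in n1 IH1 *.
have c0 : 0 <= sieve_const N.+1.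
  apply: Rle_trans IH1; apply: Rmult_le_pos; first lra.
  by left; apply: Rinv_0_lt_compat; lra.
have e1 : (x + 1) / (2 * x) = / 2 + / (2 * x) by field; lra.
have e2 : (x + 1 + 1) / (2 * (x + 1)) = / 2 + / (2 * (x + 1)) by field; lra.
have i1 : / (2 * (x + 1)) <= / (2 * x) by apply: Rinv_le_contravar; lra.
case: ifP => _; last by rewrite Rmult_1_r; lra.
have q : 0 <= / ((x + 1) * ((x + 1) * 1)) <= 1.
  split; first by left; apply: Rinv_0_lt_compat; nra.
  by rewrite -Rinv_1; apply: Rinv_le_contravar; nra.
split; last nra.
apply: (Rle_trans _ ((x + 1) / (2 * x) * (1 - / ((x + 1) * ((x + 1) * 1))))).
  by apply: Req_le; field; lra.
apply: Rmult_le_compat_r; lra.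
Qed.

Lemma rprod_mul (I : Type) (r : seq I) (P : pred I) (F irad_sum : I -> R) :
  \prod_(i <- r | P i) (F i * irad_sum i) = \prod_(i <- r | P i) F i * \prod_(i <- r | P i) irad_sum i.
Proof. by rewrite big_split. Qed.

(** Relative to [1 - 1 / p ^ 2], each prime of [l] contributes [(1 - 1 / p) / (1 - 1 / p ^ 2) = p /
    (p + 1)]. *)
Lemma sieve_density N l : (0 < l <= N)%N ->
  \prod_(p <- primes_to N) (1 - / INR (sieve_mod l p)) = sieve_const N * (INR (rad l) * ipsi l).
Proof.
move=> hl; rewrite big_primes_to.
have -> : INR (rad l) * ipsi l = \prod_(p <- primes l) (INR p / (INR p + 1)).
  rewrite /rad /ipsi /psi INR_prod INR_prod /Rdiv rprod_mul; congr (_ * _).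
  elim: (primes l) => [|p s IH]; first by rewrite !big_nil Rinv_1.
  by rewrite !big_cons Rinv_mult IH S_INR.
rewrite (big_primes_dvd _ hl) big_mkcondr /= -rprod_mul.
rewrite big_nat_cond [RHS]big_nat_cond; apply: eq_bigr => p /andP[_ pp].
have p2 := INR_prime_ge2 pp.
rewrite /sieve_mod; case: ifP => _; last by rewrite mult_INR /=; field; lra.
by rewrite /=; field; lra.
Qed.

Lemma rprod_le (I : Type) (r : seq I) (P : pred I) (F irad_sum : I -> R) :
  (forall i, P i -> 0 <= F i <= irad_sum i) ->
  0 <= \prod_(i <- r | P i) F i <= \prod_(i <- r | P i) irad_sum i.
Proof.
move=> FG; elim: r => [|i r IH]; first by rewrite !big_nil; lra.
rewrite !big_cons; case Pi: (P i) => //; have := FG i Pi => h1.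
split; first by apply: Rmult_le_pos; lra.
by apply: Rmult_le_compat; lra.
Qed.

Lemma inv_threehalf_le x : 1 <= x ->
  / ((x + 1) * sqrt (x + 1)) <= 2 / sqrt x - 2 / sqrt (x + 1).
Proof.
move=> x1; set s := sqrt x; set r := sqrt (x + 1).
have s0 : 0 < s by apply: sqrt_lt_R0; lra.
have r0 : 0 < r by apply: sqrt_lt_R0; lra.
have ss : s * s = x by apply: sqrt_sqrt; lra.
have rr : r * r = x + 1 by apply: sqrt_sqrt; lra.
have sr : s <= r by apply: sqrt_le_1; lra.
have -> : 2 / s - 2 / r = 2 * (r - s) * / (s * r) by field; lra.
have -> : r - s = / (r + s).
  apply: (Rmult_eq_reg_r (r + s)); last lra.
  by rewrite Rinv_l; last lra; lra.
have -> : 2 * / (r + s) * / (s * r) = / ((r + s) / 2 * (s * r)) by field; lra.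
rewrite -rr; apply: Rinv_le_contravar; first by apply: Rmult_lt_0_compat; nra.
have -> : r * r * r = r * (r * r) by ring.
by apply: Rmult_le_compat; nra.
Qed.

Lemma sieve_error_prod N :
  \prod_(1 <= p < N.+1 | prime p) (1 + Rpower (INR p) (- (3 / 2))) <= exp 2.
Proof.
have main n : \prod_(1 <= p < n.+2 | prime p) (1 + Rpower (INR p) (- (3 / 2))) <= exp (2 - 2 / sqrt (INR n.+1)).
  elim: n => [|n IH].
    rewrite big_mkcond big_nat1 /= sqrt_1 -[X in X <= _]exp_0; apply: exp_le; lra.
  rewrite big_mkcond big_nat_recr // -big_mkcond.
  have n1 := INR_ge1 (ltn0Sn n).
  have e : INR n.+2 = INR n.+1 + 1 by rewrite S_INR.
  have hi := inv_threehalf_le n1; rewrite -e in hi.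
  have p0 : 0 < INR n.+2 by exact: INR_pos.
  have rp : Rpower (INR n.+2) (- (3 / 2)) = / (INR n.+2 * sqrt (INR n.+2)).
    rewrite Rpower_Ropp; congr (/ _); rewrite -Rpower_sqrt // -{2}(Rpower_1 (INR n.+2)) // -Rpower_plus; congr (Rpower _ _); field.
  set P := \prod_(1 <= p < n.+2 | prime p) _ in IH *.
  have P0 : 0 <= P.
    by apply/Rlt_le/rprod_pos => p pp; have := Rpower_pos (INR p) (- (3 / 2)); lra.
  have -> : exp (2 - 2 / sqrt (INR n.+2)) =
     exp (2 - 2 / sqrt (INR n.+1)) * exp (2 / sqrt (INR n.+1) - 2 / sqrt (INR n.+2)).
    by rewrite -exp_plus; congr exp; ring.
  have ge1 : 1 + / (INR n.+2 * sqrt (INR n.+2)) <= exp (2 / sqrt (INR n.+1) - 2 / sqrt (INR n.+2)).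
    apply: (Rle_trans _ _ _ _ (exp_ineq1_le _)); lra.
  have ip : 0 < / (INR n.+2 * sqrt (INR n.+2)).
    by apply: Rinv_0_lt_compat; apply: Rmult_lt_0_compat => //; exact: sqrt_lt_R0.
  apply: Rmult_le_compat => //; case: ifP => _; rewrite ?rp; lra.
case: N => [|N]; first by rewrite big_geq // -[X in X <= _]exp_0; apply: exp_le; lra.
apply: (Rle_trans _ _ _ (main N)); apply: exp_le.
have : 0 < 2 / sqrt (INR N.+1); last lra.
by apply: Rdiv_lt_0_compat; [lra | apply: sqrt_lt_R0; exact: INR_pos].
Qed.

(** The moduli [p ^ 2] give the convergent product; for a prime of [l] the factor is at most
    [2 <= p] and goes into [rad l]. *)
Lemma sieve_error N l : (0 < l <= N)%N ->
  \prod_(p <- primes_to N) (1 + Rpower (INR (sieve_mod l p)) (- (3 / 4))) <= exp 2 * INR (rad l).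
Proof.
move=> hl; rewrite big_primes_to /rad INR_prod (big_primes_dvd _ hl) big_mkcondr /=.
set X := \big[Rmult/R1]_(1 <= i < N.+1 | prime i) (if _ then _ else _).
have X0 : 0 <= X.
  apply/Rlt_le/rprod_pos => p pp; case: ifP => _; last lra.
  by have := INR_prime_ge2 pp; lra.
apply: (Rle_trans _ ((\prod_(1 <= p < N.+1 | prime p) (1 + Rpower (INR p) (- (3 / 2)))) * X)); last first.
  by apply: Rmult_le_compat_r => //; exact: sieve_error_prod.
rewrite -rprod_mul; apply: (proj2 (rprod_le _ _)) => p pp.
have p2 := INR_prime_ge2 pp; have q0 := Rpower_pos (INR p) (- (3 / 2)).
split; first by have := Rpower_pos (INR (sieve_mod l p)) (- (3 / 4)); lra.
rewrite /sieve_mod; case: ifP => _.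
  have : Rpower (INR p) (- (3 / 4)) <= 1; last nra.
  have -> : 1 = Rpower (INR p) 0 by rewrite Rpower_O //; lra.
  by apply: Rle_Rpower; lra.
rewrite Rmult_1_r mult_INR -Rpower_mult_distr; [|lra|lra].
rewrite -Rpower_plus (_ : - (3 / 4) + - (3 / 4) = - (3 / 2)); last field; lra.
Qed.

Lemma sieve_main N l y : (0 < l <= N)%N -> 0 < y ->
  Rabs (sifted_card (sieve_mod l) (primes_to N) (nfloor y) - sieve_const N * (INR (rad l) * ipsi l) * y) <=
  exp 2 * INR (rad l) * Rpower y (3 / 4).
Proof.
move=> hl y0.
have hs : Rabs (sifted_card (sieve_mod l) (primes_to N) (nfloor y) - y * \prod_(p <- primes_to N) (1 - / INR (sieve_mod l p))) <=
  Rpower y (3 / 4) * \prod_(p <- primes_to N) (1 + Rpower (INR (sieve_mod l p)) (- (3 / 4))).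
  apply: sieve => //.
  - move=> p; rewrite mem_primes_to => /andP[pp _]; rewrite /sieve_mod; case: ifP => _; first exact: prime_gt1.
    by apply: (leq_trans (prime_gt1 pp)); rewrite leq_pmulr // prime_gt0.
  - by rewrite filter_uniq // iota_uniq.
  move=> p p'; rewrite !mem_primes_to => /andP[pp _] /andP[pp' _] ne.
  have c : coprime p p' by rewrite prime_coprime // dvdn_prime2.
  by rewrite /sieve_mod; case: ifP => _; case: ifP => _; rewrite ?coprimeMl ?coprimeMr ?c.
rewrite (sieve_density hl) in hs.
rewrite (_ : sieve_const N * (INR (rad l) * ipsi l) * y = y * (sieve_const N * (INR (rad l) * ipsi l))); last ring.
apply: (Rle_trans _ _ _ hs); rewrite (Rmult_comm _ (Rpower y _)).
by apply: Rmult_le_compat_l; [exact/Rlt_le/Rpower_pos | exact: sieve_error].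
Qed.

(** * Factoring an integer through its kernel *)

Lemma rad_gt0 n : (0 < rad n)%N.
Proof.
rewrite /rad big_seq; apply: prodn_cond_gt0 => p; rewrite mem_primes => /andP[pp _].
exact: prime_gt0.
Qed.

Lemma logn_rad p n : prime p -> logn p (rad n) = (p \in primes n).
Proof.
move=> pp; rewrite /rad.
have : all prime (primes n) by apply/allP => q; rewrite mem_primes => /andP[].
have := primes_uniq n; elim: (primes n) => [|q s IH]; first by rewrite big_nil logn1.
move=> /andP[qs us] /andP[pq ps].
have s0 : (0 < \prod_(j <- s) j)%N.
  by rewrite big_seq; apply: prodn_cond_gt0 => j /(allP ps); exact: prime_gt0.
rewrite big_cons (lognM p (prime_gt0 pq) s0) IH // inE logn_prime //.
by case: eqP qs => [->|_] //; move/negbTE ->.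
Qed.

Lemma mem_primes_dvd p n : prime p -> (0 < n)%N -> (p \in primes n) = (p %| n)%N.
Proof. by move=> pp n0; rewrite mem_primes pp n0. Qed.

Lemma rad_dvd n : (0 < n)%N -> (rad n %| n)%N.
Proof.
move=> n0; apply/dvdn_partP; first exact: rad_gt0.
move=> p; rewrite inE mem_primes => /andP[pp _].
rewrite p_part pfactor_dvdn // logn_rad //.
by case: (boolP (p \in primes n)) => // h1; rewrite logn_gt0.
Qed.

Lemma dvdn_logn m n : (0 < m)%N -> (0 < n)%N ->
  (forall p, prime p -> (logn p m <= logn p n)%N) -> (m %| n)%N.
Proof.
move=> m0 n0 hl; apply/dvdn_partP => // p; rewrite inE mem_primes => /andP[pp _].
by rewrite p_part pfactor_dvdn // hl.
Qed.

Lemma rad_mul_sifted N l q : (0 < l <= N)%N -> (0 < q <= N)%N ->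
  sifted (sieve_mod l) (primes_to N) q -> rad (l * rad l * q) = (rad l * q)%N.
Proof.
move=> /andP[l0 lN] /andP[q0 qN] /allP hq.
have r0 := rad_gt0 l.
have n0 : (0 < l * rad l * q)%N by rewrite !muln_gt0 l0 r0.
suff lg p : logn p (rad (l * rad l * q)) = logn p (rad l * q).
  by apply: eqn_from_log; [exact: rad_gt0 | rewrite muln_gt0 r0 | exact: lg].
case: (boolP (prime p)) => pp; last by rewrite (lognE p (rad _)) (lognE p (_ * _)) (negbTE pp).
rewrite logn_rad // mem_primes_dvd // lognM // logn_rad // mem_primes_dvd //.
rewrite !Euclid_dvdM //.
have prad : (p %| rad l)%N = (p %| l)%N.
  by rewrite -mem_primes_dvd // -logn_gt0 logn_rad // lt0b mem_primes_dvd.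
rewrite prad orbb.
case: (boolP (p %| l)%N) => pl /=.
  have pP : p \in primes_to N by rewrite mem_primes_to pp (leq_trans (dvdn_leq l0 pl)).
  have := hq p pP; rewrite /sieve_mod pl => pq.
  by rewrite lognE pp q0 (negbTE pq).
case: (boolP (p %| q)%N) => pq; last by rewrite lognE pp q0 (negbTE pq).
have pP : p \in primes_to N by rewrite mem_primes_to pp (leq_trans (dvdn_leq q0 pq)).
have := hq p pP; rewrite /sieve_mod (negbTE pl) -[(p * p)%N]/(p ^ 2)%N pfactor_dvdn // -ltnNge ltnS => h1.
apply/eqP; rewrite eqn_leq h1 add0n /=; rewrite logn_gt0 mem_primes_dvd // pq //.
Qed.

(** A prime of exponent [e >= 2] in [n] has exponent [e - 1] in [l] and 1 in [rad l]; a prime of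
    exponent 1 goes into [q]. *)
Lemma rad_decomp N n : (0 < n <= N)%N -> let l := (n %/ rad n)%N in let q := (rad n %/ rad l)%N in
  [/\ (0 < l <= N)%N, (0 < q <= N)%N, n = (l * rad l * q)%N & sifted (sieve_mod l) (primes_to N) q].
Proof.
move=> /andP[n0 nN] l q.
have rn := rad_gt0 n; have rl := rad_gt0 l.
have el : n = (l * rad n)%N by rewrite /l divnK // rad_dvd.
have l0 : (0 < l)%N by case: (l) el n0 => // ->.
have pn p : prime p -> (p %| l)%N -> (p %| n)%N by move=> _ pl; rewrite el dvdn_mulr.
have rr : (rad l %| rad n)%N.
  apply: dvdn_logn => // p pp; rewrite !logn_rad // !mem_primes_dvd //.
  by case: (boolP (p %| l)%N) => // /(pn p pp) ->.
have eq : rad n = (q * rad l)%N by rewrite /q divnK.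
have q0 : (0 < q)%N by case: (q) eq rn => // ->.
have lN : (l <= N)%N by apply: leq_trans nN; rewrite [X in (_ <= X)%N]el leq_pmulr.
have qN : (q <= N)%N.
  apply: leq_trans nN; apply: (leq_trans _ (dvdn_leq n0 (rad_dvd n0))).
  by rewrite eq leq_pmulr.
split; [by rewrite l0|by rewrite q0| |].
  by rewrite -mulnA (mulnC (rad l)) -eq; exact: el.
apply/allP => p; rewrite mem_primes_to => /andP[pp _].
have := logn_rad n pp; rewrite eq lognM // logn_rad // !mem_primes_dvd // => h1.
rewrite /sieve_mod; case: (boolP (p %| l)%N) => pl.
  move: h1; rewrite pl (pn p pp pl) => h1.
  have : logn p q = 0%N by move: h1; rewrite addn1 => -[].
  by move=> lq; apply/negP => pq; have : (0 < logn p q)%N by [rewrite logn_gt0 mem_primes_dvd]; rewrite lq.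
rewrite -[(p * p)%N]/(p ^ 2)%N pfactor_dvdn // -ltnNge ltnS.
by move: h1; rewrite (negbTE pl) addn0 => ->; case: (p %| n)%N.
Qed.

Lemma perm_fiber N l (C : pred nat) : (0 < l <= N)%N ->
  perm_eq [seq n <- iota 1 N | (n %/ rad n == l)%N && C n]
    [seq (l * rad l * q)%N | q <- [seq q <- iota 1 N |
      [&& sifted (sieve_mod l) (primes_to N) q, (l * rad l * q <= N)%N & C (l * rad l * q)%N]]].
Proof.
move=> hl; case/andP: (hl) => l0 lN.
have lr0 : (0 < l * rad l)%N by rewrite muln_gt0 l0 rad_gt0.
apply: uniq_perm.
- by rewrite filter_uniq // iota_uniq.
- rewrite map_inj_uniq; first by rewrite filter_uniq // iota_uniq.
  by move=> q q' /eqP; rewrite eqn_pmul2l // => /eqP.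
move=> n; rewrite mem_filter mem_iota add1n ltnS; apply/idP/mapP.
  case/andP=> /andP[/eqP el Cn] hn.
  have [_ hq en sq] := rad_decomp hn; rewrite el in hq en sq.
  exists (rad n %/ rad l)%N => //.
  by rewrite mem_filter sq -en Cn mem_iota add1n ltnS hq; case/andP: hn => _ ->.
case=> q; rewrite mem_filter mem_iota add1n ltnS => /andP[/and3P[sq nN Cq] hq] ->.
rewrite (rad_mul_sifted hl hq sq) Cq nN andbT.
case/andP: hq => q0 _; rewrite muln_gt0 lr0 q0 !andbT /=.
by rewrite -mulnA mulnK // muln_gt0 rad_gt0.
Qed.

Lemma count_fiber N l (C : pred nat) : (0 < l <= N)%N ->
  count (fun n => (n %/ rad n == l)%N && C n) (iota 1 N) =
  count (fun q => [&& sifted (sieve_mod l) (primes_to N) q, (l * rad l * q <= N)%N & C (l * rad l * q)%N]) (iota 1 N).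
Proof. by move=> hl; rewrite -!size_filter (perm_size (perm_fiber C hl)) size_map. Qed.

Lemma sum_by_fiber N (C : pred nat) (f : nat -> R) :
  \sum_(1 <= n < N.+1 | C n) f n =
  \sum_(1 <= l < N.+1) \sum_(1 <= n < N.+1 | (n %/ rad n == l)%N && C n) f n.
Proof.
under [RHS]eq_bigr do rewrite big_mkcondl.
rewrite exchange_big /= big_nat_cond [RHS]big_nat_cond; apply: eq_bigr => n /andP[hn _].
rewrite ltnS in hn; have [hl _ _ _] := rad_decomp hn.
have hin : (n %/ rad n)%N \in index_iota 1 N.+1 by rewrite mem_index_iota ltnS.
rewrite (bigD1_seq _ hin) ?iota_uniq //= eqxx big1 ?Rplus_0_r // => l; rewrite eq_sym => /negbTE -> //.
Qed.

(** The constant [kap] stands for [(ln n) ^ Th], which is nearly constant on the range that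
    matters. *)
Definition count_kappa (th kap x : R) : nat :=
  count (fun m => Rleb (INR (rad m)) (kap * Rpower (INR m) th)) (iota 1 (nfloor x)).

Lemma count_by_fiber N (C : pred nat) :
  INR (count C (iota 1 N)) =
  \sum_(1 <= l < N.+1) INR (count (fun n => (n %/ rad n == l)%N && C n) (iota 1 N)).
Proof.
have e (P : pred nat) : INR (count P (iota 1 N)) = \sum_(1 <= n < N.+1 | P n) 1.
  by rewrite INR_sum_bool /index_iota subSS subn0.
by rewrite e sum_by_fiber; apply: eq_bigr => l _; rewrite e.
Qed.

Lemma RlebP x y : reflect (x <= y) (Rleb x y).
Proof. by rewrite /Rleb; case: (Rle_dec x y) => h1; constructor. Qed.

Lemma ln_le_iff x y : 0 < x -> 0 < y -> x <= y <-> ln x <= ln y.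
Proof. by move=> x0 y0; split; [exact: ln_le | exact: exp_ln_le]. Qed.

Lemma leq_nfloor n x : 0 <= x -> (n <= nfloor x)%N <-> INR n <= x.
Proof.
move=> x0; have [h1 h2] := nfloor_spec x0; split; first by move/INR_le; lra.
by move=> h3; rewrite -ltnS; apply/ltP; apply: RIneq.INR_lt; rewrite S_INR; lra.
Qed.

Section Main.
Variables (th kap x : R).
Hypotheses (hth : 0 < th < 1) (k0 : 0 < kap) (x1 : 1 <= x).

Let a := th / (1 - th).
(* The value of [l] at which the bounds on [q] from [n <= x] and from
   [rad n <= kap * n ^ th] coincide. *)
Definition crossover : R := Rpower x (1 - th) / kap.
Definition Yl (l : nat) : R := kap * Rpower x th * hat (th / (1 - th)) (INR l / crossover).

Lemma crossover_gt0 : 0 < crossover.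
Proof. by apply: Rdiv_lt_0_compat => //; exact: Rpower_pos. Qed.

Lemma Yl_gt0 l : (0 < l)%N -> 0 < Yl l.
Proof.
move=> l0; apply: Rmult_lt_0_compat; first by apply: Rmult_lt_0_compat => //; exact: Rpower_pos.
by apply/hat_gt0/Rdiv_lt_0_compat; [exact: INR_pos | exact: crossover_gt0].
Qed.

(** [k] stands for [rad l * q], so that [l * k] is [n]. The conditions are [k <= x / l] and, solved
    for [k], [k ^ (1 - th) <= kap * l ^ th]; divided by [kap * x ^ th] the two bounds are the
    branches of [hat], whence the exponent [th / (1 - th)]. *)
Lemma Yl_spec l k : (0 < l)%N -> 0 < k ->
  (INR l * k <= x /\ k <= kap * Rpower (INR l * k) th) <-> k <= Yl l.
Proof.
move=> l0 ilog2; have lp := INR_pos l0; have L0 := crossover_gt0.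
have x0 : 0 < x by lra.
have X0 := Rpower_pos x th.
have q0 : 0 < kap * Rpower x th by apply: Rmult_lt_0_compat.
have lL : 0 < INR l / crossover by apply: Rdiv_lt_0_compat.
have e2 : kap * Rpower x th * / (INR l / crossover) = x / INR l.
  have ex : Rpower x th * Rpower x (1 - th) = x.
    by rewrite -Rpower_plus (_ : th + (1 - th) = 1) ?Rpower_1 //; ring.
  rewrite -[X in _ = X / _]ex /crossover; field; have := Rpower_pos x (1 - th); repeat split; lra.
have c2 : INR l * k <= x <-> k <= kap * Rpower x th * / (INR l / crossover).
  rewrite e2; split => h1.
    apply: (Rmult_le_reg_l (INR l)) => //; have -> : INR l * (x / INR l) = x by field; lra.
    done.
  have := Rmult_le_compat_l (INR l) _ _ ltac:(lra) h1.
  by have -> : INR l * (x / INR l) = x by field; lra.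
have c1 : k <= kap * Rpower (INR l * k) th <-> k <= kap * Rpower x th * Rpower (INR l / crossover) a.
  have y1 : 0 < kap * Rpower (INR l * k) th by apply: Rmult_lt_0_compat => //; exact: Rpower_pos.
  have y2 : 0 < kap * Rpower x th * Rpower (INR l / crossover) a by apply: Rmult_lt_0_compat => //; exact: Rpower_pos.
  rewrite (ln_le_iff ilog2 y1) (ln_le_iff ilog2 y2).
  have lR u v : ln (Rpower u v) = v * ln u by rewrite /Rpower ln_exp.
  have ik : 0 < / kap by exact: Rinv_0_lt_compat.
  have l1 : ln (kap * Rpower (INR l * k) th) = ln kap + th * (ln (INR l) + ln k).
    by rewrite ln_mult ?lR ?ln_mult //; exact: Rpower_pos.
  have l3 : ln (INR l / crossover) = ln (INR l) + - ((1 - th) * ln x + - ln kap).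
    rewrite /Rdiv ln_mult //; last exact: Rinv_0_lt_compat.
    rewrite ln_Rinv // /crossover /Rdiv ln_mult //; last exact: Rpower_pos.
    by rewrite lR ln_Rinv.
  have l2 : ln (kap * Rpower x th * Rpower (INR l / crossover) a) =
      ln kap + th * ln x + a * (ln (INR l) + - ((1 - th) * ln x + - ln kap)).
    by rewrite ln_mult ?lR ?l3 ?ln_mult ?lR //; exact: Rpower_pos.
  rewrite l1 l2.
  set lk := ln kap; set X := ln x; set ll := ln (INR l); set lK := ln k.
  have ea : a * (1 - th) = th by rewrite /a; field; lra.
  have i0 : 0 < 1 - th by lra.
  have e : (lk + th * X + a * (ll + - ((1 - th) * X + - lk))) * (1 - th) = lk + th * ll.
    have -> : (lk + th * X + a * (ll + - ((1 - th) * X + - lk))) * (1 - th) =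
       (lk + th * X) * (1 - th) + (a * (1 - th)) * (ll + - ((1 - th) * X + - lk)) by ring.
    by rewrite ea; ring.
  split => h1.
    apply: (Rmult_le_reg_r (1 - th)) => //; rewrite e; lra.
  have := Rmult_le_compat_r (1 - th) _ _ ltac:(lra) h1; rewrite e; lra.
rewrite c1 c2 /Yl; split.
  move=> [h1 h2]; by rewrite /hat /Rmin; case: Rle_dec.
move=> h1; split; apply: (Rle_trans _ _ _ h1); apply: Rmult_le_compat_l; try lra.
  exact: hat_le_inv.
exact: hat_le_pow.
Qed.

Lemma count_kappa_sum : INR (count_kappa th kap x) =
  \sum_(1 <= l < (nfloor x).+1) sifted_card (sieve_mod l) (primes_to (nfloor x)) (nfloor (Yl l / INR (rad l))).
Proof.
have x0 : 0 <= x by lra.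
set N := nfloor x; rewrite /count_kappa -/N count_by_fiber; apply: eq_big_nat => l /andP[l0 lN].
have hl : (0 < l <= N)%N by rewrite l0.
rewrite count_fiber // /sifted_card; congr INR.
have r0 := rad_gt0 l; have rp := INR_pos r0; have lp := INR_pos l0.
have Y0 := Yl_gt0 l0.
set M := nfloor _.
have Yr0 : 0 < Yl l / INR (rad l) by apply: Rdiv_lt_0_compat.
have spec q : (0 < q)%N -> (INR (l * rad l * q) <= x /\ INR (rad l * q) <= kap * Rpower (INR (l * rad l * q)) th)
   <-> (q <= M)%N.
  move=> q0; rewrite leq_nfloor; last lra.
  have ilog2 : 0 < INR (rad l * q) by apply: INR_pos; rewrite muln_gt0 r0.
  rewrite -mulnA mult_INR Yl_spec // mult_INR.
  have e : INR (rad l) * (Yl l / INR (rad l)) = Yl l by field; lra.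
  split => h1; last by rewrite -e; apply: Rmult_le_compat_l; lra.
  by apply: (Rmult_le_reg_l (INR (rad l))) => //; rewrite e.
have MN : (M <= N)%N.
  case: (posnP M) => [->|M0] //.
  have [h1 _] := proj2 (spec M M0) (leqnn M).
  rewrite /N leq_nfloor //; apply: Rle_trans h1; apply: INR_le.
  by rewrite leq_pmull // muln_gt0 l0.
have eN : iota 1 N = iota 1 M ++ iota M.+1 (N - M) by rewrite -{1}(subnKC MN) iotaD add1n.
rewrite eN count_cat.
rewrite [X in (_ + X)%N](_ : _ = 0%N); last first.
  apply/eqP; rewrite -leqn0 leqNgt -has_count; apply/hasPn => q; rewrite mem_iota addSn subnKC // => /andP[q1 q2].
  apply/negP => /and3P[sq nN /RlebP Cq].
  have q0 : (0 < q)%N by exact: leq_ltn_trans q1.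
  have qN : (0 < q <= N)%N by rewrite q0 -ltnS.
  rewrite (rad_mul_sifted hl qN sq) in Cq.
  have := proj1 (spec q q0) (conj (proj1 (leq_nfloor _ x0) nN) Cq).
  by move/(leq_trans q1); rewrite ltnn.
rewrite addn0; apply: eq_in_count => q; rewrite mem_iota add1n ltnS => /andP[q0 qM].
have qN : (0 < q <= N)%N by rewrite q0 (leq_trans qM).
case: (boolP (sifted _ _ q)) => //= sq.
have [h1 h2] := proj2 (spec q q0) qM.
rewrite (proj2 (leq_nfloor _ x0) h1) /= (rad_mul_sifted hl qN sq).
exact/RlebP.
Qed.
End Main.

(** * The error terms *)

Definition irad_sum (M : nat) : R := \sum_(1 <= l < M.+1) / INR (rad l).

Lemma harmonic M : \sum_(1 <= q < M.+1) / INR q <= 1 + ln (INR M).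
Proof.
case: M => [|M]; first by rewrite big_geq //; have := ln_INR_ge0 0; lra.
elim: M => [|M IH]; first by rewrite big_nat1 /= ln_1; lra.
rewrite rsum_recr //.
set x := INR M.+1 in IH; have x1 : 1 <= x by exact: INR_ge1.
have -> : INR M.+2 = x + 1 by rewrite S_INR.
suff : / (x + 1) <= ln (x + 1) - ln x by lra.
have -> : ln (x + 1) - ln x = - ln (x / (x + 1)).
  by rewrite /Rdiv ln_mult ?ln_Rinv; [ring | lra | lra | apply: Rinv_0_lt_compat; lra].
have x0 : 0 < x / (x + 1) by apply: Rdiv_lt_0_compat; lra.
have h1 : x / (x + 1) <= exp (- / (x + 1)).
  have := exp_ineq1_le (- / (x + 1)); have -> : x / (x + 1) = 1 + - / (x + 1) by field; lra.
  lra.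
have := ln_le x0 h1; rewrite ln_exp; lra.
Qed.

(** The [i]-th element of an increasing list above [m] is at least [m + i], and the product of
    [1 + 1 / (m + i)] telescopes. *)
Lemma sorted_prod_bound m (s : seq nat) : sorted ltn s -> all (fun p => m < p)%N s ->
  0 <= \prod_(p <- s) (1 + / INR p) <= (INR m + 1 + INR (size s)) / (INR m + 1).
Proof.
elim: s m => [|p s IH] m; first by rewrite big_nil /=; have := pos_INR m => ? _ _; split; [lra | apply: Req_le; field; lra].
rewrite [sorted _ _]/= => ps /andP[mp _].
have hs : all (fun q => m.+1 < q)%N s.
  apply/allP => q qs; have /allP h1 := order_path_min ltn_trans ps.
  by apply: leq_ltn_trans (h1 q qs).
have [IH0 {}IH] := IH m.+1 (path_sorted ps) hs.
rewrite big_cons [size _]/= S_INR; rewrite S_INR in IH.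
have m0 := pos_INR m; have n0 := pos_INR (size s).
have pr := INR_le mp; rewrite S_INR in pr.
have ip : / INR p <= / (INR m + 1) by apply: Rinv_le_contravar; lra.
have ip0 : 0 < / INR p by apply: Rinv_0_lt_compat; lra.
split; first by apply: Rmult_le_pos; lra.
apply: (Rle_trans _ ((1 + / (INR m + 1)) * ((INR m + 1 + 1 + INR (size s)) / (INR m + 1 + 1)))); last by apply: Req_le; field; lra.
by apply: Rmult_le_compat; lra.
Qed.

Lemma size_primes_lt l n : (0 < l)%N -> (l < 2 ^ n)%N -> (size (primes l) <= n)%N.
Proof.
move=> l0 ln; have h1 : (2 ^ size (primes l) <= rad l)%N.
  rewrite /rad; have : all (fun p => 1 < p)%N (primes l).
    by apply/allP => p; rewrite mem_primes => /andP[/prime_gt1].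
  elim: (primes l) => [|p s IH]; first by rewrite big_nil.
  by move=> /andP[p1 hs]; rewrite big_cons [size _]/= expnS leq_mul // IH.
have h2 := leq_trans h1 (dvdn_leq l0 (rad_dvd l0)).
by rewrite ltnW // -(@ltn_exp2l 2) // (leq_ltn_trans h2).
Qed.

Lemma psi_rad l : INR (psi l) = INR (rad l) * \prod_(p <- primes l) (1 + / INR p).
Proof.
rewrite /psi /rad !INR_prod -rprod_mul big_seq [RHS]big_seq; apply: eq_bigr => p.
rewrite mem_primes => /andP[/INR_prime_ge2 p2 _]; rewrite S_INR; field; lra.
Qed.

(** The quotient [psi l / rad l] is at most 1 plus the number of primes of [l], and there are at
    most [n] of them. *)
Lemma inv_rad_le l n : (0 < l)%N -> (l < 2 ^ n)%N -> / INR (rad l) <= (1 + INR n) * ipsi l.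
Proof.
move=> l0 ln; have r0 := INR_pos (rad_gt0 l); have p0 := INR_pos (psi_gt0 l).
rewrite /ipsi.
apply: (Rmult_le_reg_r (INR (psi l) * INR (rad l))); first by apply: Rmult_lt_0_compat.
have -> : / INR (rad l) * (INR (psi l) * INR (rad l)) = INR (psi l) by field; lra.
have -> : (1 + INR n) * / INR (psi l) * (INR (psi l) * INR (rad l)) = INR (rad l) * (1 + INR n) by field; lra.
rewrite psi_rad; apply: Rmult_le_compat_l; first lra.
have : \prod_(p <- primes l) (1 + / INR p) <= 1 + INR (size (primes l)).
  have := @sorted_prod_bound 1 _ (sorted_primes l).
  have -> : all (fun p => 1 < p)%N (primes l).
    by apply/allP => p; rewrite mem_primes => /andP[/prime_gt1].
  move=> /(_ isT) [_]; rewrite [INR 1]/=; have := pos_INR (size (primes l)); lra.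
have := INR_le (size_primes_lt l0 ln); lra.
Qed.

Lemma irad_sum_le M n : (M < 2 ^ n)%N -> irad_sum M <= (1 + INR n) * psum 1 M.
Proof.
move=> hM; rewrite /irad_sum /psum -rsum_mulr [X in _ <= X](eq_bigl xpredT); last by move=> l; rewrite coprimen1.
apply: rsum_le_nat => l /andP[l0 lM] _; apply: inv_rad_le => //.
exact: leq_ltn_trans hM.
Qed.

Lemma irad_sum_mono m n : (m <= n)%N -> irad_sum m <= irad_sum n.
Proof.
move=> mn; apply: rsum_sub_range => // l _.
by left; apply: Rinv_0_lt_compat; apply: INR_pos; exact: rad_gt0.
Qed.

(* Write [l = m * rad m * q]; then [rad l > r] forces [m <= M / r]. *)
Lemma sum_large_rad M (r : R) : 0 < r ->
  \sum_(1 <= l < M.+1 | ~~ Rleb (INR (rad l)) r) / INR (rad l) <=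
  (1 + ln (INR M)) * irad_sum (nfloor (INR M / r)).
Proof.
move=> r0; rewrite sum_by_fiber.
set K := nfloor _.
have Mr0 : 0 <= INR M / r by apply: Rmult_le_pos; [exact: pos_INR | left; exact: Rinv_0_lt_compat].
have hln : 0 <= 1 + ln (INR M) by have := ln_INR_ge0 M; lra.
apply: (Rle_trans _ (\sum_(1 <= l < M.+1 | (l <= K)%N) / INR (rad l) * (1 + ln (INR M)))).
  rewrite [X in _ <= X]big_mkcond /=; apply: rsum_le_nat => m /andP[m0 mM] _.
  have rm0 := rad_gt0 m; have rmp := INR_pos rm0.
  have hm : (0 < m <= M)%N by rewrite m0.
  set C := fun l => ~~ Rleb (INR (rad l)) r.
  rewrite -[X in X <= _]big_filter.
  have -> : [seq i <- index_iota 1 M.+1 | (i %/ rad i == m)%N && ~~ Rleb (INR (rad i)) r] =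
     [seq i <- iota 1 M | (i %/ rad i == m)%N && C i] by rewrite /index_iota subSS subn0.
  rewrite (perm_big _ (perm_fiber C hm)) /= big_map big_filter.
  apply: (Rle_trans _ (\sum_(q <- iota 1 M | (m <= K)%N) / INR (rad m) * / INR q)).
    apply: (Rle_trans _ (\sum_(q <- iota 1 M | [&& sifted (sieve_mod m) (primes_to M) q, (m * rad m * q <= M)%N & C (m * rad m * q)%N])
       (if (m <= K)%N then / INR (rad m) * / INR q else 0))); last first.
      rewrite [X in _ <= X]big_mkcond /=; apply: rsum_le_pred => // q; rewrite mem_iota => /andP[q0 _] _.
      case: ifP => _; last lra.
      by apply: Rmult_le_pos; left; apply: Rinv_0_lt_compat => //; exact: INR_pos.
    apply: rsum_le_seq => q; rewrite mem_iota add1n ltnS => hq /and3P[sq nM].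
    rewrite /C (rad_mul_sifted hm hq sq) => /RlebP cq.
    case/andP: (hq) => q0 _; have qp := INR_pos q0.
    have -> : (m <= K)%N.
      rewrite leq_nfloor //.
      have := INR_le nM; rewrite -mulnA mult_INR => h1.
      apply: (Rmult_le_reg_r r) => //; have -> : INR M / r * r = INR M by field; lra.
      apply: Rle_trans h1; apply: Rmult_le_compat_l; first exact: pos_INR.
      by apply: Rlt_le; apply: Rnot_le_lt.
    by rewrite mult_INR Rinv_mult; lra.
  case: (m <= K)%N; last by rewrite big_pred0_eq; lra.
  rewrite rsum_mulr; apply: Rmult_le_compat_l; first by left; exact: Rinv_0_lt_compat.
  by have := harmonic M; rewrite /index_iota subSS subn0.
rewrite rsum_mull Rmult_comm; apply: Rmult_le_compat_l => //.
rewrite /irad_sum; case: (leqP K M) => KM.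
  have h1 : (K.+1 <= M.+1)%N by [].
  by rewrite [X in _ <= X](big_nat_widen _ _ _ _ _ h1) /=; apply: Req_le; apply: eq_bigl => l; rewrite ltnS.
apply: (Rle_trans _ (\sum_(1 <= l < M.+1) / INR (rad l))).
  apply: rsum_le_pred => // l _ _; left; apply: Rinv_0_lt_compat; apply: INR_pos; exact: rad_gt0.
by apply: irad_sum_mono; exact: ltnW.
Qed.

Lemma psi_le_rad2 l : INR (psi l) <= INR (rad l) * INR (rad l).
Proof.
rewrite -mult_INR multE; apply: INR_le; rewrite /psi /rad.
have : all (fun p => 1 < p)%N (primes l).
  by apply/allP => p; rewrite mem_primes => /andP[/prime_gt1].
elim: (primes l) => [|p s IH]; first by rewrite !big_nil.
move=> /andP[p1 hs]; rewrite !big_cons mulnACA; apply: leq_mul; last exact: IH.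
by apply: (@leq_trans (p * 2)); [lia | rewrite leq_mul2l p1 orbT].
Qed.

Lemma ipsi_le_inv_rad l : ipsi l <= / INR (rad l).
Proof.
apply: Rinv_le_contravar; first exact/INR_pos/rad_gt0.
rewrite psi_rad -{1}(Rmult_1_r (INR (rad l))); apply: Rmult_le_compat_l; first exact: pos_INR.
apply: (@Rle_trans _ (\prod_(p <- primes l) 1)); first by rewrite big1_eq; lra.
apply: (proj2 (rprod_le _ _)) => p _; split; first lra.
have : 0 <= / INR p; last lra.
case: p => [|p]; first by rewrite Rinv_0; lra.
by left; apply: Rinv_0_lt_compat; exact: INR_pos.
Qed.

Section Raw.
Variables (th kap x R0 : R).
Hypotheses (hth : 0 < th < 1) (kap0 : 0 < kap) (x1 : 1 <= x) (R1 : 1 <= R0).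
Let a := th / (1 - th).
Let L := crossover th kap x.
Let N := nfloor x.
Let X0 := kap * Rpower x th.

(** The sieve is applied only when [rad l <= R0]; otherwise its error, which contains [rad l], is
    replaced by a trivial bound. Those [l] are cut at [L * sqrt R0]: below, [sum_large_rad] reduces
    the sum to one up to [L / sqrt R0], and above, [hat] is at most [1 / sqrt R0]. *)
Lemma count_kappa_raw : Rabs (INR (count_kappa th kap x) - sieve_const N * X0 * hsum a N 1 L) <=
  exp 2 * R0 ^ 3 * Rpower X0 (3 / 4) * psum 1 N +
  X0 * ((1 + ln (INR N)) * irad_sum (nfloor (L / sqrt R0)) + / sqrt R0 * irad_sum N).
Proof.
have a0 : 0 < a by apply: Rdiv_lt_0_compat; lra.
have L0 : 0 < L by exact: crossover_gt0.
have X00 : 0 < X0 by apply: Rmult_lt_0_compat => //; exact: Rpower_pos.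
have s1 : 1 <= sqrt R0 by rewrite -sqrt_1; apply: sqrt_le_1; lra.
have is0 : 0 < / sqrt R0 by apply: Rinv_0_lt_compat; lra.
have [c1 c2] := sieve_const_bounds N.
rewrite (count_kappa_sum hth kap0 x1) -/N /hsum /pwsum -rsum_mulr.
rewrite [X in Rabs (_ - X)](eq_bigl xpredT); last by move=> l; rewrite coprimen1.
rewrite -rsum_sub; apply: (Rle_trans _ _ _ (rsum_abs _ _ _)).
pose err l := Rabs (sifted_card (sieve_mod l) (primes_to N) (nfloor (Yl th kap x l / INR (rad l))) -
   sieve_const N * X0 * (ipsi l * hat a (INR l / L))).
rewrite (eq_bigr err) //.
have w0 l : (0 < l)%N -> 0 < hat a (INR l / L).
  by move=> l0; apply: hat_gt0; apply: Rdiv_lt_0_compat => //; exact: INR_pos.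
have e1 l : (0 < l <= N)%N -> INR (rad l) <= R0 -> err l <= exp 2 * R0 ^ 3 * Rpower X0 (3 / 4) * ipsi l.
  move=> /andP[l0 lN] rR; have r1 := INR_ge1 (rad_gt0 l).
  have Y0 := @Yl_gt0 th kap x kap0 l l0.
  have yr : 0 < Yl th kap x l / INR (rad l) by apply: Rdiv_lt_0_compat; lra.
  have := @sieve_main N l _ ltac:(by rewrite l0) yr.
  have -> : sieve_const N * (INR (rad l) * ipsi l) * (Yl th kap x l / INR (rad l)) = sieve_const N * X0 * (ipsi l * hat a (INR l / L)).
    by rewrite /Yl -/X0 -/a -/L; field; lra.
  move=> h1; apply: (Rle_trans _ _ _ h1).
  have yX : Yl th kap x l / INR (rad l) <= X0.
    apply: (Rle_trans _ (Yl th kap x l)).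
      rewrite -[X in _ <= X]Rmult_1_r; apply: Rmult_le_compat_l; first lra.
      by rewrite -Rinv_1; apply: Rinv_le_contravar; lra.
    rewrite -[X in _ <= X]Rmult_1_r /Yl; apply: Rmult_le_compat_l; first exact: Rlt_le.
    by apply: hat_le1 => //; apply: Rdiv_lt_0_compat; [exact: INR_pos | exact: L0].
  have p34 : Rpower (Yl th kap x l / INR (rad l)) (3 / 4) <= Rpower X0 (3 / 4).
    by apply: Rpower_mono => //; lra.
  (* This replaces the number of [l] by [psum], at the price of [R0 ^ 2]. *)
  have hp : 1 <= R0 * R0 * ipsi l.
    have p0 := INR_pos (psi_gt0 l).
    have := psi_le_rad2 l => hpr.
    apply: (Rmult_le_reg_r (INR (psi l))) => //; rewrite /ipsi.
    have -> : R0 * R0 * / INR (psi l) * INR (psi l) = R0 * R0 by field; lra.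
    nra.
  have q0 := Rpower_pos X0 (3 / 4); have e20 := exp_pos 2.
  apply: (Rle_trans _ (exp 2 * R0 * Rpower X0 (3 / 4) * 1)).
    rewrite Rmult_1_r; apply: Rmult_le_compat => //; [nra | exact/Rlt_le/Rpower_pos | by apply: Rmult_le_compat_l; lra].
  have -> : exp 2 * R0 ^ 3 * Rpower X0 (3 / 4) * ipsi l = exp 2 * R0 * Rpower X0 (3 / 4) * (R0 * R0 * ipsi l) by ring.
  apply: Rmult_le_compat_l => //.
  by apply: Rmult_le_pos; [nra | lra].
have e2 l : (0 < l)%N -> err l <= X0 * (hat a (INR l / L) * / INR (rad l)).
  move=> l0; have r1 := INR_ge1 (rad_gt0 l).
  have Y0 := @Yl_gt0 th kap x kap0 l l0.
  have eY : Yl th kap x l / INR (rad l) = X0 * (hat a (INR l / L) * / INR (rad l)).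
    by rewrite /Yl -/X0 -/a -/L /Rdiv; ring.
  have yr : 0 < Yl th kap x l / INR (rad l) by apply: Rdiv_lt_0_compat; lra.
  have [f1 _] := @nfloor_spec (Yl th kap x l / INR (rad l)) ltac:(lra).
  have cu : sifted_card (sieve_mod l) (primes_to N) (nfloor (Yl th kap x l / INR (rad l))) <= Yl th kap x l / INR (rad l).
    apply: Rle_trans f1; rewrite /sifted_card; apply: INR_le.
    by apply: (leq_trans (count_size _ _)); rewrite size_iota.
  have cl : 0 <= sifted_card (sieve_mod l) (primes_to N) (nfloor (Yl th kap x l / INR (rad l))) by exact: pos_INR.
  have ww := w0 l l0; have hh := ipsi_le_inv_rad l; have h0 := ipsi_gt0 l.
  have mu : sieve_const N * X0 * (ipsi l * hat a (INR l / L)) <= X0 * (hat a (INR l / L) * / INR (rad l)).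
    have : ipsi l * hat a (INR l / L) <= hat a (INR l / L) * / INR (rad l) by nra.
    have : 0 < ipsi l * hat a (INR l / L) by exact: Rmult_lt_0_compat.
    move=> z1 z2; have : sieve_const N * (ipsi l * hat a (INR l / L)) <= hat a (INR l / L) * / INR (rad l) by nra.
    move=> z3; have := Rmult_le_compat_l X0 _ _ ltac:(lra) z3; lra.
  have ml : 0 <= sieve_const N * X0 * (ipsi l * hat a (INR l / L)).
    by apply: Rmult_le_pos; [nra | exact/Rlt_le/Rmult_lt_0_compat].
  rewrite /err -eY; rewrite -eY in mu; apply: Rabs_le; split; lra.
rewrite (bigID (fun l => Rleb (INR (rad l)) R0)) /=; apply: Rplus_le_compat.
  rewrite /psum -rsum_mulr [X in _ <= X](eq_bigl xpredT); last by move=> l; rewrite coprimen1.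
  apply: (Rle_trans _ (\sum_(1 <= l < N.+1 | Rleb (INR (rad l)) R0) exp 2 * R0 ^ 3 * Rpower X0 (3 / 4) * ipsi l)).
    by apply: rsum_le_nat => l hl /RlebP rl; apply: e1.
  apply: rsum_le_pred => // l _ _.
  have q0 := Rpower_pos X0 (3 / 4); have e20 := exp_pos 2.
  do 2 (apply: Rmult_le_pos; last by [exact: ipsi_ge0 | lra]).
  by apply: Rmult_le_pos; [lra | apply: pow_le; lra].
apply: (Rle_trans _ (\sum_(1 <= l < N.+1 | ~~ Rleb (INR (rad l)) R0) (X0 * (hat a (INR l / L) * / INR (rad l))))).
  by apply: rsum_le_nat => l /andP[l0 _] _; apply: e2.
rewrite rsum_mulr; apply: Rmult_le_compat_l; first lra.
set M1 := nfloor (L * sqrt R0).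
have Ls0 : 0 <= L * sqrt R0 by nra.
set M2 := minn N M1.
apply: (Rle_trans _ (\sum_(1 <= l < N.+1 | ~~ Rleb (INR (rad l)) R0)
   ((if (l < M2.+1)%N then / INR (rad l) else 0) + / sqrt R0 * / INR (rad l)))).
  apply: rsum_le_nat => l /andP[l0 lN] _.
  have ir : 0 < / INR (rad l) by apply: Rinv_0_lt_compat; apply: INR_pos; exact: rad_gt0.
  have lp := INR_pos l0; have ww := w0 l l0.
  have wl1 : hat a (INR l / L) <= 1 by apply: hat_le1 => //; apply: Rdiv_lt_0_compat.
  case: ifP => lM; first by have : 0 < / sqrt R0 * / INR (rad l) by [exact: Rmult_lt_0_compat]; nra.
  have lL : L * sqrt R0 < INR l.
    apply: Rnot_le_lt => hle; move/negP: lM; apply; rewrite ltnS /M2 leq_min -ltnS lN /=.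
    by rewrite /M1 leq_nfloor.
  rewrite Rplus_0_l; apply: Rmult_le_compat_r; first lra.
  apply: (Rle_trans _ _ _ (hat_le_inv _ _)).
  have -> : / (INR l / L) = L / INR l by field; lra.
  apply: (Rmult_le_reg_r (INR l * sqrt R0)); first nra.
  have -> : L / INR l * (INR l * sqrt R0) = L * sqrt R0 by field; lra.
  have -> : / sqrt R0 * (INR l * sqrt R0) = INR l by field; lra.
  lra.
rewrite big_split /= rsum_mulr; apply: Rplus_le_compat.
  rewrite -big_mkcondr /=.
  have h1 : (M2.+1 <= N.+1)%N by rewrite ltnS geq_minl.
  rewrite -(big_nat_widen _ _ _ _ _ h1).
  apply: (Rle_trans _ _ _ (sum_large_rad M2 _)); first lra.
  have M2N : (M2 <= N)%N by exact: geq_minl.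
  have hlnN := ln_INR_ge0 N.
  have hlnM : ln (INR M2) <= ln (INR N).
    case: (posnP M2) => [e|M20]; last by apply: ln_le; [exact: INR_pos | exact: INR_le].
    rewrite e; have -> : ln (INR 0) = 0; last lra.
    by rewrite /ln; case: (Rlt_dec 0 (INR 0)) => // h2; exfalso; move: h2; rewrite /=; lra.
  have G0 m : 0 <= irad_sum m.
    by apply: rsum_ge0 => l _; left; apply: Rinv_0_lt_compat; apply: INR_pos; exact: rad_gt0.
  apply: Rmult_le_compat => //; [by have := ln_INR_ge0 M2; lra | lra |].
  apply: irad_sum_mono; apply: nfloor_mono; first by apply: Rmult_le_pos; [exact: pos_INR | left; apply: Rinv_0_lt_compat; lra].
  have m1 : INR M2 <= L * sqrt R0.
    have [f1 _] := nfloor_spec Ls0; apply: Rle_trans f1; apply: INR_le; exact: geq_minr.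
  have ss : sqrt R0 * sqrt R0 = R0 by apply: sqrt_sqrt; lra.
  apply: (Rmult_le_reg_r R0); first lra.
  have -> : INR M2 / R0 * R0 = INR M2 by field; lra.
  have -> : L / sqrt R0 * R0 = L * sqrt R0 by rewrite -{2}ss; field; lra.
  lra.
apply: Rmult_le_compat_l; first lra.
apply: rsum_le_pred => // l _ _.
by left; apply: Rinv_0_lt_compat; apply: INR_pos; exact: rad_gt0.
Qed.
End Raw.

Lemma k2_le_rt A : exists k0, (0 < k0)%N /\ forall k, (k0 <= k)%N -> A * INR k ^ 2 <= rt k.
Proof.
have [k0 [k00 hk]] := cube_beats (A ^ 2).
exists k0; split => // k kk; have := hk k kk.
have k1 : (0 < k)%N := leq_trans k00 kk.
have kr := INR_ge1 k1.
move=> h1; apply: Rsqr_incr_0_var; last exact/Rlt_le/rt_gt0.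
rewrite /Rsqr rt_sq.
have -> : A * INR k ^ 2 * (A * INR k ^ 2) = INR k * (A ^ 2 * INR k ^ 3) by ring.
by apply: Rmult_le_compat_l; lra.
Qed.

Lemma t3_le_exp A e : 0 < A -> 0 < e -> exists k0, (0 < k0)%N /\ forall k, (k0 <= k)%N ->
  A * INR (2 ^ k)%N ^ 3 <= exp (e * INR (2 ^ k)%N).
Proof.
move=> A0 e0; have [k0 [k00 hk]] := @t_le_exp (1 + A) (e / 3) ltac:(lra).
exists k0; split => // k kk; have := hk k kk; have := exp2_gt0 k; set t := INR _ => t0 h1.
have -> : exp (e * t) = exp (e / 3 * t) ^ 3 by rewrite exp_pow; congr exp; rewrite /=; field.
apply: (Rle_trans _ (((1 + A) * t) ^ 3)); last by apply: pow_incr; split => //; nra.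
rewrite Rpow_mult_distr; apply: Rmult_le_compat_r; first by apply: pow_le; lra.
have : 1 + 3 * A <= (1 + A) ^ 3 by rewrite /=; nra.
lra.
Qed.

(* [psum] grows faster than any power of [2 ^ k] between [L / R0] and [L]. *)
Lemma psum_far c (cr : R) : 0 < c -> 0 < cr -> exists k0, (12 <= k0)%N /\ forall k L R0, (k0 <= k)%N ->
  exp (c * INR (2 ^ k)%N) <= L -> (nfloor L < 2 ^ 2 ^ k)%N -> exp (cr * INR (2 ^ k)%N) <= R0 ->
  psum 1 (nfloor (L / R0)) <= / (12 * INR (2 ^ k)%N ^ 3) * psum (1 * 2) (nfloor L).
Proof.
move=> c0 cr0.
set s := sqrt (2 * 40960); have s0 : 0 < s by apply: sqrt_lt_R0; lra.
have [k1 [k10 hk1]] := k2_le_rt (2 * s / cr * 6).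
have [k2 [k20 hk2]] := t_large (2 / c).
have [k3 [k30 hk3]] := t_large (12 * 40960).
have [k4 [k40 hk4]] := t_large (2 / cr).
exists (maxn 12 (maxn k1 (maxn k2 (maxn k3 k4)))); split; first by rewrite leq_max.
move=> k L R0; rewrite !geq_max => /and5P[k12 kk1 kk2 kk3 kk4] hL hN hR.
have {}hk1 := hk1 k kk1; have {}hk2 := hk2 k kk2; have {}hk3 := hk3 k kk3; have {}hk4 := hk4 k kk4.
have k0 : (0 < k)%N by apply: leq_trans k12.
set t := INR (2 ^ k)%N in hL hR hk2 hk3 hk4 *; have t0 : 0 < t := exp2_gt0 k.
have kr := INR_ge1 k0; have r0 := rt_gt0 k0; have rs := rt_sq k; rewrite -/t in rs.
have c2 : 2 <= c * t.
  have := Rmult_le_compat_l c _ _ ltac:(lra) hk2.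
  by rewrite (_ : c * (2 / c) = 2); [lra | field; lra].
have ct2 : 2 <= cr * t.
  have := Rmult_le_compat_l cr _ _ ltac:(lra) hk4.
  by rewrite (_ : cr * (2 / cr) = 2); [lra | field; lra].
have [L1 _] := @floor_range c k L c2 hL.
set Ms := nfloor L in hN *.
have [i1 i2] := @nfloor_spec (cr * t) ltac:(lra).
set i := nfloor (cr * t) in i1 i2.
have hi : cr * t / 2 <= INR i by lra.
have R0p : 0 < R0 by have := exp_pos (cr * t); lra.
have iR : INR (2 ^ i)%N <= R0.
  rewrite exp2_exp; apply: Rle_trans hR; apply: exp_le.
  have := ln2_lt1; have := ln2_gt; have := pos_INR i; nra.
have fl : (nfloor (L / R0) <= Ms %/ 2 ^ i)%N.
  rewrite /Ms -nfloor_div ?expn_gt0 //; last lra.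
  apply: nfloor_mono; first by apply: Rmult_le_pos; [lra | left; exact: Rinv_0_lt_compat].
  apply: Rmult_le_compat_l; first lra; apply: Rinv_le_contravar => //; exact: exp2_gt0.
set F := psum (1 * 2).
have mF : mono F by exact: psum_mono. have F0 : F 0%N = 0 by exact: psum0.
set K := 40960 * (INR k * t).
have K1 : 1 <= 2 * K.
  have : 1 <= t by apply: INR_ge1; rewrite expn_gt0.
  rewrite /K; nra.
have ad : avoid k (1 * 2) by apply: avoid_mul; [exact: avoid_1 | exact: (@leq_pexp2l 2 1 k isT k0)].
have hB m : (m <= Ms)%N -> gsum2 F m <= K * F m.
  by move=> mM; apply: second_order => //; exact: leq_ltn_trans mM hN.
have gr := @gsum2_growth F K Ms mF F0 ltac:(lra) hB Ms i (leqnn _) K1.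
have esK : sqrt (2 * K) = s * rt k.
  rewrite /s /rt -sqrt_mult; [congr sqrt; rewrite -/t /K; lra | lra | rewrite -/t; nra].
rewrite esK in gr.
have sr : 0 < s * rt k by exact: Rmult_lt_0_compat.
have s1 : 1 <= s * rt k by rewrite -esK -sqrt_1; apply: sqrt_le_1; lra.
set u := / (s * rt k) in gr.
have u0 : 0 < u by exact: Rinv_0_lt_compat.
have u1 : u <= 1 by rewrite -Rinv_1; apply: Rinv_le_contravar; lra.
have pu : (1 - u) ^ i <= exp (- (INR i * u)).
  have -> : - (INR i * u) = INR i * (- u) by ring.
  rewrite -exp_pow; apply: pow_incr; split; first lra.
  by have := exp_ineq1_le (- u); lra.
have FM0 : 0 <= F Ms by exact: psum_ge0.
have BM0 : 0 <= gsum2 F Ms by apply: gsum_ge0 => m; apply: gsum_ge0; exact: psum_ge0.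
have st1 : psum 1 (nfloor (L / R0)) <= exp (- (INR i * u)) * (K * F Ms).
  apply: (Rle_trans _ _ _ (psum_mono 1 fl)).
  apply: (Rle_trans _ _ _ (psum_le_T _ (isT : prime 2) (isT : ~~ (2 %| 1)%N))).
  apply: (Rle_trans _ _ _ (gsum_ge _ (isT : (1 < 2)%N) (gsum_mono (isT : (1 < 2)%N) mF F0) (gsum0 _ _))).
  apply: (Rle_trans _ _ _ gr).
  apply: Rmult_le_compat => //; first by apply: pow_le; lra.
  exact: hB.
apply: (Rle_trans _ _ _ st1); rewrite -Rmult_assoc; apply: Rmult_le_compat_r => //.
(* [i * u] is of order [2 ^ k / rt k = sqrt (2 ^ k / k)]. Exceeding [6 k] it saves [t ^ 6]: [t ^ 3]
   for the claim, two powers for [K], and one for the constants. *)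
have iu : 6 * INR k <= INR i * u.
  apply: (Rle_trans _ (cr * t / 2 * u)); last by apply: Rmult_le_compat_r; lra.
  apply: (Rmult_le_reg_r (s * rt k)) => //.
  have -> : cr * t / 2 * u * (s * rt k) = cr * t / 2 by rewrite /u; field; lra.
  have h1 : INR k * rt k <= cr * t / (12 * s).
    have h2 := Rmult_le_compat_r (rt k) _ _ ltac:(lra) hk1.
    rewrite rs in h2.
    have h3 : 2 * s / cr * 6 * (INR k * rt k) <= t.
      apply: (Rmult_le_reg_l (INR k)); first lra.
      have -> : INR k * (2 * s / cr * 6 * (INR k * rt k)) = 2 * s / cr * 6 * INR k ^ 2 * rt k by rewrite /Rdiv; ring.
      lra.
    have cs : 0 < cr / (12 * s) by apply: Rdiv_lt_0_compat; lra.
    have := Rmult_le_compat_l _ _ _ (Rlt_le _ _ cs) h3.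
    have -> : cr / (12 * s) * (2 * s / cr * 6 * (INR k * rt k)) = INR k * rt k by field; lra.
    by have -> : cr / (12 * s) * t = cr * t / (12 * s) by field; lra.
  have := Rmult_le_compat_l (6 * s) _ _ ltac:(lra) h1.
  have -> : 6 * s * (cr * t / (12 * s)) = cr * t / 2 by field; lra.
  lra.
have te : t ^ 6 <= exp (INR i * u).
  rewrite /t exp2_exp exp_pow; apply: exp_le; rewrite [INR 6]/=; have := ln2_lt1; nra.
have kt : INR k <= t by apply/INR_le/ltnW/ltn_expl.
rewrite exp_Ropp.
have t6 : 0 < t ^ 6 by apply: pow_lt.
apply: (Rle_trans _ (/ t ^ 6 * K)).
  by apply: Rmult_le_compat_r; [lra | apply: Rinv_le_contravar].
apply: (Rmult_le_reg_r (12 * t ^ 6)); first lra.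
have -> : / t ^ 6 * K * (12 * t ^ 6) = 12 * K by field; lra.
have -> : / (12 * t ^ 3) * (12 * t ^ 6) = t ^ 3 by field; lra.
have : 12 * K <= 12 * 40960 * (t * t) by rewrite /K; nra.
have -> : t ^ 3 = t * (t * t) by ring.
nra.
Qed.

Lemma count_kappa_main th c cX : 0 < th < 1 -> 0 < c -> 0 < cX -> exists k0, (12 <= k0)%N /\ forall k kap x,
  (k0 <= k)%N -> 0 < kap -> 1 <= x -> (nfloor x < 2 ^ 2 ^ k.-1)%N ->
  let L := crossover th kap x in let X0 := kap * Rpower x th in
  exp (c * INR (2 ^ k)%N) <= L -> L <= INR (nfloor x) -> exp (cX * INR (2 ^ k)%N) <= X0 ->
  Rabs (INR (count_kappa th kap x) - sieve_const (nfloor x) * X0 * hsum (th / (1 - th)) (nfloor x) 1 L) <=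
  delta k * X0 * psum (1 * 2) (nfloor L).
Proof.
move=> hth c0 cX0.
have [k1 [k112 hk1]] := @psum_far c (cX / 48) c0 ltac:(lra).
have [k2 [k20 hk2]] := @psum_top (c / 2) (cX / 200) ltac:(lra) ltac:(lra).
have [k3 [k30 hk3]] := @t3_le_exp (12 + 3 * exp 2) (cX / 100) ltac:(have := exp_pos 2; lra) ltac:(lra).
have [k4 [k40 hk4]] := t_large (2 / c).
exists (maxn k1 (maxn k2 (maxn k3 k4))); split; first by rewrite leq_max k112.
move=> k kap x; rewrite !geq_max => /and4P[kk1 kk2 kk3 kk4] kap0 x1 hN L X0 hL LN hX.
have {}hk3 := hk3 k kk3; have {}hk4 := hk4 k kk4.
have k0 : (0 < k)%N by exact: leq_trans k20 kk2.
have kr := INR_ge1 k0.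
set N := nfloor x in hN LN *.
have N2 : (N < 2 ^ 2 ^ k)%N by apply: (leq_trans hN); rewrite leq_exp2l // leq_exp2l // leq_pred.
(* Then [R0 ^ 3 * X0 ^ (3 / 4) = X0 ^ (7 / 8)], which keeps a saving [X0 ^ (1 / 8)] in the sieve
   error, and [sqrt R0] is still exponential in [2 ^ k]. *)
set R0 := Rpower X0 (/ 24).
have X00 : 0 < X0 by have := exp_pos (cX * INR (2 ^ k)%N); lra.
have R0e : exp (cX / 24 * INR (2 ^ k)%N) <= R0.
  apply: (Rle_trans _ (Rpower (exp (cX * INR (2 ^ k)%N)) (/ 24))).
    by rewrite /Rpower ln_exp; apply: Req_le; congr exp; field.
  by apply: Rpower_mono; [exact: exp_pos | | lra].
set t := INR (2 ^ k)%N in hL hX R0e hk3 hk4; have t0 : 0 < t := exp2_gt0 k.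
have t1 : 1 <= t by apply: INR_ge1; rewrite expn_gt0.
have R01 : 1 <= R0 by apply: Rle_trans R0e; rewrite -exp_0; apply: exp_le; nra.
have raw := @count_kappa_raw th kap x R0 hth kap0 x1 R01.
apply: (Rle_trans _ _ _ raw); rewrite -/N -/L -/X0.
set Ms := nfloor L; set HM := psum (1 * 2) Ms.
have HM0 : 0 <= HM by exact: psum_ge0.
have c2 : 2 <= c * t.
  have := Rmult_le_compat_l c _ _ ltac:(lra) hk4.
  by rewrite (_ : c * (2 / c) = 2); [lra | field; lra].
have [L1 lMs] := @floor_range c k L c2 hL; rewrite -/t -/Ms in lMs.
have MsN : (Ms <= N)%N by apply: leq_of_INR; have := @nfloor_spec L ltac:(lra); rewrite -/Ms; lra.
have Ms2 : (Ms < 2 ^ 2 ^ k.-1)%N by apply: leq_ltn_trans hN.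
have Ms3 : (Ms < 2 ^ 2 ^ k)%N by apply: leq_ltn_trans N2.
have hHN : psum 1 N <= exp (cX / 200 * t) * (t * HM).
  apply: (Rle_trans _ _ _ (hk2 k 1%N 3%N Ms N kk2 (@avoid_1 k) isT isT isT lMs Ms2 hN)).
  apply: Rmult_le_compat_l; first exact/Rlt_le/exp_pos.
  apply: (Rle_trans _ _ _ (psum_le_T Ms (isT : prime 2) (isT : ~~ (2 %| 1)%N))).
  by apply: gsum_le_log => //; [exact: psum_mono | exact: psum0].
have sR0 : exp (cX / 48 * t) <= sqrt R0.
  have -> : exp (cX / 48 * t) = sqrt (exp (cX / 24 * t)).
    have -> : exp (cX / 24 * t) = exp (cX / 48 * t) * exp (cX / 48 * t) by rewrite -exp_plus; congr exp; field.
    by rewrite sqrt_square //; exact/Rlt_le/exp_pos.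
  by apply: sqrt_le_1 => //; [exact/Rlt_le/exp_pos | lra].
have s0 : 0 < sqrt R0 by have := exp_pos (cX / 48 * t); lra.
have hfar := hk1 k L (sqrt R0) kk1 hL Ms3 sR0; rewrite -/t -/Ms -/HM in hfar.
set far := nfloor (L / sqrt R0) in hfar *.
have farM : (far < 2 ^ 2 ^ k)%N.
  apply: leq_ltn_trans Ms3; apply: nfloor_mono; first by apply: Rmult_le_pos; [lra | left; exact: Rinv_0_lt_compat].
  rewrite -[X in _ <= X]Rmult_1_r; apply: Rmult_le_compat_l; first lra.
  rewrite -Rinv_1; apply: Rinv_le_contravar; first lra.
  by apply: Rle_trans sR0; rewrite -exp_0; apply: exp_le; nra.
have hGf := irad_sum_le farM; have hGN := irad_sum_le N2; rewrite -/t in hGf hGN.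
have lnN : 0 <= ln (INR N) <= t by split; [exact: ln_INR_ge0 | exact: ln_lt_exp2].
have dt : / t <= delta k by apply: Rinv_le_contravar; [exact: rt_gt0 | exact: rt_le_t1].
set e100 := exp (cX / 100 * t) in hk3; have e0 : 0 < e100 by exact: exp_pos.
have E2 := exp_pos 2.
have t3 : 0 < t ^ 3 by apply: pow_lt.
have G0 m : 0 <= irad_sum m.
  by apply: rsum_ge0 => l _; left; apply: Rinv_0_lt_compat; apply: INR_pos; exact: rad_gt0.
have R3 : R0 ^ 3 * Rpower X0 (3 / 4) = X0 * Rpower X0 (- / 8).
  rewrite -Rpower_pow; last lra.
  rewrite /R0 Rpower_mult -Rpower_plus -{2}(Rpower_1 X0) // -Rpower_plus; congr Rpower; rewrite /=; field.
have X8 : Rpower X0 (- / 8) <= exp (- (cX / 8 * t)).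
  rewrite Rpower_Ropp exp_Ropp; apply: Rinv_le_contravar; first exact: exp_pos.
  apply: (Rle_trans _ (Rpower (exp (cX * t)) (/ 8))).
    by rewrite /Rpower ln_exp; apply: Req_le; congr exp; field.
  by apply: Rpower_mono; [exact: exp_pos | | lra].
have T1 : exp 2 * R0 ^ 3 * Rpower X0 (3 / 4) * psum 1 N <= / 3 * (/ t * X0 * HM).
  have -> : exp 2 * R0 ^ 3 * Rpower X0 (3 / 4) * psum 1 N = X0 * (exp 2 * (Rpower X0 (- / 8) * psum 1 N)).
    by rewrite Rmult_assoc (Rmult_assoc (exp 2)) -(Rmult_assoc (R0 ^ 3)) R3; ring.
  have -> : / 3 * (/ t * X0 * HM) = X0 * (/ 3 * / t * HM) by ring.
  apply: Rmult_le_compat_l; first lra.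
  apply: (Rle_trans _ (exp 2 * (exp (- (cX / 8 * t)) * (exp (cX / 200 * t) * (t * HM))))).
    apply: Rmult_le_compat_l; first lra.
    by apply: Rmult_le_compat => //; [exact/Rlt_le/Rpower_pos | exact: psum_ge0].
  have -> : exp 2 * (exp (- (cX / 8 * t)) * (exp (cX / 200 * t) * (t * HM))) =
     exp 2 * t * (exp (- (cX / 8 * t)) * exp (cX / 200 * t)) * HM by ring.
  apply: Rmult_le_compat_r => //.
  rewrite -exp_plus.
  apply: (Rle_trans _ (exp 2 * t * / e100)).
    apply: Rmult_le_compat_l; first nra.
    rewrite /e100 -exp_Ropp; apply: exp_le; nra.
  apply: (Rmult_le_reg_r (3 * t * e100)); first nra.
  have -> : exp 2 * t * / e100 * (3 * t * e100) = 3 * exp 2 * (t * t) by field; lra.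
  have -> : / 3 * / t * (3 * t * e100) = e100 by field; lra.
  apply: Rle_trans hk3.
  have : t * t <= t ^ 3 by rewrite /=; nra.
  nra.
have T2 : X0 * ((1 + ln (INR N)) * irad_sum far) <= / 3 * (/ t * X0 * HM).
  have -> : / 3 * (/ t * X0 * HM) = X0 * (/ 3 * / t * HM) by ring.
  apply: Rmult_le_compat_l; first lra.
  apply: (Rle_trans _ ((1 + t) * ((1 + t) * (/ (12 * t ^ 3) * HM)))).
    apply: Rmult_le_compat => //; [lra | lra |].
    by apply: (Rle_trans _ _ _ hGf); apply: Rmult_le_compat_l; lra.
  have -> : (1 + t) * ((1 + t) * (/ (12 * t ^ 3) * HM)) = ((1 + t) * (1 + t)) * / (12 * t ^ 3) * HM by ring.
  apply: Rmult_le_compat_r => //.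
  apply: (Rmult_le_reg_r (12 * t ^ 3)); first lra.
  have -> : (1 + t) * (1 + t) * / (12 * t ^ 3) * (12 * t ^ 3) = (1 + t) * (1 + t) by field; lra.
  have -> : / 3 * / t * (12 * t ^ 3) = 4 * (t * t) by field; lra.
  nra.
have T3 : X0 * (/ sqrt R0 * irad_sum N) <= / 3 * (/ t * X0 * HM).
  have -> : / 3 * (/ t * X0 * HM) = X0 * (/ 3 * / t * HM) by ring.
  apply: Rmult_le_compat_l; first lra.
  apply: (Rle_trans _ (exp (- (cX / 48 * t)) * ((1 + t) * (exp (cX / 200 * t) * (t * HM))))).
    apply: Rmult_le_compat => //; first by left; exact: Rinv_0_lt_compat.
      by rewrite exp_Ropp; apply: Rinv_le_contravar => //; exact: exp_pos.
    by apply: (Rle_trans _ _ _ hGN); apply: Rmult_le_compat_l; lra.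
  have -> : exp (- (cX / 48 * t)) * ((1 + t) * (exp (cX / 200 * t) * (t * HM))) =
     (1 + t) * t * (exp (- (cX / 48 * t)) * exp (cX / 200 * t)) * HM by ring.
  apply: Rmult_le_compat_r => //.
  rewrite -exp_plus.
  apply: (Rle_trans _ ((1 + t) * t * / e100)).
    apply: Rmult_le_compat_l; first nra.
    rewrite /e100 -exp_Ropp; apply: exp_le; nra.
  apply: (Rmult_le_reg_r (3 * t * e100)); first nra.
  have -> : (1 + t) * t * / e100 * (3 * t * e100) = 3 * ((1 + t) * t * t) by field; lra.
  have -> : / 3 * / t * (3 * t * e100) = e100 by field; lra.
  apply: Rle_trans hk3.
  have : (1 + t) * t * t <= 2 * t ^ 3 by rewrite /=; nra.
  nra.
have fin : / t * X0 * HM <= delta k * X0 * HM.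
  by apply: Rmult_le_compat_r => //; apply: Rmult_le_compat_r; lra.
rewrite Rmult_plus_distr_l; lra.
Qed.

(** * Dependence on the constant in front of [n ^ th] *)

(** The range is wide enough for a single [k] to serve both [x] and its quotient by a power of
    [log x]. *)
Definition in_range (k : nat) (x : R) := exp (INR (2 ^ k)%N / 16) <= x /\ (nfloor x < 2 ^ 2 ^ k.-1)%N.

Lemma kdel_small e : 0 < e -> exists k0, (0 < k0)%N /\ forall k, (k0 <= k)%N -> INR k * delta k <= e.
Proof.
move=> e0; have [k0 [k00 hk]] := k_le_rt (/ e).
exists k0; split => // k kk; have := hk k kk.
have k1 : (0 < k)%N := leq_trans k00 kk; have r0 := rt_gt0 k1.
move=> h1; apply: (Rmult_le_reg_r (rt k)) => //.
have -> : INR k * delta k * rt k = INR k by rewrite /delta; field; lra.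
have := Rmult_le_compat_l e _ _ ltac:(lra) h1.
by rewrite -Rmult_assoc Rinv_r ?Rmult_1_l //; lra.
Qed.

(** On the logarithmic scale [kap] moves everything by at most [A * k], which is negligible against
    [2 ^ k]. *)
Lemma range_facts th (A : nat) : 0 < th < 1 -> exists k0, (12 <= k0)%N /\ forall k x kap, (k0 <= k)%N ->
  in_range k x -> / INR (2 ^ (A * k))%N <= kap <= INR (2 ^ (A * k))%N ->
  [/\ 1 <= x, exp (th / 32 * INR (2 ^ k)%N) <= kap * Rpower x th,
      exp ((1 - th) / 32 * INR (2 ^ k)%N) <= crossover th kap x &
      crossover th kap x <= INR (nfloor x) * exp (- (th / 64 * INR (2 ^ k)%N))].
Proof.
move=> hth.
set m := Rmin th (1 - th); have m0 : 0 < m by apply: Rmin_glb_lt; lra.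
have mth : m <= th by exact: Rmin_l. have mth' : m <= 1 - th by exact: Rmin_r.
have [k1 [k10 hk1]] := cube_beats (32 * INR A / m).
have [k2 [k20 hk2]] := t_large (64 / m).
exists (maxn 12 (maxn k1 k2)); split; first by rewrite leq_max.
move=> k x kap; rewrite !geq_max => /and3P[k12 kk1 kk2] [hx hN] [ka kb].
have {}hk1 := hk1 k kk1; have {}hk2 := hk2 k kk2.
have k0 : (0 < k)%N by apply: leq_trans k12.
have kr := INR_ge1 k0.
set t := INR (2 ^ k)%N in hx hk1 hk2 *; have t0 : 0 < t := exp2_gt0 k.
have mt : 64 <= m * t.
  have := Rmult_le_compat_l m _ _ ltac:(lra) hk2.
  by rewrite (_ : m * (64 / m) = 64); [lra | field; lra].
have Ak : INR A * INR k <= m / 32 * t.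
  have h1 := Rmult_le_compat_l (m / 32) _ _ ltac:(lra) hk1.
  have e1 : m / 32 * (32 * INR A / m * INR k ^ 3) = INR A * INR k ^ 3 by field; lra.
  rewrite e1 in h1; have : INR k <= INR k ^ 3 by rewrite /=; nra.
  have := pos_INR A; nra.
have x0 : 0 < x by have := exp_pos (t / 16); lra.
have x1 : 1 <= x by apply: Rle_trans hx; rewrite -exp_0; apply: exp_le; lra.
have lx : t / 16 <= ln x by have := ln_le (exp_pos (t / 16)) hx; rewrite ln_exp.
have q0 := exp2_gt0 (A * k).
have kap0 : 0 < kap by have := Rinv_0_lt_compat _ q0; lra.
have lk : - (m / 32 * t) <= ln kap <= m / 32 * t.
  have l2 : ln (INR (2 ^ (A * k))%N) <= INR A * INR k.
    have ak0 : 0 <= INR A * INR k by apply: Rmult_le_pos; [exact: pos_INR | lra].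
    by rewrite ln_pow2 mult_INR; have := ln2_lt1; nra.
  have h1 := ln_le (Rinv_0_lt_compat _ q0) ka; rewrite ln_Rinv // in h1.
  have h2 := ln_le kap0 kb; lra.
have eX : kap * Rpower x th = exp (ln kap + th * ln x) by rewrite exp_plus exp_ln.
have eL : crossover th kap x = exp ((1 - th) * ln x - ln kap).
  by rewrite /crossover /Rminus exp_plus exp_Ropp exp_ln.
split => //.
- rewrite eX; apply: exp_le; nra.
- rewrite eL; apply: exp_le; nra.
have [f1 f2] := @nfloor_spec x ltac:(lra).
have fx : x / 2 <= INR (nfloor x).
  case: (Rle_lt_dec 2 x) => h1; first lra.
  have : (1 <= nfloor x)%N by rewrite leq_nfloor //=; lra.
  move/INR_le; rewrite [INR 1]/=; lra.
apply: (Rle_trans _ (x / 2 * exp (- (th / 64 * t)))); last first.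
  by apply: Rmult_le_compat_r => //; exact/Rlt_le/exp_pos.
have -> : x / 2 * exp (- (th / 64 * t)) = exp (ln x - ln 2 - th / 64 * t).
  by rewrite /Rminus !exp_plus !exp_Ropp !exp_ln //; lra.
rewrite eL; apply: exp_le; have := ln2_lt1; nra.
Qed.

(** Both parts rest on [count_kappa th kap y] being [sieve_const * kap * y ^ th * W y 1] up to a
    relative error of order [k * delta k], where only the factor [kap] depends on [kap]. In the
    second part the gain comes from [y ^ th] alone, since [W z 1] is bounded by a multiple of
    [W x 1]. *)
Lemma count_kappa_regular th (A : nat) : 0 < th < 1 -> exists C k0, 0 < C /\ (12 <= k0)%N /\ forall k x, (k0 <= k)%N ->
  in_range k x ->
  (forall kap, / INR (2 ^ (A * k))%N <= kap <= INR (2 ^ (A * k))%N ->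
    Rabs (INR (count_kappa th kap x) - kap * INR (count_kappa th 1 x)) <= C * (INR k * delta k) * (kap * INR (count_kappa th 1 x))) /\
  (forall z, in_range k z -> z <= x -> INR (count_kappa th 1 z) <= C * Rpower (z / x) th * INR (count_kappa th 1 x)).
Proof.
move=> hth; set a := th / (1 - th); have a0 : 0 < a by apply: Rdiv_lt_0_compat; lra.
set c := (1 - th) / 32; have c0 : 0 < c by rewrite /c; lra.
set e0 := th / 64; have e00 : 0 < e0 by rewrite /e0; lra.
have cX0 : 0 < th / 32 by lra.
have [k1 [k112 hR]] := range_facts A hth.
have [k2 [k212 hS]] := count_kappa_main hth c0 cX0.
have [CV [k3 [CV0 [k312 hV]]]] := hsum_real_shift a0 A c0 e00.
have [CU [k4 [CU0 hU]]] := hsum_up a0 c0.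
set cl := Rpower (/ 2) a / 3.
have cl0 : 0 < cl by apply: Rdiv_lt_0_compat; [exact: Rpower_pos | lra].
set C' := 2 / cl + 2 * CV.
have icl : 0 < / cl by exact: Rinv_0_lt_compat.
have C'0 : 0 < C' by rewrite /C' /Rdiv; nra.
have [k5 [k50 hk5]] := @kdel_small (/ (2 * CV)) ltac:(apply: Rinv_0_lt_compat; lra).
have [k6 [k60 hk6]] := @kdel_small (/ (4 * C')) ltac:(apply: Rinv_0_lt_compat; lra).
exists (8 * C' + 8 * CU / cl), (maxn k1 (maxn k2 (maxn k3 (maxn k4 (maxn k5 k6))))).
have p8 : 0 < 8 * CU / cl by apply: Rdiv_lt_0_compat; lra.
split; first lra.
split; first by rewrite leq_max k112.
move=> k x; rewrite !geq_max => /andP[kk1 /andP[kk2 /and4P[kk3 kk4 kk5 kk6]]].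
have k0 : (0 < k)%N := leq_trans k50 kk5.
have kr := INR_ge1 k0; have d0 := delta_gt0 k0.
have {}hk5 := hk5 k kk5; have {}hk6 := hk6 k kk6.
set eps := INR k * delta k in hk5 hk6 *.
have eps0 : 0 < eps by rewrite /eps; nra.
have deps : delta k <= eps by rewrite /eps; nra.
have CVe : CV * eps <= / 2.
  have := Rmult_le_compat_l CV _ _ ltac:(lra) hk5.
  by rewrite (_ : CV * / (2 * CV) = / 2) //; field; lra.
have C'e : C' * eps <= / 4.
  have := Rmult_le_compat_l C' _ _ ltac:(lra) hk6.
  by rewrite (_ : C' * / (4 * C') = / 4) //; field; lra.
have q1 : 1 <= INR (2 ^ (A * k))%N by apply: INR_ge1; rewrite expn_gt0.
have one : / INR (2 ^ (A * k))%N <= 1 <= INR (2 ^ (A * k))%N.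
  by split => //; rewrite -[X in _ <= X]Rinv_1; apply: Rinv_le_contravar; lra.
pose W y kap := hsum a (nfloor y) 1 (crossover th kap y).
have ee y : 0 <= y -> exp (- (e0 * INR (2 ^ k)%N)) * y <= y.
  move=> y0; have : exp (- (e0 * INR (2 ^ k)%N)) <= 1; last nra.
  by rewrite -exp_0; apply: exp_le; have := exp2_gt0 k; nra.
have basic y kap : in_range k y -> / INR (2 ^ (A * k))%N <= kap <= INR (2 ^ (A * k))%N ->
   [/\ 0 <= W y kap,
    Rabs (INR (count_kappa th kap y) - sieve_const (nfloor y) * (kap * Rpower y th) * W y kap) <= / cl * eps * (kap * Rpower y th) * W y kap,
    Rabs (W y kap - W y 1) <= 2 * CV * eps * W y 1 & psum (1 * 2) (nfloor (crossover th kap y)) <= / cl * W y kap].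
  move=> ry hk; have [y1 hX hL hLN] := hR k y kap kk1 ry hk.
  have [_ _ hL1 hLN1] := hR k y 1 kk1 ry one.
  have hN : (nfloor y < 2 ^ 2 ^ k.-1)%N by case: ry.
  have kap0 : 0 < kap by have := Rinv_0_lt_compat (INR (2 ^ (A * k))%N) ltac:(lra); lra.
  have LN : crossover th kap y <= INR (nfloor y).
    by apply: (Rle_trans _ _ _ hLN); rewrite Rmult_comm; apply: ee; exact: pos_INR.
  have Lp : 0 < crossover th kap y by exact: crossover_gt0.
  have W0 : 0 <= W y kap by exact: hsum_ge0.
  have W10 : 0 <= W y 1 by apply: hsum_ge0; apply: crossover_gt0; lra.
  have L1 : 1 <= crossover th kap y.
    apply: Rle_trans hL; rewrite -[X in X <= _]exp_0; apply: exp_le.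
    by apply: Rmult_le_pos; [lra | exact/Rlt_le/exp2_gt0].
  have low : psum (1 * 2) (nfloor (crossover th kap y)) <= / cl * W y kap.
    have h1 := @hsum_low a a0 (nfloor y) 1 (crossover th kap y) isT L1 LN.
    apply: (Rmult_le_reg_l cl) => //; rewrite -Rmult_assoc Rinv_r ?Rmult_1_l //; lra.
  have X0 : 0 < kap * Rpower y th by apply: Rmult_lt_0_compat => //; exact: Rpower_pos.
  split => //.
    apply: (Rle_trans _ _ _ (hS k kap y kk2 kap0 y1 hN hL LN hX)).
    have -> : / cl * eps * (kap * Rpower y th) * W y kap = eps * (kap * Rpower y th) * (/ cl * W y kap) by ring.
    apply: Rmult_le_compat; [by apply: Rmult_le_pos; lra | exact: psum_ge0 | by apply: Rmult_le_compat_r; lra | exact: low].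
  (* [hsum_real_shift] measures the error at the larger scale. For [kap < 1] that is the scale of
     [kap], and the error is brought back to [W y 1] through [W y kap <= 2 * W y 1]. *)
  case: (Rle_lt_dec 1 kap) => k1'.
    have e1 : kap * crossover th kap y = crossover th 1 y by rewrite /crossover; field; lra.
    have h1 := hV k (nfloor y) (crossover th kap y) kap kk3 hN k1' (proj2 hk) hL.
    rewrite e1 in h1; have {}h1 := h1 hLN1; rewrite Rabs_minus_sym.
    apply: (Rle_trans _ _ _ h1); rewrite -/eps -/(W y 1).
    apply: Rmult_le_compat_r => //; nra.
  have e1 : / kap * crossover th 1 y = crossover th kap y by rewrite /crossover; field; lra.
  have f1 : 1 <= / kap by rewrite -Rinv_1; apply: Rinv_le_contravar; lra.
  have f2 : / kap <= INR (2 ^ (A * k))%N.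
    rewrite -[X in _ <= X]Rinv_inv; apply: Rinv_le_contravar; last lra.
    apply: Rinv_0_lt_compat; lra.
  have h1 := hV k (nfloor y) (crossover th 1 y) (/ kap) kk3 hN f1 f2 hL1.
  rewrite e1 in h1; have {}h1 := h1 hLN; rewrite -/eps -/(W y 1) -/(W y kap) in h1.
  have h2 := Rabs_def2_le h1.
  have h3 : W y kap <= 2 * W y 1.
    have : CV * eps * W y kap <= / 2 * W y kap by apply: Rmult_le_compat_r.
    lra.
  apply: (Rle_trans _ _ _ h1).
  have -> : 2 * CV * eps * W y 1 = CV * eps * (2 * W y 1) by ring.
  by apply: Rmult_le_compat_l => //; nra.
have asym y kap : in_range k y -> / INR (2 ^ (A * k))%N <= kap <= INR (2 ^ (A * k))%N ->
   Rabs (INR (count_kappa th kap y) - sieve_const (nfloor y) * (kap * Rpower y th) * W y 1) <= C' * eps * (kap * Rpower y th) * W y 1.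
  move=> ry hk; have [W0 b1 b2 _] := basic y kap ry hk.
  have [W10 _ _ _] := basic y 1 ry one.
  have kap0 : 0 < kap by have := Rinv_0_lt_compat (INR (2 ^ (A * k))%N) ltac:(lra); lra.
  set Z := kap * Rpower y th in b1 *.
  have Z0 : 0 < Z by apply: Rmult_lt_0_compat => //; exact: Rpower_pos.
  have [n1 n2] := sieve_const_bounds (nfloor y); set cn := sieve_const _ in b1 n1 n2 *.
  have b2' := Rabs_def2_le b2.
  have Wle : W y kap <= 2 * W y 1.
    have : CV * eps * W y 1 <= / 2 * W y 1 by apply: Rmult_le_compat_r.
    lra.
  have t1 : / cl * eps * Z * W y kap <= 2 / cl * (eps * Z * W y 1).
    have -> : 2 / cl * (eps * Z * W y 1) = / cl * eps * Z * (2 * W y 1) by field; lra.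
    apply: Rmult_le_compat_l => //; apply: Rmult_le_pos; [nra | lra].
  have t2 : Rabs (cn * Z * (W y kap - W y 1)) <= 2 * CV * (eps * Z * W y 1).
    rewrite Rabs_mult (Rabs_pos_eq (cn * Z)); last nra.
    apply: (Rle_trans _ (Z * (2 * CV * eps * W y 1))); last by apply: Req_le; ring.
    apply: Rmult_le_compat => //; [nra | exact: Rabs_pos | nra].
  have -> : INR (count_kappa th kap y) - cn * Z * W y 1 =
    (INR (count_kappa th kap y) - cn * Z * W y kap) + cn * Z * (W y kap - W y 1) by ring.
  apply: (Rle_trans _ _ _ (Rabs_triang _ _)).
  have -> : C' * eps * Z * W y 1 = 2 / cl * (eps * Z * W y 1) + 2 * CV * (eps * Z * W y 1) by rewrite /C'; ring.
  lra.
have low y : in_range k y -> Rpower y th * W y 1 <= 4 * INR (count_kappa th 1 y) /\ INR (count_kappa th 1 y) <= 2 * (Rpower y th * W y 1).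
  move=> ry; have := Rabs_def2_le (asym y 1 ry one); rewrite !Rmult_1_l.
  have [W10 _ _ _] := basic y 1 ry one.
  have [n1 n2] := sieve_const_bounds (nfloor y); have p0 := Rpower_pos y th.
  set Q := Rpower y th * W y 1.
  have Q0 : 0 <= Q by apply: Rmult_le_pos; lra.
  have -> : sieve_const (nfloor y) * Rpower y th * W y 1 = sieve_const (nfloor y) * Q by rewrite /Q; ring.
  have -> : C' * eps * Rpower y th * W y 1 = C' * eps * Q by rewrite /Q; ring.
  have : C' * eps * Q <= / 4 * Q by apply: Rmult_le_compat_r.
  nra.
move=> rx; have [lo1 lo2] := low x rx.
have S0 := pos_INR (count_kappa th 1 x).
split=> [kap hk|z rz zx].
  have kap0 : 0 < kap by have := Rinv_0_lt_compat (INR (2 ^ (A * k))%N) ltac:(lra); lra.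
  have a1 := Rabs_def2_le (asym x kap rx hk); have a2 := Rabs_def2_le (asym x 1 rx one).
  rewrite !Rmult_1_l in a2.
  set Q := Rpower x th * W x 1 in lo1 lo2.
  have e1 : sieve_const (nfloor x) * (kap * Rpower x th) * W x 1 = kap * (sieve_const (nfloor x) * Q) by rewrite /Q; ring.
  have e2 : C' * eps * (kap * Rpower x th) * W x 1 = kap * (C' * eps * Q) by rewrite /Q; ring.
  have e3 : sieve_const (nfloor x) * Rpower x th * W x 1 = sieve_const (nfloor x) * Q by rewrite /Q; ring.
  have e4 : C' * eps * Rpower x th * W x 1 = C' * eps * Q by rewrite /Q; ring.
  rewrite e1 e2 in a1; rewrite e3 e4 in a2.
  have b1 : kap * (C' * eps * Q) <= 4 * C' * eps * (kap * INR (count_kappa th 1 x)).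
    have -> : 4 * C' * eps * (kap * INR (count_kappa th 1 x)) = kap * (C' * eps * (4 * INR (count_kappa th 1 x))) by ring.
    apply: Rmult_le_compat_l; first lra; apply: Rmult_le_compat_l; [nra | lra].
  have b2 : - (kap * (C' * eps * Q)) <= kap * INR (count_kappa th 1 x) - kap * (sieve_const (nfloor x) * Q) <= kap * (C' * eps * Q) by nra.
  have b3 : 0 <= 8 * CU / cl * eps * (kap * INR (count_kappa th 1 x)) by apply: Rmult_le_pos; nra.
  apply: Rabs_le; split; lra.
have [z1 hXz hLz hLNz] := hR k z 1 kk1 rz one.
have hNz : (nfloor z < 2 ^ 2 ^ k.-1)%N by case: rz.
have LNz : crossover th 1 z <= INR (nfloor z).
  by apply: (Rle_trans _ _ _ hLNz); rewrite Rmult_comm; apply: ee; exact: pos_INR.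
have up := hU k 1%N 2%N 3%N (nfloor z) (crossover th 1 z) kk4 (@avoid_1 k) isT isT isT isT isT isT isT hNz hLz LNz.
rewrite -/(W z 1) in up.
have [_ lz] := low z rz.
have [_ _ _ hx] := basic x 1 rx one.
have zp := Rpower_pos z th; have xp := Rpower_pos x th.
have cz0 : 0 < crossover th 1 z by apply: crossover_gt0; lra.
have hm : psum (1 * 2) (nfloor (crossover th 1 z)) <= psum (1 * 2) (nfloor (crossover th 1 x)).
  apply: psum_mono; apply: nfloor_mono; first lra.
  rewrite /crossover; apply: Rmult_le_compat_r; first by rewrite Rinv_1; lra.
  by apply: Rpower_mono; lra.
have Wz : W z 1 <= CU * (/ cl * W x 1).
  by apply: (Rle_trans _ _ _ up); apply: Rmult_le_compat_l; lra.
have x1 : 1 <= x by lra.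
have ezx : Rpower z th = Rpower (z / x) th * Rpower x th.
  rewrite Rpower_mult_distr; [congr Rpower; field; lra | apply: Rdiv_lt_0_compat; lra | lra].
have qp := Rpower_pos (z / x) th.
apply: (Rle_trans _ (2 * (Rpower z th * (CU * (/ cl * W x 1))))).
  by apply: (Rle_trans _ _ _ lz); apply: Rmult_le_compat_l; [lra | apply: Rmult_le_compat_l; lra].
have -> : 2 * (Rpower z th * (CU * (/ cl * W x 1))) = 2 * CU / cl * Rpower (z / x) th * (Rpower x th * W x 1).
  by rewrite ezx; field; lra.
apply: (Rle_trans _ (2 * CU / cl * Rpower (z / x) th * (4 * INR (count_kappa th 1 x)))).
  apply: Rmult_le_compat_l => //; apply: Rmult_le_pos; last lra.
  by left; apply: Rdiv_lt_0_compat; lra.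
have -> : 2 * CU / cl * Rpower (z / x) th * (4 * INR (count_kappa th 1 x)) = 8 * CU / cl * Rpower (z / x) th * INR (count_kappa th 1 x) by field; lra.
apply: Rmult_le_compat_r => //; apply: Rmult_le_compat_r; lra.
Qed.

(** * Conclusion *)

Lemma ln_small D : 0 <= D -> exists v0, 1 <= v0 /\ forall v, v0 <= v -> D * ln v <= v.
Proof.
move=> D0; exists (1 + 4 * D ^ 2); split; first by rewrite /=; nra.
move=> v hv; have v1 : 1 <= v by rewrite /= in hv; nra.
have s0 : 0 < sqrt v by apply: sqrt_lt_R0; lra.
have ss : sqrt v * sqrt v = v by apply: sqrt_sqrt; lra.
have l1 : ln v <= 2 * sqrt v.
  rewrite -{1}ss ln_mult //; have := exp_ineq1_le (ln (sqrt v)); rewrite exp_ln //; lra.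
have s2 : 2 * D <= sqrt v.
  apply: Rsqr_incr_0_var; last lra; rewrite /Rsqr ss; rewrite /= in hv; lra.
nra.
Qed.

Lemma exp_near1 y e : Rabs y <= e -> e <= / 2 -> 1 - 2 * e <= exp y <= 1 + 2 * e.
Proof.
move=> /Rabs_def2_le hy he; have := exp_ineq1_le y => h1; split; first lra.
have h2 := exp_ineq1_le (- e); have e0 : 0 < exp (- e) by exact: exp_pos.
apply: (Rle_trans _ (exp e)); first by apply: exp_le; lra.
rewrite -(Rinv_inv (exp e)) -exp_Ropp.
apply: (Rle_trans _ (/ (1 - e))); first by apply: Rinv_le_contravar; lra.
apply: (Rmult_le_reg_r (1 - e)); first lra.
rewrite Rinv_l; nra.
Qed.

Lemma count_le_in (P Q : pred nat) (s : seq nat) :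
  (forall n, n \in s -> P n -> Q n) -> (count P s <= count Q s)%N.
Proof.
elim: s => [|m s IH] hs //=; apply: leq_add.
  by case Pm: (P m) => //; rewrite (hs m) // inE eqxx.
by apply: IH => n ns; apply: hs; rewrite inE ns orbT.
Qed.

Lemma count_cover (N Nz : nat) (Q Q1 Q2 : pred nat) : (Nz <= N)%N ->
  (forall n, (0 < n <= N)%N -> Q n -> Q1 n || ((n <= Nz)%N && Q2 n)) ->
  (count Q (iota 1 N) <= count Q1 (iota 1 N) + count Q2 (iota 1 Nz))%N.
Proof.
move=> NzN hQ.
apply: (@leq_trans (count (predU Q1 (fun n => (n <= Nz)%N && Q2 n)) (iota 1 N))).
  by apply: count_le_in => n; rewrite mem_iota add1n ltnS => hn; exact: hQ.
rewrite -(leq_add2r (count (predI Q1 (fun n => (n <= Nz)%N && Q2 n)) (iota 1 N))) count_predUI.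
rewrite -addnA leq_add2l; apply: leq_trans (leq_addr _ _).
have -> : iota 1 N = iota 1 Nz ++ iota Nz.+1 (N - Nz) by rewrite -{1}(subnKC NzN) iotaD add1n.
rewrite count_cat [X in (_ + X)%N](_ : _ = 0%N) ?addn0.
  by apply: sub_count => n /andP[].
apply/eqP; rewrite -leqn0 leqNgt -has_count; apply/hasPn => n; rewrite mem_iota => /andP[h1 _].
by rewrite leqNgt h1.
Qed.

Lemma S_th_Sst th x : S_th th x = count_kappa th 1 x.
Proof. by apply: eq_count => m; rewrite Rmult_1_l. Qed.

Lemma S_thTh_count th Th x : 1 <= x -> S_thTh th Th x =
  count (fun n => (1 < n)%N && Rleb (INR (rad n)) (Rpower (INR n) th * Rpower (ln (INR n)) Th)) (iota 1 (nfloor x)).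
Proof.
move=> x1; have N1 : (0 < nfloor x)%N by rewrite leq_nfloor /=; lra.
rewrite /S_thTh -{2}(subnKC N1) iotaD [iota 1 1]/= count_cat [count _ [:: _]]/= add0n add1n.
apply: eq_in_count => n; rewrite mem_iota => /andP[n1 _]; by rewrite n1.
Qed.

Theorem theorem3 (th Th : R) (hth : 0 < th < 1) :
  exists x0 C : R, 0 < C /\
    forall x : R, x0 <= x ->
      Rabs (INR (S_thTh th Th x) - Rpower (ln x) Th * INR (S_th th x))
      <= C * Rpower (ln x) Th * INR (S_th th x) * sqrt (ln (ln x) / ln x).
Proof.
set T := Rabs Th; have T0 : 0 <= T by exact: Rabs_pos.
have hT : Th <= T by exact: Rle_abs. have hT' : - Th <= T by rewrite /T -Rabs_Ropp; exact: Rle_abs.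
have [A hA] := INR_unbounded (T + 3).
(* With this exponent [(z / x) ^ th = v ^ (- (2 T + 1))]: one [v ^ T] pays for the bound [kap0] on
   the small [n], another for [lam >= v ^ (- T)], and [1 / v] remains. *)
set B := (2 * T + 1) / th; have B0 : 0 < B by apply: Rdiv_lt_0_compat; lra.
have [C [k0 [C0 [k012 hreg]]]] := count_kappa_regular A hth.
(* The single condition [D * (l / v) <= 1] yields all the smallness needed: [l / v <= 1],
   [2 * eta <= 1], [2 * eps <= 1] and [C * sg <= 1]. *)
set D := 1 + 2 * B + 8 * T * B + C ^ 2.
have TB : 0 <= T * B by nra.
have C2 : 0 < C ^ 2 by apply: pow_lt.
have D0 : 0 <= D by rewrite /D; lra.
have [v0 [v01 hv0]] := ln_small D0.
set vm := v0 + 8 + INR (2 ^ k0)%N.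
have p2T := Rpower_pos 2 T.
exists (exp vm), (4 * T * B + 2 * C + 2 * C * Rpower 2 T).
split; first by have := Rmult_lt_0_compat _ _ C0 p2T; lra.
move=> x hx; rewrite S_th_Sst.
have x0 : 0 < x by have := exp_pos vm; lra.
set v := ln x.
have ex : x = exp v by rewrite /v exp_ln.
have vvm : vm <= v by rewrite -(ln_exp vm); apply: ln_le => //; exact: exp_pos.
have tk0 := exp2_gt0 k0.
have v8 : 8 <= v by rewrite /vm in vvm; lra.
have hv := hv0 v ltac:(rewrite /vm in vvm; lra).
have lv1 : 1 <= ln v.
  have h1 : 8 <= v := v8.
  have : ln (INR (2 ^ 3)%N) <= ln v by apply: ln_le => /=; lra.
  rewrite ln_pow2 [INR 3]/=; have := ln2_gt; lra.
set l := ln v in hv lv1 *.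
have x1 : 1 <= x by rewrite ex -exp_0; apply: exp_le; lra.
(* This puts [v] between [2 ^ k / 8] and [2 ^ k / 4], so that [x] and also [z], whose logarithm is
   at least [v / 2], satisfy [in_range k]. *)
have [k [ka kb]] := @dyadic_bracket (8 * v) ltac:(lra).
set t := INR (2 ^ k)%N in ka kb; have t0 : 0 < t := exp2_gt0 k.
have kk0 : (k0 <= k)%N.
  have : (2 ^ k0 <= 2 ^ k)%N by apply: leq_of_INR; rewrite -/t; rewrite /vm in vvm; lra.
  by rewrite leq_exp2l.
have kpos : (0 < k)%N by apply: leq_trans kk0; apply: leq_trans k012.
have kr := INR_ge1 kpos.
set sg := sqrt (l / v).
have lv : 0 < l / v by apply: Rdiv_lt_0_compat; lra.
have sg0 : 0 < sg by exact: sqrt_lt_R0.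
have ssg : sg * sg = l / v by apply: sqrt_sqrt; lra.
have kl : INR k <= 4 * l.
  have h1 : ln t <= ln (8 * v) by apply: ln_le.
  rewrite /t ln_pow2 ln_mult in h1; [|lra|lra].
  have h2 : ln 8 <= l by apply: ln_le; lra.
  have := ln2_gt; rewrite -/l in h1; nra.
have kdel : INR k * delta k <= sg.
  apply: Rsqr_incr_0_var; last lra; rewrite /Rsqr ssg.
  have r0 := rt_gt0 kpos; have rs := rt_sq k; rewrite -/t in rs.
  have -> : INR k * delta k * (INR k * delta k) = INR k / t.
    have -> : INR k * delta k * (INR k * delta k) = INR k * INR k / (rt k * rt k) by rewrite /delta; field; lra.
    by rewrite rs; field; lra.
  apply: (Rmult_le_reg_r (t * v)); first nra.
  have -> : INR k / t * (t * v) = INR k * v by field; lra.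
  have -> : l / v * (t * v) = l * t by field; lra.
  nra.
have Dlv : D * (l / v) <= 1.
  apply: (Rmult_le_reg_r v); first lra.
  have -> : D * (l / v) * v = D * l by field; lra.
  lra.
have Csg : C * sg <= 1.
  apply: Rsqr_incr_0_var; last lra; rewrite /Rsqr.
  have -> : C * sg * (C * sg) = C ^ 2 * (l / v) by rewrite -ssg; ring.
  have : 0 <= (1 + 2 * B + 8 * T * B) * (l / v) by apply: Rmult_le_pos; lra.
  rewrite /D in Dlv; lra.
have lvsg : l / v <= sg.
  have : l / v <= 1 by have : 0 <= (2 * B + 8 * T * B + C ^ 2) * (l / v) by [apply: Rmult_le_pos; lra]; rewrite /D in Dlv; lra.
  rewrite -ssg => h1.
  have : sg <= 1 by apply: Rsqr_incr_0_var; rewrite /Rsqr; lra.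
  nra.
have ivsg : / v <= sg.
  apply: Rle_trans lvsg; rewrite -[X in X <= _]Rmult_1_l; apply: Rmult_le_compat_r => //.
  by left; apply: Rinv_0_lt_compat; lra.
set eta := B * (l / v); set eps := 4 * T * eta.
have eta0 : 0 <= eta by rewrite /eta; nra.
have eta2 : 2 * eta <= 1.
  have : 0 <= (1 + 8 * T * B + C ^ 2) * (l / v) by apply: Rmult_le_pos; lra.
  rewrite /D in Dlv; rewrite /eta; lra.
have Teta : 0 <= T * eta by nra.
have eps1 : 2 * eps <= 1.
  have : 0 <= (1 + 2 * B + C ^ 2) * (l / v) by apply: Rmult_le_pos; lra.
  rewrite /D in Dlv; rewrite /eps /eta; lra.
have eps0 : 0 <= eps by rewrite /eps; lra.
have epssg : eps <= 4 * T * B * sg.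
  by rewrite /eps /eta -Rmult_assoc; apply: Rmult_le_compat_l => //; lra.
have tv : t / 8 <= v <= t / 4 by lra.
have t2e : 2 * INR (2 ^ k.-1)%N = t by rewrite /t -{2}(prednK kpos) expnS mult_INR /=; lra.
have rng y : exp (t / 16) <= y -> y <= x -> in_range k y.
  move=> y1 y2; split => //.
  apply/ltP; apply: RIneq.INR_lt.
  have y0 : 0 <= y by have := exp_pos (t / 16); lra.
  have [f1 _] := nfloor_spec y0.
  apply: (@Rle_lt_trans _ x); first lra.
  rewrite exp2_exp ex; apply: exp_increasing; have := ln2_gt; nra.
(* The [n <= z = x / (ln x)^B] are negligible; for the others [ln n] is
   [ln x] up to the factor [1 + O(ln ln x / ln x)]. *)
set z := exp (v - B * l).
have etav : eta * v = B * l by rewrite /eta; field; lra.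
have zv : v / 2 <= v - B * l by rewrite -etav; nra.
have rz : in_range k z.
  apply: rng; first by apply: exp_le; lra.
  by rewrite ex; apply: exp_le; nra.
have rx : in_range k x by apply: rng; [rewrite ex; apply: exp_le; lra | lra].
have zx : z <= x by rewrite ex; apply: exp_le; nra.
have z1 : 1 <= z by rewrite /z -exp_0; apply: exp_le; lra.
have [hU hZ] := hreg k x kk0 rx.
have [hUz _] := hreg k z kk0 rz.
have hzx := hZ z rz zx.
set lam := Rpower v Th; have lam0 : 0 < lam by exact: Rpower_pos.
(* This bounds [(ln n) ^ Th] for all [2 <= n <= z] whatever the sign of [Th]; the factor 2 covers
   negative [Th], where [ln n] may be as small as [ln 2 > 1 / 2]. *)
set kap0 := Rpower (2 * v) T.
have tA : INR (2 ^ (A * k))%N = Rpower t (INR A).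
  by rewrite Rpower_pow //; rewrite mulnC expnM INR_exp.
have t1 : 1 < t by lra.
have lamu : lam <= Rpower v T by apply: Rle_Rpower; lra.
have laml : / Rpower v T <= lam by rewrite -Rpower_Ropp; apply: Rle_Rpower; lra.
have vT : Rpower v T <= Rpower t T by apply: Rpower_mono; lra.
have vT1 : 1 <= Rpower v T.
  have -> : 1 = Rpower v 0 by rewrite Rpower_O //; lra.
  by apply: Rle_Rpower; lra.
have tT1 : 2 * Rpower t T <= Rpower t (INR A).
  apply: (Rle_trans _ (Rpower t 1 * Rpower t T)).
    by apply: Rmult_le_compat_r; [exact/Rlt_le/Rpower_pos | rewrite Rpower_1; lra].
  by rewrite -Rpower_plus; apply: Rle_Rpower; lra.
have kap0le : kap0 <= Rpower t T by apply: Rpower_mono; lra.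
have kap01 : 1 <= kap0.
  have -> : 1 = Rpower (2 * v) 0 by rewrite Rpower_O //; lra.
  by apply: Rle_Rpower; lra.
have vTk : Rpower v T <= kap0 by apply: Rpower_mono; lra.
have iA : / Rpower t (INR A) <= / (2 * Rpower v T) by apply: Rinv_le_contravar; lra.
have iv2 : / (2 * Rpower v T) = / 2 * / Rpower v T by field; lra.
have krange q : / 2 * lam <= q -> q <= 2 * Rpower t T -> / INR (2 ^ (A * k))%N <= q <= INR (2 ^ (A * k))%N.
  move=> h1 h2; rewrite tA; split; last lra.
  apply: (Rle_trans _ _ _ iA); rewrite iv2; lra.
have S0 := pos_INR (count_kappa th 1 x). set S := INR (count_kappa th 1 x) in S0 hU hzx *.
have logcmp n : (0 < n)%N -> z < INR n -> INR n <= x ->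
   lam * (1 - eps) <= Rpower (ln (INR n)) Th <= lam * (1 + eps).
  move=> n0 zn nx; set u := ln (INR n).
  have u1 : v - B * l <= u by rewrite -(ln_exp (v - B * l)); apply: ln_le; [exact: exp_pos | rewrite -/z; lra].
  have u2 : u <= v by apply: ln_le => //; exact: INR_pos.
  have u0 : 0 < u by lra.
  have eu : u = v * (u / v) by field; lra.
  have r1 : 1 - eta <= u / v <= 1.
    by split; apply: (Rmult_le_reg_r v); lra.
  have r0 : 0 < u / v by apply: Rdiv_lt_0_compat; lra.
  have lr : Rabs (ln (u / v)) <= 2 * eta.
    apply: Rabs_le; split.
      have h1 := @one_sub_exp eta ltac:(lra).
      rewrite -(ln_exp (- (2 * eta))); apply: ln_le; [exact: exp_pos | lra].
    apply: (@Rle_trans _ 0); last lra.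
    by rewrite -ln_1; apply: ln_le; lra.
  have hy : Rabs (Th * ln (u / v)) <= 2 * (T * eta).
    rewrite Rabs_mult -/T.
    have -> : 2 * (T * eta) = T * (2 * eta) by ring.
    exact: Rmult_le_compat_l.
  have he : 2 * (T * eta) <= / 2 by rewrite /eps in eps1; lra.
  have [h1 h2] := exp_near1 hy he.
  have -> : Rpower u Th = lam * exp (Th * ln (u / v)).
    by rewrite {1}eu -Rpower_mult_distr //; lra.
  split; apply: Rmult_le_compat_l; rewrite /eps; lra.
have N0 : 0 <= x by lra. have z0 : 0 <= z by lra.
have NzN : (nfloor z <= nfloor x)%N by apply: nfloor_mono.
have hn n : (0 < n <= nfloor x)%N -> INR n <= x by case/andP=> _ /(leq_nfloor _ N0).
have zn n : ~~ (n <= nfloor z)%N -> z < INR n.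
  by move=> h1; apply: Rnot_le_lt => h2; move/negP: h1; apply; rewrite leq_nfloor.
have rp n : 0 < Rpower (INR n) th by exact: Rpower_pos.
have upc : INR (S_thTh th Th x) <= INR (count_kappa th (lam * (1 + eps)) x) + INR (count_kappa th kap0 z).
  rewrite S_thTh_count // -plus_INR; apply: INR_le; apply: count_cover => // n hN /andP[n1 /RlebP hc].
  have n0 : (0 < n)%N by case/andP: hN.
  case: (boolP (n <= nfloor z)%N) => hz.
    rewrite /=; apply/orP; right; apply/RlebP; apply: (Rle_trans _ _ _ hc); rewrite Rmult_comm.
    apply: Rmult_le_compat_r; first exact/Rlt_le.
    have ln2n : / 2 <= ln (INR n).
      have : 2 <= INR n by have := INR_le n1; rewrite /=; lra.
      by move=> h2; have := @ln_le 2 (INR n) ltac:(lra) h2; have := ln2_gt; lra.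
    have lnv : ln (INR n) <= v by apply: ln_le; [exact: INR_pos | exact: hn].
    case: (Rle_lt_dec 0 Th) => hTh.
      apply: (Rle_trans _ (Rpower (2 * v) Th)); first by apply: Rpower_mono; lra.
      by apply: Rle_Rpower; lra.
    have -> : Th = - (- Th) by lra.
    rewrite Rpower_Ropp.
    apply: (Rle_trans _ (/ Rpower (/ 2) (- Th))).
      by apply: Rinv_le_contravar; [exact: Rpower_pos | apply: Rpower_mono; lra].
    have -> : / Rpower (/ 2) (- Th) = Rpower 2 (- Th).
      by rewrite -Rpower_Ropp /Rpower ln_Rinv; [congr exp; ring | lra].
    apply: (Rle_trans _ (Rpower 2 T)); first by apply: Rle_Rpower; lra.
    by apply: Rpower_mono; lra.
  rewrite orbF; apply/RlebP; apply: (Rle_trans _ _ _ hc); rewrite Rmult_comm.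
  apply: Rmult_le_compat_r; first exact/Rlt_le.
  by case: (logcmp n n0 (zn n hz) (hn n hN)).
have loc : INR (count_kappa th (lam * (1 - eps)) x) <= INR (S_thTh th Th x) + INR (count_kappa th kap0 z).
  rewrite S_thTh_count // -plus_INR; apply: INR_le; apply: count_cover => // n hN /RlebP hc.
  have n0 : (0 < n)%N by case/andP: hN.
  case: (boolP (n <= nfloor z)%N) => hz.
    apply/orP; right; apply/RlebP; apply: (Rle_trans _ _ _ hc).
    apply: Rmult_le_compat_r; first exact/Rlt_le.
    have : lam * (1 - eps) <= lam by have := Rmult_le_pos _ _ (Rlt_le _ _ lam0) eps0; lra.
    lra.
  rewrite orbF.
  have zl := zn n hz.
  have -> : (1 < n)%N by apply/ltP; apply: RIneq.INR_lt; rewrite [INR 1]/=; lra.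
  apply/RlebP; apply: (Rle_trans _ _ _ hc); rewrite Rmult_comm.
  apply: Rmult_le_compat_l; first exact/Rlt_le.
  by case: (logcmp n n0 zl (hn n hN)).
set U := lam * S; have U0 : 0 <= U by apply: Rmult_le_pos; lra.
set ck := C * (INR k * delta k) in hU hUz.
have ck1 : ck <= C * sg by apply: Rmult_le_compat_l; lra.
have ck0 : 0 <= ck by apply: Rmult_le_pos; [lra | apply: Rmult_le_pos; [lra | exact/Rlt_le/delta_gt0]].
have m0 : 0 <= lam * eps by apply: Rmult_le_pos; lra.
have m1 : lam * eps <= lam * / 2 by apply: Rmult_le_compat_l; lra.
have up1 := Rabs_def2_le (hU (lam * (1 + eps)) (krange (lam * (1 + eps)) ltac:(lra) ltac:(lra))).
have lo1 := Rabs_def2_le (hU (lam * (1 - eps)) (krange (lam * (1 - eps)) ltac:(lra) ltac:(lra))).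
have e1 : lam * (1 + eps) * S = U + eps * U by rewrite /U; ring.
have e2 : lam * (1 - eps) * S = U - eps * U by rewrite /U; ring.
rewrite e1 in up1; rewrite e2 in lo1.
have kz : INR (count_kappa th kap0 z) <= 2 * C * Rpower 2 T * sg * U.
  have r : / INR (2 ^ (A * k))%N <= kap0 <= INR (2 ^ (A * k))%N.
    rewrite tA; split; last by have := Rpower_pos t T; lra.
    apply: (@Rle_trans _ 1) => //; rewrite -Rinv_1; apply: Rinv_le_contravar; first lra.
    lra.
  have h1 := Rabs_def2_le (hUz kap0 r); set Sz := INR (count_kappa th 1 z) in h1 hzx.
  have Sz0 : 0 <= Sz by exact: pos_INR.
  have kS : 0 <= kap0 * Sz by apply: Rmult_le_pos; lra.
  have h2 : INR (count_kappa th kap0 z) <= 2 * (kap0 * Sz).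
    have : ck * (kap0 * Sz) <= 1 * (kap0 * Sz) by apply: Rmult_le_compat_r => //; lra.
    lra.
  apply: (Rle_trans _ _ _ h2).
  have ez : Rpower (z / x) th = / Rpower v (2 * T + 1).
    have -> : z / x = exp (- (B * l)) by rewrite /z ex /Rdiv -exp_Ropp -exp_plus; congr exp; ring.
    rewrite -Rpower_Ropp /Rpower ln_exp -/l; congr exp.
    have eB : th * B = 2 * T + 1 by rewrite /B; field; lra.
    by rewrite -eB; ring.
  have -> : 2 * C * Rpower 2 T * sg * U = 2 * (C * Rpower 2 T * (sg * lam) * S) by rewrite /U; ring.
  apply: Rmult_le_compat_l; first lra.
  apply: (Rle_trans _ (kap0 * (C * Rpower (z / x) th * S))); first by apply: Rmult_le_compat_l; lra.
  have -> : kap0 * (C * Rpower (z / x) th * S) = C * (kap0 * Rpower (z / x) th) * S by ring.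
  apply: Rmult_le_compat_r => //; rewrite Rmult_assoc; apply: Rmult_le_compat_l; first lra.
  rewrite ez /kap0 -Rpower_mult_distr; [|lra|lra].
  rewrite Rmult_assoc; apply: Rmult_le_compat_l; first lra.
  rewrite !Rpower_plus Rpower_1; last lra.
  have -> : Rpower v (2 * T) = Rpower v T * Rpower v T by rewrite -Rpower_plus; congr Rpower; ring.
  have -> : Rpower v T * / (Rpower v T * Rpower v T * v) = / v * / Rpower v T by field; lra.
  apply: Rmult_le_compat => //; left; apply: Rinv_0_lt_compat; lra.
rewrite -/lam -/S.
have -> : (4 * T * B + 2 * C + 2 * C * Rpower 2 T) * lam * S * sg =
  4 * T * B * sg * U + 2 * (C * sg * U) + 2 * C * Rpower 2 T * sg * U by rewrite /U; ring.
have f1 : eps * U <= 4 * T * B * sg * U by apply: Rmult_le_compat_r.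
have f0 : 0 <= eps * U by apply: Rmult_le_pos.
have f2 : ck * (U + eps * U) <= 2 * (C * sg * U).
  have eU : eps * U <= 1 * U by apply: Rmult_le_compat_r; lra.
  have : ck * (U + eps * U) <= C * sg * (2 * U) by apply: Rmult_le_compat; lra.
  lra.
have f3 : ck * (U - eps * U) <= 2 * (C * sg * U).
  have : ck * (U - eps * U) <= ck * (U + eps * U) by apply: Rmult_le_compat_l; lra.
  lra.
apply: Rabs_le; rewrite -/U; split; lra.
Qed.
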